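(* Let $\sigma>0$, $z\sim N(0,\sigma^2 I_n)$, and let $f=(f_1,\dots,f_n)^\top:\mathbb{R}^n\to\mathbb{R}^n$ and $g:\mathbb{R}^n\to\mathbb{R}$ be such that the functions $x\mapsto f_i(\sigma x)$, $i=1,\dots,n$, and $x\mapsto g(\sigma x)$ all belong to $W^{1,2}(\gamma_n)$. Let $\tilde V(g)=\operatorname{Var}(g(z))-\sigma^2\mathbb{E}[\|\nabla g(z)\|^2]$. Then $$\operatorname{Var}\big(z^\top f(z)-\sigma^2\operatorname{div} f(z)-g(z)\big)=\mathbb{E}\Big[\sigma^2\|f(z)-\nabla g(z)\|^2+\sigma^4\operatorname{trace}\big((\nabla f(z))^2\big)\Big]+\tilde V(g)$$ $$\le \mathbb{E}\Big[\sigma^2\|f(z)-\nabla g(z)\|^2+\sigma^4\operatorname{trace}\big((\nabla f(z))^2\big)\Big].$$ In particular, taking $g(x)=x^\top f(x)$, when for this choice of $g$ the function $x\mapsto g(\sigma x)=\sigma x^\top f(\sigma x)$ belongs to $W^{1,2}(\gamma_n)$, $$\operatorname{Var}[\operatorname{div} f(z)]=\mathbb{E}\big[\operatorname{trace}((\nabla f(z))^2)\big]+\operatorname{Var}\big[z^\top f(z)/\sigma^2\big]-\mathbb{E}\big[\|f(z)/\sigma\|^2\big]-2\,\mathbb{E}\big[f(z)^\top(\nabla f(z))z/\sigma^2\big]$$ $$\le \mathbb{E}\big[\operatorname{trace}((\nabla f(z))^2)\big]+\mathbb{E}\big[\|(\nabla f(z))z/\sigma\|^2\big].$$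
   Context: $\|\cdot\|$ is the Euclidean norm, $\operatorname{div} f=\sum_i\partial f_i/\partial x_i$. For $f:\mathbb{R}^n\to\mathbb{R}^n$, $\nabla f\in\mathbb{R}^{n\times n}$ is the matrix whose columns are the gradients $\nabla f_1,\dots,\nabla f_n$, i.e. $(\nabla f)_{ji}=\partial f_i/\partial x_j$. $\gamma_n$ is the standard Gaussian measure on $\mathbb{R}^n$, and $W^{1,2}(\gamma_n)$ is the set of locally integrable, weakly differentiable $g:\mathbb{R}^n\to\mathbb{R}$ with $\int (g^2+\|\nabla g\|^2)\,d\gamma_n<\infty$ (equivalently the completion of $C_0^\infty(\mathbb{R}^n)$ in the corresponding norm). Derivatives are weak derivatives. *)

(* Defs.v *)
From HB Require Import structures.
From mathcomp Require Import all_boot all_order all_algebra.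
From mathcomp Require Import all_classical all_reals all_analysis.
Set Implicit Arguments.
Unset Strict Implicit.
Unset Printing Implicit Defensive.
Import Order.TTheory GRing.Theory Num.Theory.
Import numFieldNormedType.Exports.
Local Open Scope classical_set_scope.
Local Open Scope ring_scope.

(* R^n is 'rV[R]_n, a vector x being the row of its coordinates x 0 i, so the
   transpose x^T of the column-vector notation is the row x itself. *)

Definition rV_display : measure_display -> measure_display.
Proof. exact. Qed.

(* Product sigma-algebra, as for n.-tuple T in the library; for T = R it is the
   Borel sigma-algebra of R^n. *)
Section measurable_rV.
Context {d} {T : measurableType d} {n : nat}.

Let coord : 'I_n -> 'rV[T]_n -> T := fun i x => x 0 i.

HB.instance Definition _ := @isMeasurable.Build (rV_display d) 'rV[T]_n
  (g_sigma_preimage coord) (@sigma_algebra0 _ _ _) (@sigma_algebraC _ _)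
  (@sigma_algebra_bigcup _ _ _).

End measurable_rV.

Lemma measurable_coord {d} {T : measurableType d} n (i : 'I_n) :
  measurable_fun [set: 'rV[T]_n] (fun x => x 0 i).
Proof.
move=> _ Y mY; rewrite setTI; apply: sub_sigma_algebra => /=.
rewrite -bigcup_seq/=; exists i => /=; first by rewrite mem_index_enum.
by exists Y => //; rewrite setTI.
Qed.

Lemma measurable_fun_rVP {d1 d2} {T1 : measurableType d1}
    {T2 : measurableType d2} n (f : T1 -> 'rV[T2]_n) :
  measurable_fun setT f <-> forall i, measurable_fun setT (fun x => f x 0 i).
Proof.
split=> [mf i|mf]; first exact: (measurableT_comp (measurable_coord i) mf).
move=> _ A mA; rewrite setTI.
have := g_sigma_preimage_comp (fun (i : 'I_n) (x : 'rV[T2]_n) => x 0 i) f.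
move=> e; suff : g_sigma_preimage (fun i => (fun x : 'rV[T2]_n => x 0 i) \o f)
    `<=` measurable.
  by apply; rewrite e; exists A => //; rewrite setTI.
apply: smallest_sub; first exact: sigma_algebra_measurable.
rewrite -bigcup_seq; apply: bigcup_sub => i _.
by move=> _ [B mB <-]; exact: mf.
Qed.

Section rV_measure.
Context {R : realType}.

(* The copy of R with its Borel sigma-algebra on which the library puts
   lebesgue_measure and normal_prob. *)
Local Notation mR := (measurableTypeR R).

Definition cons_rV n (p : mR * 'rV[R]_n) : 'rV[R]_n.+1 :=
  \row_i oapp (fun j => p.2 0 j) p.1 (unlift 0 i).

Lemma measurable_cons_rV n : measurable_fun setT (@cons_rV n).
Proof.
apply/measurable_fun_rVP => i; rewrite /cons_rV.
under eq_fun do rewrite mxE.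
case: unlift => [j|] /=; last exact: measurable_fst.
exact: (measurableT_comp (measurable_coord j) measurable_snd).
Qed.

Section cons_measure.
Variables (n : nat) (mu : {sigma_finite_measure set mR -> \bar R}).
Variable nu : {sigma_finite_measure set 'rV[R]_n -> \bar R}.

Definition cons_measure : set 'rV[R]_n.+1 -> \bar R :=
  pushforward (mu \x nu)%E (@cons_rV n).

Let cons_measure0 : cons_measure set0 = 0%E.
Proof. by rewrite /cons_measure /pushforward preimage_set0 measure0. Qed.

Let mcons A : measurable A -> measurable (@cons_rV n @^-1` A).
Proof.
by move=> mA; rewrite -[X in measurable X]setTI; exact: measurable_cons_rV.
Qed.

Let cons_measure_ge0 A : (0 <= cons_measure A)%E.
Proof. by rewrite /cons_measure /pushforward measure_ge0. Qed.

Let cons_measure_sigma_additive : semi_sigma_additive cons_measure.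
Proof.
move=> F mF tF mUF; rewrite /cons_measure /pushforward preimage_bigcup.
apply: measure_semi_sigma_additive.
- by move=> k; exact: mcons.
- apply/trivIsetP => /= i j _ _ ij; rewrite -preimage_setI.
  by move/trivIsetP : tF => /(_ _ _ _ _ ij) ->//; rewrite preimage_set0.
- by rewrite -preimage_bigcup; exact: mcons.
Qed.

HB.instance Definition _ := isMeasure.Build _ _ _ cons_measure
  cons_measure0 cons_measure_ge0 cons_measure_sigma_additive.

Let uncons (x : 'rV[R]_n.+1) : mR * 'rV[R]_n := (x 0 0, \row_j x 0 (lift 0 j)).

Let cons_rVK : cancel (@cons_rV n) uncons.
Proof.
move=> [a x]; rewrite /uncons /cons_rV !mxE unlift_none /=; congr pair.
by apply/rowP => j; rewrite !mxE liftK.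
Qed.

Let measurable_uncons : measurable_fun setT uncons.
Proof.
apply/measurable_fun_pairP; split; first exact: measurable_coord.
apply/measurable_fun_rVP => i /=.
under eq_fun do rewrite mxE.
exact: measurable_coord.
Qed.

Let cons_measure_sigma_finite : sigma_finite setT cons_measure.
Proof.
have /sigma_finiteP[F [TF ndF Foo]] := sigma_finiteT mu.
have /sigma_finiteP[G [TG ndG Goo]] := sigma_finiteT nu.
exists (fun k => uncons @^-1` (F k `*` G k)).
  rewrite -preimage_bigcup -[LHS](preimage_setT uncons); congr (_ @^-1` _).
  rewrite -setXTT TF TG predeqE => -[x y]; split.
    move=> [/= [j _ Fjx] [k _ Gky]]; exists (maxn j k) => //; split.
    - by move: x Fjx; exact/subsetPset/ndF/leq_maxl.
    - by move: y Gky; exact/subsetPset/ndG/leq_maxr.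
  by move=> [j _ []/= ? ?]; split; exists j.
move=> k; have [mF Fk] := Foo k; have [mG Gk] := Goo k; split.
  by rewrite -[X in measurable X]setTI; apply: measurable_uncons => //;
    exact: measurableX.
rewrite /cons_measure /pushforward -comp_preimage.
rewrite (_ : uncons \o _ = id); last by apply/funext => p /=; rewrite cons_rVK.
by rewrite product_measure1E// lte_mul_pinfty// ge0_fin_numE.
Qed.

HB.instance Definition _ := Measure_isSigmaFinite.Build _ _ _ cons_measure
  cons_measure_sigma_finite.

End cons_measure.

(* n-fold product measure: mu_0 is the unit mass at the point of R^0, and
   mu_(n+1) is the image of mu \x mu_n under (a, x) |-> (a, x_0, ..., x_(n-1)) *)
Fixpoint prod_rV (mu : {sigma_finite_measure set mR -> \bar R}) n :
    {sigma_finite_measure set 'rV[R]_n -> \bar R} :=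
  if n is k.+1 then cons_measure mu (prod_rV mu k) else dirac (0 : 'rV[R]_0).

Lemma prod_rVE (mu : {sigma_finite_measure set mR -> \bar R}) n
    (A : 'I_n -> set mR) : (forall i, measurable (A i)) ->
  prod_rV mu n [set x | forall i, A i (x 0 i)] = (\prod_(i < n) mu (A i))%E.
Proof.
elim: n A => [|n IH] A mA.
  by rewrite big_ord0 /= /dirac indicE mem_set // => -[].
pose B := [set x : 'rV[R]_n | forall i, A (lift 0 i) (x 0 i)].
have mB : measurable B.
  rewrite (_ : B = \bigcap_(i in [set: 'I_n])
      ((fun x : 'rV[R]_n => x 0 i) @^-1` A (lift 0 i))); last first.
    by apply/seteqP; split=> [x Ax i _|x Ax i]; exact: Ax.
  apply: fin_bigcap_measurable => // i _.
  rewrite -[X in measurable X]setTI.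
  exact: (measurable_coord i measurableT (mA (lift 0 i))).
rewrite big_ord_recl -(IH (A \o lift 0))//= -/B -product_measure1E//.
rewrite /cons_measure /pushforward.
congr (_ \x _)%E; apply/seteqP; split=> [[a x] /= Ax|[a x] /= [Aa Ax] i].
  split; first by have := Ax ord0; rewrite mxE unlift_none.
  by move=> i; have := Ax (lift ord0 i); rewrite mxE liftK.
by rewrite mxE; case: unliftP => [j ->|->].
Qed.

Definition lebesgue_rV n : {sigma_finite_measure set 'rV[R]_n -> \bar R} :=
  prod_rV (@lebesgue_measure R) n.

(* N(0, sigma^2 I_n); the second argument of the library's normal_prob is the
   standard deviation. *)
Definition normal_rV n (sigma : R) : set 'rV[R]_n -> \bar R :=
  prod_rV (normal_prob 0 sigma) n.

Let normal_rV_setT n sigma : normal_rV sigma [set: 'rV[R]_n] = 1%E.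
Proof.
have -> : [set: 'rV[R]_n] = [set x | forall i, [set: mR] (x 0 i)].
  by apply/seteqP; split.
rewrite /normal_rV (prod_rVE _ (fun=> measurableT)).
by rewrite big1// => i _; exact: (probability_setT (normal_prob 0 sigma)).
Qed.

HB.instance Definition _ n sigma := SigmaFiniteMeasure.on (@normal_rV n sigma).
HB.instance Definition _ n sigma :=
  Measure_isProbability.Build _ _ _ (@normal_rV n sigma) (normal_rV_setT n sigma).

End rV_measure.

Section sobolev.
Context {R : realType} {n : nat}.
Implicit Types (u v : 'rV[R]_n) (phi g h : 'rV[R]_n -> R).

Definition dotv u v : R := \sum_i u 0 i * v 0 i.

(* The library's norm on 'rV[R]_n is the sup norm. *)
Definition enorm u : R := Num.sqrt (\sum_i u 0 i ^+ 2).

Definition pderiv (i : 'I_n) phi : 'rV[R]_n -> R := 'D_(delta_mx 0 i) phi.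

Definition smooth phi := forall s : seq 'I_n,
  let psi := foldr pderiv phi s in
  continuous psi /\ forall i x, derivable psi x (delta_mx 0 i).

Definition test_function phi :=
  smooth phi /\ compact (closure [set x | phi x != 0]).

Definition locally_integrable_rV g := measurable_fun setT g /\
  forall K : set 'rV[R]_n, compact K ->
    (\int[lebesgue_rV n]_(x in K) `|g x|%:E < +oo)%E.

Definition weak_pderiv (i : 'I_n) g h := forall phi, test_function phi ->
  (\int[lebesgue_rV n]_x (g x * pderiv i phi x)%:E =
   - \int[lebesgue_rV n]_x (h x * phi x)%:E)%E.

Definition is_weak_gradient g (G : 'rV[R]_n -> 'rV[R]_n) := forall i,
  locally_integrable_rV (fun x => G x 0 i) /\
  weak_pderiv i g (fun x => G x 0 i).

Definition weakly_differentiable g := exists G, is_weak_gradient g G.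

(* A version of the weak gradient, unique up to a Lebesgue-null set; arbitrary
   if g is not weakly differentiable. *)
Definition wgrad g : 'rV[R]_n -> 'rV[R]_n := get [set G | is_weak_gradient g G].

Definition W12_gauss g :=
  [/\ locally_integrable_rV g, weakly_differentiable g &
      (\int[normal_rV 1]_x (g x ^+ 2 + enorm (wgrad g x) ^+ 2)%:E < +oo)%E].

Implicit Type f : 'rV[R]_n -> 'rV[R]_n.

(* Column i is the gradient of the i-th component of f: the transpose of the
   Jacobian matrix. *)
Definition nabla f x : 'M[R]_n := \matrix_(j, i) wgrad (fun y => f y 0 i) x 0 j.

Definition wdiv f x : R := \sum_i wgrad (fun y => f y 0 i) x 0 i.

End sobolev.

(* Main.v *)
(** Let del_i p = x_i p - d_i p, the adjoint of d_i in L^2(gamma_n) by Gaussian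
    integration by parts. As [d_j, del_i] is the identity if i = j and 0 otherwise,
    E[del_i p * del_j q] = [i = j] E[p q] + E[d_j p * d_i q]. For sigma = 1 one has
    z^T f - div f = sum_i del_i f_i, and E[(sum_i del_i f_i) g] = E[f^T grad g], which
    gives the equality; the inequality is the Gaussian Poincare inequality.

    For polynomials all this is algebra, the Poincare inequality because
    L = sum_i del_i d_i maps onto the polynomials p of mean zero: if p = L r, then
    E[p^2] = E[(grad r)^T (grad p)], while E[|grad r|^2] <= E[(L r)^2].
    Polynomials are dense in L^2(gamma_n), and the gradient of the orthogonal
    projection of u on the polynomials of degree N+1 is the projection of grad u on
    those of degree N; hence the identities and the inequality extend to W^{1,2}.

    A weak derivative is paired with a polynomial q through the test functions
    chi_k q rho, with rho the Gaussian density and chi_k cutoffs tending to 1. The case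
    of any sigma follows by rescaling, and the second part from g(x) = x^T f(x), whose
    gradient is f(x) + (nabla f(x)) x. *)

Require Import Defs.
From mathcomp Require Import all_boot all_order all_algebra finmap.
From mathcomp Require Import all_classical all_reals all_analysis.
From mathcomp Require Import ring lra measurable_realfun.
Import Order.TTheory GRing.Theory Num.Theory.
Import numFieldNormedType.Exports.
Local Open Scope classical_set_scope.
Local Open Scope ring_scope.
Set Implicit Arguments.
Unset Strict Implicit.
Unset Printing Implicit Defensive.

(** * Square-integrable functions on a probability space *)

(** The analytic core is the density of the polynomials. Bounded functions that multiply polynomials
    into their L^2-closure are produced from sines, whose Taylor polynomials are dominated by
    exponentials of the l1 norm. Iterating a cubic turns sines into signs, hence into indicators of
    orthants, and a Dynkin argument reaches all measurable sets.

    Two obstacles shape the rest. Before del_i u makes sense in L^2, x_i u must be shown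
    square-integrable; this comes from E[(del_i p)^2] = E[p^2] + E[(d_i p)^2] on polynomials, by
    truncating x_i. And W^{1,2} refers to one chosen version of the weak gradient, while dilations
    and the product x^T f produce other versions: almost everywhere uniqueness is what makes these
    square-integrable too.

    L is onto because it acts on the top-degree part of a polynomial as multiplication by the
    degree, and E[(L r)^2] exceeds E[|grad r|^2] by the sum of the E[(d_i d_j r)^2]. Passing to x
    |-> sigma f(sigma x) absorbs every power of sigma. *)

Lemma fct_scalerAl (T : Type) (R : realType) (c : R) (u v : T -> R) :
  (c *: u) * v = c *: (u * v).
Proof. by apply/funext => x; exact/esym/mulrA. Qed.

Lemma fct_scalerAr (T : Type) (R : realType) (c : R) (u v : T -> R) :
  u * (c *: v) = c *: (u * v).
Proof. by rewrite mulrC fct_scalerAl mulrC. Qed.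

Section L2.
Context {d : measure_display} {T : measurableType d} {R : realType}.
Variable mu : probability T R.
Implicit Types u v w : T -> R.

Definition intg u := mu.-integrable setT (EFin \o u).
Definition Ex u : R := \int[mu]_x u x.

Lemma intg_mfun u : intg u -> measurable_fun setT u.
Proof. by move=> /integrableP[/measurable_EFinP]. Qed.

Lemma intgD u v : intg u -> intg v -> intg (u + v).
Proof. by move=> iu iv; rewrite /intg (_ : _ \o _ = (EFin \o u) \+ (EFin \o v))%E //; exact: integrableD. Qed.

Lemma intgZ (c : R) u : intg u -> intg (c *: u).
Proof. by move=> iu; exact: (integrableZl measurableT c iu). Qed.

Lemma intgN u : intg u -> intg (- u).
Proof. by move=> iu; rewrite -scaleN1r; exact: intgZ. Qed.

Lemma intgB u v : intg u -> intg v -> intg (u - v).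
Proof. by move=> iu iv; apply: intgD => //; exact: intgN. Qed.

Lemma intg_le u v : measurable_fun setT u -> (forall x, `|u x| <= v x) ->
  intg v -> intg u.
Proof.
move=> mu_ uv iv; apply: le_integrable iv => //; first exact/measurable_EFinP.
by move=> x _ /=; rewrite lee_fin (le_trans (uv x))// ler_norm.
Qed.

Lemma intg_cst c : intg (fun=> c).
Proof. exact: finite_measure_integrable_cst. Qed.

Lemma intg0 : intg 0. Proof. exact: intg_cst. Qed.

Lemma intg_sum I (r : seq I) (P : pred I) (F : I -> T -> R) :
  (forall i, P i -> intg (F i)) -> intg (\sum_(i <- r | P i) F i).
Proof. by move=> h; apply: (big_ind intg) => //; [exact: intg0|exact: intgD]. Qed.

Lemma ExD u v : intg u -> intg v -> Ex (u + v) = Ex u + Ex v.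
Proof. by move=> iu iv; rewrite /Ex -RintegralD. Qed.

Lemma ExZ c u : intg u -> Ex (c *: u) = c * Ex u.
Proof. by move=> iu; rewrite /Ex -RintegralZl. Qed.

Lemma ExN u : intg u -> Ex (- u) = - Ex u.
Proof. by move=> iu; rewrite -scaleN1r ExZ// mulN1r. Qed.

Lemma ExB u v : intg u -> intg v -> Ex (u - v) = Ex u - Ex v.
Proof. by move=> iu iv; rewrite ExD ?ExN//; exact: intgN. Qed.

Lemma Ex_cst c : Ex (fun=> c) = c.
Proof. rewrite /Ex Rintegral_cst// [X in fine X](_ : _ = 1%E) ?mulr1//.
exact: probability_setT. Qed.

Lemma Ex0 : Ex 0 = 0. Proof. exact: Ex_cst. Qed.

Lemma Ex_sum I (r : seq I) (P : pred I) (F : I -> T -> R) :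
  (forall i, P i -> intg (F i)) ->
  Ex (\sum_(i <- r | P i) F i) = \sum_(i <- r | P i) Ex (F i).
Proof.
move=> h; elim: r => [|i r IH]; first by rewrite !big_nil Ex0.
rewrite !big_cons; case: ifPn => // Pi.
by rewrite ExD ?IH//; [exact: h|exact: intg_sum].
Qed.

Lemma le_Ex u v : intg u -> intg v -> (forall x, u x <= v x) -> Ex u <= Ex v.
Proof. by move=> iu iv uv; apply: le_Rintegral. Qed.

Lemma Ex_ge0 u : (forall x, 0 <= u x) -> 0 <= Ex u.
Proof. by move=> h; apply: Rintegral_ge0. Qed.

Lemma dominated_Ex (u_ : nat -> T -> R) u g :
  (forall k, measurable_fun setT (u_ k)) ->
  (forall x, u_ k x @[k --> \oo] --> u x) ->
  intg g -> (forall k x, `|u_ k x| <= g x) ->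
  intg u /\ Ex (u_ k) @[k --> \oo] --> Ex u.
Proof.
move=> mu_ cu ig ug.
have mu0 : measurable_fun setT u.
  by apply: (measurable_fun_cvg mu_) => x _; exact: cu.
have [||||| iu _ h] := @dominated_convergence _ _ _ mu setT measurableT
  (fun k => EFin \o u_ k) (EFin \o u) (EFin \o g).
- by move=> k; exact/measurable_EFinP.
- exact/measurable_EFinP.
- by apply: aeW => x _; apply: cvg_EFin; [exact: nearW|exact: cu].
- exact: ig.
- by apply: aeW => x k _ /=; rewrite lee_fin.
split=> //; apply: (@fine_cvg R).
by rewrite fineK; [exact: h|exact: integrable_fin_num].
Qed.

Definition L2 u := measurable_fun setT u /\ intg (u * u).

Lemma L2_mfun u : L2 u -> measurable_fun setT u. Proof. by case. Qed.

Lemma L2_intgM u v : L2 u -> L2 v -> intg (u * v).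
Proof.
move=> [mu_ iu] [mv iv]; apply: (@intg_le _ (u * u + v * v)).
- exact: measurable_funM.
- move=> x; rewrite !fctE normrM -[u x * _]expr2 -[v x * _]expr2.
  rewrite -(real_normK (num_real (u x))) -(real_normK (num_real (v x))).
  have := sqr_ge0 (`|u x| - `|v x|); have := sqr_ge0 (`|u x|); have := sqr_ge0 (`|v x|).
  by nra.
- exact: intgD.
Qed.

Lemma L2_le u v : measurable_fun setT u -> (forall x, `|u x| <= `|v x|) ->
  L2 v -> L2 u.
Proof.
move=> mu_ uv [mv iv]; split=> //; apply: intg_le iv; first exact: measurable_funM.
move=> x; rewrite !fctE -[v x * _]expr2 -(real_normK (num_real (v x))) normrM expr2.
by apply: ler_pM.
Qed.

Lemma L2Z (c : R) u : L2 u -> L2 (c *: u).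
Proof.
move=> [mu_ iu]; split; first exact: measurable_funM.
by rewrite fct_scalerAl fct_scalerAr scalerA; exact: intgZ.
Qed.

Lemma L2D u v : L2 u -> L2 v -> L2 (u + v).
Proof.
move=> hu hv; split; first exact: measurable_funD (L2_mfun hu) (L2_mfun hv).
have -> : (u + v) * (u + v) = u * u + (u * v + (u * v + v * v)) by ring.
by rewrite /=; do 3?apply: intgD; exact: L2_intgM.
Qed.

Lemma L2N u : L2 u -> L2 (- u).
Proof. by rewrite -scaleN1r; exact: L2Z. Qed.

Lemma L2B u v : L2 u -> L2 v -> L2 (u - v).
Proof. by move=> hu hv; apply: L2D => //; exact: L2N. Qed.

Lemma L2_cst c : L2 (fun=> c).
Proof. by split; [exact: measurable_cst|exact: (@intg_cst (c * c))]. Qed.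

Lemma L2_1 : L2 1. Proof. exact: L2_cst. Qed.

Lemma L2_0 : L2 0. Proof. exact: L2_cst. Qed.

Lemma L2_sum I (r : seq I) (P : pred I) (F : I -> T -> R) :
  (forall i, P i -> L2 (F i)) -> L2 (\sum_(i <- r | P i) F i).
Proof. by move=> h; apply: (big_ind L2) => //; [exact: L2_0|exact: L2D]. Qed.

Lemma L2_intg u : L2 u -> intg u.
Proof. by move=> hu; rewrite -[u]mulr1; apply: L2_intgM => //; exact: L2_1. Qed.

Lemma L2_bddM (b : T -> R) u (c : R) : measurable_fun setT b -> (forall x, `|b x| <= c) ->
  L2 u -> L2 (b * u).
Proof.
move=> mb bc hu; apply: (@L2_le _ (c *: u)); last exact: L2Z.
- exact: measurable_funM mb (L2_mfun hu).
- move=> x; rewrite !fctE !normrM ler_pM//.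
  by rewrite (le_trans (bc x))// ler_norm.
Qed.

Definition ip u v := Ex (u * v).

Lemma ipC u v : ip u v = ip v u. Proof. by rewrite /ip mulrC. Qed.

Lemma ipDl u v w : L2 u -> L2 v -> L2 w -> ip (u + v) w = ip u w + ip v w.
Proof. by move=> *; rewrite /ip mulrDl ExD//; exact: L2_intgM. Qed.

Lemma ipDr u v w : L2 u -> L2 v -> L2 w -> ip w (u + v) = ip w u + ip w v.
Proof. by move=> *; rewrite ipC ipDl// !(ipC w). Qed.

Lemma ipZl c u v : L2 u -> L2 v -> ip (c *: u) v = c * ip u v.
Proof. by move=> *; rewrite /ip fct_scalerAl ExZ//; exact: L2_intgM. Qed.

Lemma ipZr c u v : L2 u -> L2 v -> ip u (c *: v) = c * ip u v.
Proof. by move=> *; rewrite ipC ipZl// ipC. Qed.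

Lemma ipNl u v : L2 u -> L2 v -> ip (- u) v = - ip u v.
Proof. by move=> *; rewrite -scaleN1r ipZl// mulN1r. Qed.

Lemma ipBl u v w : L2 u -> L2 v -> L2 w -> ip (u - v) w = ip u w - ip v w.
Proof. by move=> *; rewrite ipDl ?ipNl//; exact: L2N. Qed.

Lemma ipBr u v w : L2 u -> L2 v -> L2 w -> ip w (u - v) = ip w u - ip w v.
Proof. by move=> *; rewrite ipC ipBl// !(ipC w). Qed.

Lemma ip_suml I (r : seq I) (P : pred I) (F : I -> T -> R) v :
  (forall i, P i -> L2 (F i)) -> L2 v ->
  ip (\sum_(i <- r | P i) F i) v = \sum_(i <- r | P i) ip (F i) v.
Proof.
move=> h hv; rewrite /ip big_distrl /= Ex_sum// => i Pi.
by apply: L2_intgM => //; exact: h.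
Qed.

Lemma ip_sumr I (r : seq I) (P : pred I) (F : I -> T -> R) v :
  (forall i, P i -> L2 (F i)) -> L2 v ->
  ip v (\sum_(i <- r | P i) F i) = \sum_(i <- r | P i) ip v (F i).
Proof.
by move=> h hv; rewrite ipC ip_suml//; apply: eq_bigr => i _; rewrite ipC.
Qed.

Lemma ip_ge0 u : 0 <= ip u u.
Proof. by apply: Ex_ge0 => x; rewrite fctE -expr2 sqr_ge0. Qed.

Lemma ip_sqrD u v : L2 u -> L2 v ->
  ip (u + v) (u + v) = ip u u + 2 * ip u v + ip v v.
Proof. by move=> hu hv; rewrite ipDl ?ipDr ?(ipC v u)//; [lra|exact: L2D]. Qed.

Lemma ip_sqrB u v : L2 u -> L2 v ->
  ip (u - v) (u - v) = ip u u - 2 * ip u v + ip v v.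
Proof. by move=> hu hv; rewrite ipBl ?ipBr ?(ipC v u)//; [lra|exact: L2B]. Qed.

Lemma ip_sqrD_le u v : L2 u -> L2 v ->
  ip (u + v) (u + v) <= 2 * ip u u + 2 * ip v v.
Proof.
by move=> hu hv; have := ip_ge0 (u - v); rewrite ip_sqrB// ip_sqrD//; lra.
Qed.

Lemma cauchy_schwarz u v : L2 u -> L2 v -> ip u v ^+ 2 <= ip u u * ip v v.
Proof.
move=> hu hv.
have h s t : 0 <= s ^+ 2 * ip u u - 2 * (s * t) * ip u v + t ^+ 2 * ip v v.
  have := ip_ge0 (s *: u - t *: v).
  rewrite ip_sqrB; [|exact: L2Z..].
  by rewrite !(ipZl,ipZr)//; [lra|exact: L2Z..].
have := ip_ge0 v; rewrite le_eqVlt => /predU1P[v0|v0].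
  have [->|uv0] := eqVneq (ip u v) 0; first by rewrite expr0n/= -v0 mulr0.
  (* With v of norm zero, this t would make the form [h 1 t] equal to [- ip u u - 2], which is
     negative. *)
  have : exists t, t * ip u v = ip u u + 1.
    by exists ((ip u u + 1) / ip u v); rewrite divfK.
  by move=> [t ht]; have := h 1 t; have := ip_ge0 u; rewrite -v0; nra.
(* At this point the form is [ip v v] times the difference of the two sides. *)
have := h (ip v v) (ip u v).
by move=> he; rewrite -(ler_pM2l v0); nra.
Qed.

Lemma ip_eq0 u v : L2 u -> L2 v -> ip v v = 0 -> ip u v = 0.
Proof.
move=> hu hv v0; have := cauchy_schwarz hu hv; rewrite v0 mulr0 => h.
by apply/eqP; rewrite -sqrf_eq0 eq_le h sqr_ge0.
Qed.

Definition cvgL2 (u_ : nat -> T -> R) u :=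
  ip (u_ k - u) (u_ k - u) @[k --> \oo] --> (0 : R).

Lemma cvg_ip (u_ v_ : nat -> T -> R) u v :
  (forall k, L2 (u_ k)) -> L2 u -> (forall k, L2 (v_ k)) -> L2 v ->
  cvgL2 u_ u -> cvgL2 v_ v -> ip (u_ k) (v_ k) @[k --> \oo] --> ip u v.
Proof.
have cs0 (a b : nat -> T -> R) : (forall k, L2 (a k)) -> (forall k, L2 (b k)) ->
   ip (a k) (a k) * ip (b k) (b k) @[k --> \oo] --> (0 : R) ->
   ip (a k) (b k) @[k --> \oo] --> (0 : R).
  move=> ha hb ab; apply/norm_cvg0P.
  have h : Num.sqrt (ip (a k) (a k) * ip (b k) (b k)) @[k --> \oo] --> (0 : R).
    by rewrite -[X in _ --> X](@sqrtr0 R); apply: continuous_cvg ab; exact: sqrt_continuous.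
  apply: squeeze_cvgr (cvg_cst 0) h; near=> k; rewrite normr_ge0/=.
  by rewrite -sqrtr_sqr; apply: ler_wsqrtr; exact: cauchy_schwarz.
move=> hu_ hu hv_ hv cu cv.
have -> : (fun k => ip (u_ k) (v_ k)) = (fun k => ip (u_ k - u) (v_ k - v) +
    ip (u_ k - u) v + ip u (v_ k - v) + ip u v).
  apply/funext => k; rewrite (@ipBr _ _ (u_ k - u))//; last exact: L2B.
  by rewrite !ipBl// ipBr//; lra.
rewrite -[X in _ --> X]add0r -[X in X + _]addr0 -[X in X + _ + _]addr0.
apply: cvgD; last exact: cvg_cst.
apply: cvgD; first apply: cvgD.
- apply: cs0 => [k|k|]; [exact: L2B..|].
  by rewrite -[X in _ --> X](mulr0 (0:R)); exact: cvgM.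
- apply: (cs0 (fun k => u_ k - u) (fun=> v)) => [k|//|]; first exact: L2B.
  by rewrite -[X in _ --> X](mul0r (ip v v)); apply: cvgM => //; exact: cvg_cst.
- apply: (cs0 (fun=> u) (fun k => v_ k - v)) => [//|k|]; first exact: L2B.
  by rewrite -[X in _ --> X](mulr0 (ip u u)); apply: cvgM => //; exact: cvg_cst.
Unshelve. all: by end_near. Qed.

End L2.

(** * The Gaussian density and dilations *)

Section density.
Context {d : measure_display} {T : measurableType d} {R : realType}.
Variables (nu : {finite_measure set T -> \bar R}).
Variables (mu : {sigma_finite_measure set T -> \bar R}) (p : T -> R).
Hypothesis mp : measurable_fun setT p.
Hypothesis nuE : forall A, measurable A -> nu A = (\int[mu]_(x in A) (p x)%:E)%E.

(** p has the same integrals over measurable sets as the Radon-Nikodym derivative of nu, hence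
    agrees with it almost everywhere. *)
Lemma ge0_integral_density (F : T -> \bar R) : measurable_fun setT F ->
  (forall x, 0 <= F x)%E ->
  (\int[nu]_x F x = \int[mu]_x (F x * (p x)%:E))%E.
Proof.
move=> mF F0.
have dom : nu `<< mu.
  apply/null_content_dominatesP => A mA muA0.
  rewrite nuE//; apply: null_set_integral => //.
  by apply/measurable_EFinP; exact: measurable_funTS.
rewrite -(Radon_Nikodym_SigmaFinite.change_of_variables dom)//.
have h := Radon_Nikodym_SigmaFinite.f_integral dom.
have iRN := Radon_Nikodym_SigmaFinite.f_integrable dom.
apply: ae_eq_integral => //.
- apply: emeasurable_funM => //; exact: measurable_int iRN.
- by apply: emeasurable_funM => //; exact/measurable_EFinP.
- apply: ae_eqe_mul2l; apply: integral_ae_eq => //.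
  + exact/measurable_EFinP.
  + by move=> E _ mE; rewrite -h// -nuE.
Qed.

Lemma integral_density (F : T -> R) : (forall x, 0 <= p x) ->
  measurable_fun setT F ->
  (\int[nu]_x (F x)%:E = \int[mu]_x (F x * p x)%:E)%E.
Proof.
move=> p0 mF; have mEF : measurable_fun setT (EFin \o F) by exact/measurable_EFinP.
rewrite [LHS]integralE [RHS]integralE; congr (_ - _)%E.
- rewrite ge0_integral_density//; last exact: measurable_funepos.
  apply: eq_integral => x _; rewrite !funeposE /= -[0%E]/(0%R%:E) -!EFin_max.
  by rewrite -EFinM maxr_pMl// mul0r.
- rewrite ge0_integral_density//; last exact: measurable_funeneg.
  apply: eq_integral => x _; rewrite !funenegE /= -[0%E]/(0%R%:E) -!EFin_max.
  by rewrite -EFinM maxr_pMl// mul0r mulNr.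
Qed.

End density.

(** * Dilations of Lebesgue measure on the line *)

Section scale1.
Context {R : realType}.
Local Notation leb := (@lebesgue_measure R).

Lemma measurable_scale1 (s : R) :
  measurable_fun setT ((fun t => s * t) : measurableTypeR R -> measurableTypeR R).
Proof. exact: measurable_funM. Qed.

(** The image of Lebesgue measure under t |-> s t, multiplied by s, agrees with Lebesgue measure on
    intervals, and these determine it. *)
Lemma ge0_lebesgue_scale (s : R) (h : measurableTypeR R -> \bar R) : 0 < s ->
  measurable_fun setT h -> (forall x, 0 <= h x)%E ->
  (\int[leb]_t h t = s%:E * \int[leb]_t h (s * t)%R)%E.
Proof.
move=> s0 mh h0.
have s0' : 0 <= s by exact: ltW.
pose k : {nonneg R} := NngNum s0'.
pose f : measurableTypeR R -> measurableTypeR R := fun t : R => s * t.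
have mf : measurable_fun setT f by exact: measurable_scale1.
pose nu : {measure set (measurableTypeR R) -> \bar R} :=
  measure_function_pushforward__canonical__measure_function_Measure leb mf.
pose m := mscale k nu.
transitivity (\int[m]_t h t)%E; last first.
  rewrite ge0_integral_mscale//; congr (_ * _)%E.
  by rewrite [LHS](@ge0_integral_pushforward _ _ _ _ _ _ mf).
apply: eq_measure_integral => A mA _; apply: lebesgue_measure_unique => //.
move=> _ [[a b] _ <-].
have e : leb `]a, b]%classic = (s%:E * leb [set` `]a / s, b / s]%R])%E.
  rewrite !lebesgue_measure_itv/= !lte_fin ltr_pM2r ?invr_gt0//.
  case: ifP => _; last by rewrite mule0.
  by rewrite -!EFinB -EFinM -mulrBl mulrC divfK// gt_eqF.
apply: (etrans e); rewrite /m /mscale /nu /pushforward/=; congr (_ * leb _)%E.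
by apply/seteqP; split=> x /=; rewrite !in_itv/= ltr_pdivrMr// ler_pdivlMr// mulrC.
Qed.

End scale1.

(** * Fubini, dilations and the Gaussian density in dimension n *)

Section gaussian_rV.
Context {R : realType}.
Local Notation mR := (measurableTypeR R).
Implicit Type m : {sigma_finite_measure set mR -> \bar R}.

Lemma ge0_integral_rVS m n (F : 'rV[R]_n.+1 -> \bar R) :
  measurable_fun setT F -> (forall x, 0 <= F x)%E ->
  (\int[prod_rV m n.+1]_x F x =
   \int[m]_a \int[prod_rV m n]_x F (cons_rV (a, x)))%E.
Proof.
move=> mF F0.
rewrite [LHS](@ge0_integral_pushforward _ _ _ _ _ _ (@measurable_cons_rV R n))//.
rewrite preimage_setT fubini_tonelli1//.
- exact: (measurableT_comp mF (@measurable_cons_rV R n)).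
- by move=> x /=; exact: F0.
Qed.

Lemma measurable_slice_rV n (a : mR) :
  measurable_fun setT (fun x : 'rV[R]_n => cons_rV (a, x)).
Proof. exact: (measurableT_comp (@measurable_cons_rV R n) (measurable_pair1 a)). Qed.

Lemma measurable_integral_slice m n (F : 'rV[R]_n.+1 -> \bar R) :
  measurable_fun setT F -> (forall x, 0 <= F x)%E ->
  measurable_fun setT (fun a : mR => \int[prod_rV m n]_x F (cons_rV (a, x)))%E.
Proof.
move=> mF F0.
apply: (@measurable_fun_fubini_tonelli_F _ _ _ _ _ (prod_rV m n)
  (F \o @cons_rV R n)) => //.
- exact: (measurableT_comp mF (@measurable_cons_rV R n)).
- by move=> x /=; exact: F0.
Qed.

Lemma measurable_scale_rV n (s : R) :
  measurable_fun setT (fun x : 'rV[R]_n => s *: x).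
Proof.
apply/measurable_fun_rVP => i; under eq_fun do rewrite mxE.
by apply: measurable_funM => //; exact: measurable_coord.
Qed.

Lemma scale_cons_rV n (s a : R) (x : 'rV[R]_n) :
  s *: cons_rV (a : mR, x) = cons_rV (s * a : mR, s *: x).
Proof. by apply/rowP => i; rewrite !mxE; case: unlift => //= j; rewrite mxE. Qed.

(** The one-dimensional rule is a hypothesis so that a single induction on the dimension serves both
    Lebesgue measure (c = s) and the normal law (c = 1). *)
Lemma ge0_integral_rV_scale m m' (c s : R) : 0 <= c ->
  (forall h : mR -> \bar R, measurable_fun setT h -> (forall t, 0 <= h t)%E ->
    (\int[m]_t h t = c%:E * \int[m']_t h (s * t)%R)%E) ->
  forall n (F : 'rV[R]_n -> \bar R), measurable_fun setT F ->
    (forall x, 0 <= F x)%E ->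
    (\int[prod_rV m n]_x F x = (c ^+ n)%:E * \int[prod_rV m' n]_x F (s *: x)%R)%E.
Proof.
move=> c0 hm; elim=> [|n IH] F mF F0.
  rewrite expr0 mul1e; apply: eq_integral => x _; congr F.
  by apply/rowP => -[].
rewrite !ge0_integral_rVS//; last exact: (measurableT_comp mF (measurable_scale_rV s)).
under eq_integral.
  move=> a _; rewrite IH//; last exact: (measurableT_comp mF (measurable_slice_rV a)).
  over.
rewrite hm; last 2 first.
- apply: measurable_funeM.
  apply: (@measurable_fun_fubini_tonelli_F _ _ _ _ _ (prod_rV m' n)
    (fun p => F (cons_rV (p.1, s *: p.2)))) => //.
  apply: (measurableT_comp mF); apply: (measurableT_comp (@measurable_cons_rV R n)).
  apply/measurable_fun_pairP; split; first exact: measurable_fst.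
  exact: (measurableT_comp (measurable_scale_rV s) measurable_snd).
- by move=> t; apply: mule_ge0; [rewrite lee_fin exprn_ge0|exact: integral_ge0].
rewrite exprS EFinM -muleA; congr (_ * _)%E.
rewrite -[RHS](@ge0_integralZl _ _ _ _ _ measurableT) ?lee_fin ?exprn_ge0//.
- by apply: eq_integral => a _; congr (_ * _)%E; apply: eq_integral => x _;
    rewrite scale_cons_rV.
- apply: (measurable_integral_slice m'
    (measurableT_comp mF (measurable_scale_rV s))) => x /=; exact: F0.
- by move=> a _; apply: integral_ge0 => x _ /=; exact: F0.
Qed.

Lemma lebesgue_rV_scale n (s : R) (F : 'rV[R]_n -> \bar R) : 0 < s ->
  measurable_fun setT F -> (forall x, 0 <= F x)%E ->
  (\int[lebesgue_rV n]_x F x = (s ^+ n)%:E * \int[lebesgue_rV n]_x F (s *: x)%R)%E.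
Proof.
move=> s0; apply: ge0_integral_rV_scale; first exact: ltW.
by move=> h mh h0; exact: ge0_lebesgue_scale.
Qed.

Lemma ge0_integral_normal1 (s : R) (h : mR -> \bar R) :
  measurable_fun setT h -> (forall t, 0 <= h t)%E ->
  (\int[normal_prob 0 s]_t h t =
   \int[@lebesgue_measure R]_t (h t * (normal_pdf 0 s t)%:E))%E.
Proof.
move=> mh h0; apply: ge0_integral_density => //.
exact: measurable_normal_pdf.
Qed.

Lemma normal_pdf_scale (s t : R) : 0 < s ->
  s * normal_pdf 0 s (s * t) = normal_pdf 0 1 t.
Proof.
move=> s0; rewrite !normal_pdfE ?oner_eq0 ?gt_eqF//.
rewrite /normal_peak /normal_fun !subr0 expr1n mul1r.
rewrite -mulrnAr sqrtrM ?sqr_ge0// sqrtr_sqr gtr0_norm//.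
rewrite mulrA invfM mulrA divff ?gt_eqF// mul1r; congr (_ * expR _).
by rewrite exprMn -mulrnAr; field; rewrite gt_eqF.
Qed.

(** The factor [1%:E] is the constant c in the form that [ge0_integral_rV_scale] expects. *)
Lemma ge0_normal_prob_scale (s : R) (h : mR -> \bar R) : 0 < s ->
  measurable_fun setT h -> (forall t, 0 <= h t)%E ->
  (\int[normal_prob 0 s]_t h t = 1%:E * \int[normal_prob 0 1]_t h (s * t)%R)%E.
Proof.
move=> s0 mh h0; have mhs := measurableT_comp mh (measurable_scale1 s).
have mG : measurable_fun setT (fun t => h t * (normal_pdf 0 s t)%:E)%E.
  by apply: emeasurable_funM => //; apply/measurable_EFinP; exact: measurable_normal_pdf.
have G0 t : (0 <= h t * (normal_pdf 0 s t)%:E)%E.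
  by rewrite mule_ge0// lee_fin normal_pdf_ge0.
rewrite mul1e [LHS]ge0_integral_normal1// [RHS](ge0_integral_normal1 1 mhs); last by move=> t; exact: h0.
rewrite [LHS](ge0_lebesgue_scale s0 mG G0) -[LHS](@ge0_integralZl _ _ _ _ _ measurableT).
- by apply: eq_integral => t _; rewrite muleCA -EFinM normal_pdf_scale.
- exact: (measurableT_comp mG (measurable_scale1 s)).
- by move=> t _; exact: G0.
- by rewrite lee_fin ltW.
Qed.

Lemma normal_rV_scale n (s : R) (F : 'rV[R]_n -> \bar R) : 0 < s ->
  measurable_fun setT F -> (forall x, 0 <= F x)%E ->
  (\int[normal_rV s]_x F x = \int[normal_rV 1]_x F (s *: x)%R)%E.
Proof.
move=> s0 mF F0.
have := ge0_integral_rV_scale ler01 (fun h => @ge0_normal_prob_scale s h s0) mF F0.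
by rewrite expr1n mul1e.
Qed.

Definition gdens n (x : 'rV[R]_n) : R := \prod_i normal_pdf 0 1 (x 0 i).

Lemma gdens_ge0 n (x : 'rV[R]_n) : 0 <= gdens x.
Proof. by apply: prodr_ge0 => i _; exact: normal_pdf_ge0. Qed.

Lemma measurable_gdens n : measurable_fun setT (@gdens n).
Proof.
apply: measurable_prod => i _.
exact: (measurableT_comp (measurable_normal_pdf 0 1) (measurable_coord i)).
Qed.

Lemma gdens_cons n a (x : 'rV[R]_n) :
  gdens (cons_rV (a : mR, x)) = normal_pdf 0 1 a * gdens x.
Proof.
rewrite /gdens big_ord_recl mxE unlift_none; congr (_ * _).
by apply: eq_bigr => i _; rewrite mxE liftK.
Qed.

Lemma ge0_integral_gdens n (F : 'rV[R]_n -> \bar R) :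
  measurable_fun setT F -> (forall x, 0 <= F x)%E ->
  (\int[normal_rV 1]_x F x = \int[lebesgue_rV n]_x (F x * (gdens x)%:E))%E.
Proof.
elim: n F => [|n IH] F mF F0.
  by apply: eq_integral => x _; rewrite /gdens big_ord0 mule1.
have mFg : measurable_fun setT (fun x => F x * (gdens x)%:E)%E.
  by apply: emeasurable_funM => //; apply/measurable_EFinP; exact: measurable_gdens.
have Fg0 x : (0 <= F x * (gdens x)%:E)%E by rewrite mule_ge0// lee_fin gdens_ge0.
rewrite [LHS]ge0_integral_rVS// [RHS]ge0_integral_rVS//.
rewrite ge0_integral_normal1; first last.
- by move=> a; exact: integral_ge0.
- exact: measurable_integral_slice.
apply: eq_integral => a _; rewrite [X in (X * _)%E]IH//; last first.
  exact: (measurableT_comp mF (measurable_slice_rV a)).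
rewrite -ge0_integralZr//.
- by apply: eq_integral => x _; rewrite gdens_cons EFinM muleAC muleA.
- apply: emeasurable_funM; first exact: (measurableT_comp mF (measurable_slice_rV a)).
  by apply/measurable_EFinP; exact: measurable_gdens.
- by move=> x _; rewrite mule_ge0// lee_fin gdens_ge0.
- by rewrite lee_fin normal_pdf_ge0.
Qed.

End gaussian_rV.

(** * Gaussian integration by parts *)

Section expbound.
Context {R : realType}.
Local Notation mR := (measurableTypeR R).
Local Notation leb := (@lebesgue_measure R).

(** Completing the square: an exponential factor translates the density, so exponential moments
    reduce to the integrability of a normal density of mean c. *)
Lemma normal_pdf_exp (c t : R) :
  expR (c * t) * normal_pdf 0 1 t = expR (c ^+ 2 / 2) * normal_pdf c 1 t.
Proof.
rewrite !normal_pdfE ?oner_eq0// mulrCA [RHS]mulrCA -!expRD; congr (_ * expR _).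
by rewrite expr1n; field.
Qed.

Lemma measurable_exp_abs (c : R) : measurable_fun setT (fun t : R => expR (c * `|t|)).
Proof.
apply: measurableT_comp => //; exact: measurable_funM.
Qed.

Lemma exp_abs_le (c t : R) : expR (c * `|t|) <= expR (c * t) + expR ((- c) * t).
Proof.
have [t0|t0] := ger0P t; first by rewrite lerDl expR_ge0.
by rewrite mulrN mulNr lerDr expR_ge0.
Qed.

Lemma integrable_exp_abs_pdf (c : R) :
  leb.-integrable setT (fun t => (expR (c * `|t|) * normal_pdf 0 1 t)%:E).
Proof.
have h b : leb.-integrable setT (fun t => (expR (b * t) * normal_pdf 0 1 t)%:E).
  under eq_fun do rewrite normal_pdf_exp EFinM.
  by apply: integrableZl => //; exact: integrable_normal_pdf.
have := integrableD measurableT (h c) (h (- c)); apply: le_integrable => //.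
  apply/measurable_EFinP; apply: measurable_funM; first exact: measurable_exp_abs.
  exact: measurable_normal_pdf.
move=> t _; rewrite lee_fin ger0_norm; last first.
  by rewrite mulr_ge0// ?expR_ge0// normal_pdf_ge0.
rewrite (le_trans _ (ler_norm _))//=.
by rewrite -mulrDl ler_wpM2r ?normal_pdf_ge0// exp_abs_le.
Qed.

Lemma integral_exp_abs_lty (c : R) :
  (\int[normal_prob 0 1]_t (expR (c * `|t|))%:E < +oo)%E.
Proof.
rewrite ge0_integral_normal1.
- have /integrableP[_] := integrable_exp_abs_pdf c; apply: le_lt_trans.
  apply: ge0_le_integral => //.
  + by move=> t _; rewrite mule_ge0// lee_fin ?expR_ge0 ?normal_pdf_ge0.
  + apply: emeasurable_funM; apply/measurable_EFinP; [exact: measurable_exp_abs|exact: measurable_normal_pdf].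
  + apply/measurableT_comp => //; apply/measurable_EFinP; apply: measurable_funM; first exact: measurable_exp_abs.
    exact: measurable_normal_pdf.
  + by move=> t _; rewrite -EFinM lee_abs.
- by apply/measurable_EFinP; exact: measurable_exp_abs.
- by move=> t; rewrite lee_fin expR_ge0.
Qed.

(** Growth is measured in the l1 norm because [expR (c * l1 x)] is a product over the
    coordinates. *)
Definition l1 n (x : 'rV[R]_n) : R := \sum_i `|x 0 i|.

Lemma l1_ge0 n (x : 'rV[R]_n) : 0 <= l1 x.
Proof. by apply: sumr_ge0 => i _. Qed.

Lemma coord_l1 n (x : 'rV[R]_n) i : `|x 0 i| <= l1 x.
Proof. by rewrite /l1 (bigD1 i)//= lerDl sumr_ge0. Qed.

Lemma l1_cons n a (x : 'rV[R]_n) : l1 (cons_rV (a : mR, x)) = `|a| + l1 x.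
Proof.
rewrite /l1 big_ord_recl mxE unlift_none; congr (_ + _).
by apply: eq_bigr => i _; rewrite mxE liftK.
Qed.

Lemma measurable_l1 n : measurable_fun setT (@l1 n).
Proof.
rewrite /l1; apply: measurable_sum => i.
by apply: measurableT_comp => //; exact: measurable_coord.
Qed.

Lemma measurable_exp_l1 n (c : R) :
  measurable_fun setT (fun x : 'rV[R]_n => expR (c * l1 x)).
Proof.
apply: measurableT_comp => //; apply: measurable_funM => //; exact: measurable_l1.
Qed.

Lemma integral_exp_l1_lty n (c : R) :
  (\int[normal_rV 1]_x (expR (c * @l1 n x))%:E < +oo)%E.
Proof.
elim: n => [|n IH].
  have -> : (fun x : 'rV[R]_0 => (expR (c * l1 x))%:E) = cst 1%E.
    by apply/funext => x; rewrite /l1 big_ord0 mulr0 expR0.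
  by rewrite integral_cst// mul1e (le_lt_trans (probability_le1 _ _))// ltry.
rewrite ge0_integral_rVS; last 2 first.
- by apply/measurable_EFinP; exact: measurable_exp_l1.
- by move=> x; rewrite lee_fin expR_ge0.
pose K : \bar R := (\int[normal_rV 1]_x (expR (c * @l1 n x))%:E)%E.
have K0 : (0 <= K)%E by apply: integral_ge0 => x _; rewrite lee_fin expR_ge0.
rewrite (eq_integral (fun a : mR => (expR (c * `|a : R|))%:E * K)%E); last first.
  move=> a _; rewrite -ge0_integralZl ?lee_fin ?expR_ge0//.
  - by apply: eq_integral => x _; rewrite l1_cons mulrDr expRD EFinM.
  - by apply/measurable_EFinP; exact: measurable_exp_l1.
rewrite ge0_integralZr//.
- rewrite lte_mul_pinfty//; first by apply: integral_ge0 => t _; rewrite lee_fin expR_ge0.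
  rewrite ge0_fin_numE; first exact: integral_exp_abs_lty.
  by apply: integral_ge0 => t _; rewrite lee_fin expR_ge0.
- by apply/measurable_EFinP; exact: measurable_exp_abs.
Qed.

(** At most exponential growth. The class contains the polynomials, is stable under sums, products
    and slices, and lies in every L^p of the Gaussian measure; membership discharges the
    integrability conditions below. *)
Definition eb n (F : 'rV[R]_n -> R) := measurable_fun setT F /\
  exists2 C : R, 0 <= C & exists2 c : R, 0 <= c & forall x, `|F x| <= C * expR (c * l1 x).

Lemma eb_intg n (F : 'rV[R]_n -> R) : eb F -> intg (normal_rV 1) F.
Proof.
move=> [mF [C C0 [c c0 h]]].
apply: (@intg_le _ _ _ _ _ (C *: (fun x => expR (c * l1 x)))) => //.
apply: intgZ; apply/integrableP; split.
  by apply/measurable_EFinP; exact: measurable_exp_l1.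
under eq_integral do rewrite /= ger0_norm ?expR_ge0//.
exact: integral_exp_l1_lty.
Qed.

Section closure.
Variable n : nat.
Implicit Types F G : 'rV[R]_n -> R.

Lemma eb_bdd F (C : R) : measurable_fun setT F -> (forall x, `|F x| <= C) -> eb F.
Proof.
move=> mF h; split=> //; exists `|C| => //; exists 0 => // x.
by rewrite mul0r expR0 mulr1 (le_trans (h x))// ler_norm.
Qed.

Lemma eb_cst (C : R) : eb (fun _ : 'rV[R]_n => C).
Proof. by apply: (@eb_bdd _ `|C|) => //. Qed.

Lemma eb_coord i : eb (fun x : 'rV[R]_n => x 0 i).
Proof.
split; first exact: measurable_coord.
exists 1 => //; exists 1 => // x; rewrite !mul1r (le_trans (coord_l1 x i))//.
by rewrite (le_trans _ (expR_ge1Dx _))// lerDr.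
Qed.

Lemma eb_le F G : measurable_fun setT F -> (forall x, `|F x| <= `|G x|) -> eb G -> eb F.
Proof.
move=> mF h [mG [C C0 [c c0 hG]]]; split=> //; exists C => //; exists c => // x.
exact: le_trans (hG x).
Qed.

Lemma ebM F G : eb F -> eb G -> eb (F * G).
Proof.
move=> [mF [C C0 [c c0 hF]]] [mG [D D0 [e e0 hG]]]; split; first exact: measurable_funM.
exists (C * D); first exact: mulr_ge0.
exists (c + e) => [|x]; first exact: addr_ge0.
by rewrite fctE normrM mulrDl expRD mulrACA; apply: ler_pM.
Qed.

Lemma ebD F G : eb F -> eb G -> eb (F + G).
Proof.
move=> [mF [C C0 [c c0 hF]]] [mG [D D0 [e e0 hG]]]; split; first exact: measurable_funD.
exists (C + D); first exact: addr_ge0.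
exists (c + e) => [|x]; first exact: addr_ge0.
rewrite (le_trans (ler_normD _ _))// mulrDl; apply: lerD.
- rewrite (le_trans (hF x))// ler_wpM2l// ler_expR ler_wpM2r ?l1_ge0// lerDl//.
- rewrite (le_trans (hG x))// ler_wpM2l// ler_expR ler_wpM2r ?l1_ge0// lerDr//.
Qed.

Lemma ebZ (C : R) F : eb F -> eb (C *: F).
Proof. by move=> hF; exact: ebM (eb_cst C) hF. Qed.

Lemma ebN F : eb F -> eb (- F).
Proof. by rewrite -scaleN1r; exact: ebZ. Qed.

Lemma ebB F G : eb F -> eb G -> eb (F - G).
Proof. by move=> *; apply: ebD => //; exact: ebN. Qed.

Lemma eb_L2 F : eb F -> L2 (normal_rV 1) F.
Proof. by move=> hF; split; [case: hF|apply: eb_intg; exact: ebM]. Qed.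

End closure.
End expbound.

(** * Integration by parts on the line *)

Section stein1.
Context {R : realType}.
Local Notation mR := (measurableTypeR R).
Local Notation leb := (@lebesgue_measure R).

Lemma is_derive_normal_pdf (t : R) :
  is_derive t 1 (normal_pdf 0 1) (- t * normal_pdf 0 1 t).
Proof.
pose q : R -> R := (- 2^-1) *: (id ^+ 2).
have -> : normal_pdf 0 1 = cst (normal_peak 1) * (expR \o q) :> (R -> R).
  rewrite normal_pdfE ?oner_eq0//; apply/funext => x /=.
  rewrite /normal_fun subr0 expr1n; congr (_ * expR _); rewrite /q !fctE /GRing.scale/=.
  by field.
have dq : is_derive t 1 q (- t).
  by apply: is_derive_eq; rewrite /GRing.scale /=; field.
have de : is_derive t 1 (expR \o q) (expR (q t) * (- t)).
  exact: is_derive1_comp.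
have dc := is_derive_cst (normal_peak 1 : R) t (1:R).
apply: (is_derive_eq (is_deriveM dc de)).
by rewrite !fctE /GRing.scale /=; ring.
Qed.

Lemma normal_pdf_exp_cvg (c : R) :
  (expR (c * k%:R) * normal_pdf 0 1 (k%:R)) @[k --> \oo] --> (0:R).
Proof.
have h : (normal_peak 1 * (expR (-1) : R) ^+ k) @[k --> \oo] --> (0:R).
  rewrite -[X in _ --> X](mulr0 (normal_peak 1)); apply: cvgMr.
  by apply: cvg_expr; rewrite ger0_norm ?expR_ge0// -expR0 ltr_expR ltrN10.
apply: squeeze_cvgr (cvg_cst 0) h; near=> k.
rewrite mulr_ge0 ?expR_ge0 ?normal_pdf_ge0//=.
rewrite normal_pdfE ?oner_eq0// mulrCA ler_wpM2l ?normal_peak_ge0//.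
rewrite /normal_fun -expRM_natl -expRD ler_expR subr0 expr1n.
(* From this k on, c k - k^2 / 2 <= - k. *)
have : 2 * c + 2 <= k%:R by near: k; exact: nbhs_infty_ger.
have : (0:R) <= k%:R by [].
by nra.
Unshelve. all: by end_near. Qed.

(** Times the density, the integrand is the derivative of G, minus h times the density. Integrate
    over [-k, k]: the boundary terms vanish by the exponential bound on h, and the bound on the
    integrand allows dominated convergence. *)
Lemma stein1 (h h' : R -> R) (C c : R) :
  (forall t : R, is_derive t 1 h (h' t)) -> continuous h' -> 0 <= C ->
  (forall t, `|h t| <= C * expR (c * `|t|)) ->
  (forall t, `|t * h t - h' t| <= C * expR (c * `|t|)) ->
  (\int[normal_prob 0 1]_t (t * h t - h' t)%:E = 0)%E.
Proof.
move=> dh ch' C0 hb gb.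
have ch : continuous h.
  by move=> t; apply/differentiable_continuous/derivable1_diffP; have [] := dh t.
have cp := @continuous_normal_pdf R 0 1 (oner_neq0 _).
pose G : R -> R := - (h * normal_pdf 0 1).
pose g : R -> R := (fun t => t * h t - h' t) * normal_pdf 0 1.
have dG (t : R) : is_derive t (1 : R) G (g t).
  apply: (is_derive_eq (is_deriveN (is_deriveM (dh t) (is_derive_normal_pdf t)))).
  by rewrite /g !fctE /GRing.scale/=; ring.
have cg : continuous g.
  move=> t; apply: (@cvgM R); last exact: cp.
  apply: (@cvgB R R^o); last exact: ch'.
  by apply: (@cvgM R); [exact: cvg_id|exact: ch].
have mg : measurable_fun setT g by exact: continuous_measurable_fun.
have cF : continuous ((fun t => t * h t - h' t) : R -> R).
  move=> t; apply: (@cvgB R R^o); last exact: ch'.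
  by apply: (@cvgM R); [exact: cvg_id|exact: ch].
have gle t : `|g t| <= C * (expR (c * `|t|) * normal_pdf 0 1 t).
  by rewrite /g fctE normrM (ger0_norm (normal_pdf_ge0 _ _ _)) mulrA ler_wpM2r ?normal_pdf_ge0.
rewrite (@integral_density _ _ _ (normal_prob 0 1) leb (normal_pdf 0 1) _ _ (fun t : R => t * h t - h' t)); last 4 first.
- exact: measurable_normal_pdf.
- by [].
- by move=> t; exact: normal_pdf_ge0.
- exact: continuous_measurable_fun.
pose f_ (k : nat) := EFin \o (g \_ `[- k%:R, k%:R]).
have iM : leb.-integrable setT (fun t => (C * (expR (c * `|t|) * normal_pdf 0 1 t))%:E).
  under eq_fun do rewrite EFinM.
  by apply: integrableZl => //; exact: integrable_exp_abs_pdf.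
have [|||| ig _ hcv] := @dominated_convergence _ _ _ leb setT measurableT f_ (EFin \o g) _ _ _ _ iM.
- move=> k; apply/measurable_EFinP; apply/(measurable_restrictT _ _).1 => //.
  exact: measurable_funTS.
- exact/measurable_EFinP.
- apply: aeW => t _; apply: cvg_near_cst; near=> k.
  rewrite /f_ /= patchE mem_set//= in_itv/= -ler_norml.
  by near: k; exact: nbhs_infty_ger.
- apply: aeW => t k _; rewrite /f_/= lee_fin patchE; case: ifP => _; first exact: gle.
  by rewrite normr0 mulr_ge0// mulr_ge0 ?expR_ge0 ?normal_pdf_ge0.
(* Only for large k, since the fundamental theorem is applied on an interval of positive length. *)
have hk : \forall k \near \oo, (\int[leb]_t f_ k t = (G k%:R - G (- k%:R))%:E)%E.
  near=> k.
  have k0 : (0:R) < k%:R by near: k; exact: nbhs_infty_gtr.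
  rewrite /f_ -restrict_EFin -integral_mkcond (@continuous_FTC2 _ _ G)// ?gtrN//.
  - exact: continuous_subspaceT.
  - split.
    + by move=> t _; have [] := dG t.
    + apply: cvg_at_right_filter; apply/differentiable_continuous/derivable1_diffP.
      by have [] := dG (- k%:R).
    + apply: cvg_at_left_filter; apply/differentiable_continuous/derivable1_diffP.
      by have [] := dG (k%:R).
  - by move=> t _; rewrite derive1E; have [] := dG t.
(* Both ends of the interval at once: s is 1 or -1, and the density is even. *)
have G0 (s : R) : `|s| = 1 -> G (s * k%:R) @[k --> \oo] --> (0:R).
  move=> s1; apply/norm_cvg0P.
  have hc : C * (expR (c * k%:R) * normal_pdf 0 1 k%:R) @[k --> \oo] --> (0:R).
    by rewrite -[X in _ --> X](mulr0 C); apply: cvgMr; exact: normal_pdf_exp_cvg.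
  apply: squeeze_cvgr (cvg_cst 0) hc; near=> k; rewrite normr_ge0/=.
  have e : normal_pdf 0 1 (s * k%:R) = normal_pdf 0 1 k%:R.
    rewrite !normal_pdfE ?oner_eq0// /normal_fun !subr0 exprMn.
    by rewrite -(real_normK (num_real s)) s1 expr1n mul1r.
  rewrite /G !fctE normrN normrM (ger0_norm (normal_pdf_ge0 _ _ _)) e.
  rewrite mulrA ler_wpM2r ?normal_pdf_ge0//.
  by have := hb (s * k%:R); rewrite normrM s1 mul1r normr_nat.
apply: (cvg_unique _ hcv) => //.
rewrite (_ : 0%E = (0 - 0)%:E); last by rewrite subrr.
apply: (@cvg_trans _ ((G k%:R - G (- k%:R))%:E @[k --> \oo])).
  apply: near_eq_cvg; near=> k; apply/esym; near: k; exact: hk.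
apply: cvg_EFin; first exact: nearW.
apply: (@cvgB R R^o).
- have := G0 1 (normr1 _); by under eq_fun do rewrite mul1r.
- have := G0 (-1) (normrN1 _); by under eq_fun do rewrite mulN1r.
Unshelve. all: by end_near. Qed.

End stein1.

(** * Integration by parts along one coordinate of R^n *)

Section stein_rV.
Context {R : realType}.
Local Notation mR := (measurableTypeR R).

Definition upd n (x : 'rV[R]_n) (i : 'I_n) (t : R) : 'rV[R]_n :=
  \row_j if j == i then t else x 0 j.

Definition X n (i : 'I_n) (x : 'rV[R]_n) : R := x 0 i.
Arguments X {n}.

Lemma upd_cons0 n (x : 'rV[R]_n) (a t : R) :
  upd (cons_rV (a : mR, x)) 0 t = cons_rV (t : mR, x).
Proof.
by apply/rowP => j; rewrite !mxE; case: unliftP => [k ->|->].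
Qed.

Lemma upd_consS n (x : 'rV[R]_n) (i : 'I_n) (a t : R) :
  upd (cons_rV (a : mR, x)) (lift 0 i) t = cons_rV (a : mR, upd x i t).
Proof.
apply/rowP => j; rewrite !mxE; case: unliftP => [k ->|->] //=.
by rewrite mxE (inj_eq lift_inj).
Qed.

(** Both orders of integration are recorded: the induction of [integral_upd0] either fixes the first
    coordinate or integrates over it first. *)
Lemma integral_rVS n (F : 'rV[R]_n.+1 -> R) : eb F ->
  (\int[normal_rV 1]_x (F x)%:E =
   \int[normal_prob 0 1]_a \int[normal_rV 1]_x (F (cons_rV (a : mR, x)))%:E)%E /\
  (\int[normal_rV 1]_x (F x)%:E =
   \int[normal_rV 1]_x \int[normal_prob 0 1]_a (F (cons_rV (a : mR, x)))%:E)%E.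
Proof.
move=> hF; have iF := eb_intg hF; have mF : measurable_fun setT F by case: hF.
pose G := EFin \o F \o @cons_rV R n.
have mG : measurable_fun setT G.
  apply: measurableT_comp; last exact: measurable_cons_rV.
  exact/measurable_EFinP.
have iG : (normal_prob 0 1 \x (normal_rV 1 : {measure set 'rV[R]_n -> \bar R}))%E.-integrable setT G.
  apply/integrableP; split => //.
  have /integrableP[_] := iF; rewrite /normal_rV /=.
  rewrite [X in (X < _)%E -> _](@ge0_integral_pushforward _ _ _ _ _ _ (@measurable_cons_rV R n))//.
  by apply/measurable_EFinP; exact: measurableT_comp.
have e : (\int[normal_rV 1]_x (F x)%:E =
   \int[normal_prob 0 1 \x (normal_rV 1 : {measure set 'rV[R]_n -> \bar R})]_p G p)%E.
  apply: (integral_pushforward (@measurable_cons_rV R n)) => //.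
  exact/measurable_EFinP.
split; rewrite e; first by rewrite -(integral12_prod_meas1 iG).
by rewrite -(integral21_prod_meas1 iG).
Qed.

Lemma eb_cons n (F : 'rV[R]_n.+1 -> R) (a : R) : eb F ->
  eb (fun x : 'rV[R]_n => F (cons_rV (a : mR, x))).
Proof.
move=> [mF [C C0 [c c0 h]]]; split.
  exact: (measurableT_comp mF (measurable_slice_rV (a : mR))).
exists (C * expR (c * `|a|)); first by rewrite mulr_ge0// expR_ge0.
exists c => // x; rewrite (le_trans (h _))// l1_cons mulrDr expRD mulrA//.
Qed.

(** Fubini with the i-th coordinate integrated before the ones that precede it. *)
Lemma integral_upd0 n (i : 'I_n) (F : 'rV[R]_n -> R) : eb F ->
  (forall x, \int[normal_prob 0 1]_t (F (upd x i t))%:E = 0)%E ->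
  (\int[normal_rV 1]_x (F x)%:E = 0)%E.
Proof.
elim: n i F => [[]//|n IH] i F hF h.
case: (unliftP 0 i) h => [j ->|->] h.
- rewrite (integral_rVS hF).1 integral0_eq// => a _.
  apply: (IH j) => [|x]; first exact: eb_cons.
  by rewrite -[RHS](h (cons_rV (a : mR, x))); apply: eq_integral => t _; rewrite upd_consS.
- rewrite (integral_rVS hF).2 integral0_eq// => x _.
  (* The 0 is a placeholder, since [upd] overwrites this coordinate. *)
  rewrite -[RHS](h (cons_rV (0 : mR, x))); apply: eq_integral => t _.
  by rewrite upd_cons0.
Qed.

Lemma l1_upd n (x : 'rV[R]_n) i t : l1 (upd x i t) <= l1 x + `|t|.
Proof.
rewrite /l1 (bigD1 i)//= mxE eqxx addrC lerD2r [leRHS](bigD1 i)//=.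
rewrite [X in X <= _](_ : _ = \sum_(j | j != i) `|x 0 j|) ?lerDr//.
by apply: eq_bigr => j ji; rewrite mxE (negbTE ji).
Qed.

Lemma stein n (i : 'I_n) (q dq : 'rV[R]_n -> R) : eb q -> eb dq ->
  (forall x (t : R), is_derive t 1 (fun t => q (upd x i t)) (dq (upd x i t))) ->
  (forall x, continuous (fun t => dq (upd x i t))) ->
  Ex (normal_rV 1) (X i * q - dq) = 0.
Proof.
move=> hq hdq dqE cdq.
set F := X i * q - dq; rewrite /Ex /Rintegral.
have hF : eb F by apply: ebB => //; apply: ebM => //; exact: eb_coord.
rewrite (@integral_upd0 _ i) => // x.
have [_ [C C0 [c c0 h1]]] := hq; have [_ [D D0 [e e0 h2]]] := hF.
(* [stein1] takes one pair of constants for both of its bounds, so those of q and of F are added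
   up. *)
have wk (A a B b : R) (y : 'rV[R]_n) : 0 <= A -> 0 <= a -> 0 <= B -> 0 <= b ->
  A * expR (a * l1 y) <= (A + B) * expR ((a + b) * l1 y).
  move=> *; rewrite ler_pM ?expR_ge0 ?lerDl// ler_expR ler_wpM2r ?l1_ge0 ?lerDl//.
have wk2 t : (C + D) * expR ((c + e) * l1 (upd x i t)) <=
   ((C + D) * expR ((c + e) * l1 x)) * expR ((c + e) * `|t|).
  by rewrite -mulrA -expRD -mulrDr ler_wpM2l ?addr_ge0// ler_expR ler_wpM2l ?addr_ge0 ?l1_upd.
have FE t : F (upd x i t) = t * q (upd x i t) - dq (upd x i t).
  by rewrite /F /X !fctE mxE eqxx.
under eq_integral do rewrite FE.
apply: (stein1 (C := (C + D) * expR ((c + e) * l1 x)) (c := c + e)) => //.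
- by rewrite mulr_ge0 ?expR_ge0 ?addr_ge0.
- move=> t; apply: le_trans (wk2 t); apply: (le_trans (h1 _)); exact: wk.
- move=> t; rewrite -FE; apply: le_trans (wk2 t); apply: (le_trans (h2 _)).
  by rewrite (addrC C) (addrC c); exact: wk.
Qed.

End stein_rV.

(** * Polynomials *)

Section pol.
Context {R : realType} {n : nat}.
Local Notation mu := (@normal_rV R n 1).
Implicit Types (p q : 'rV[R]_n -> R) (i j k : 'I_n) (N : nat).
Local Notation e_ := (delta_mx 0).
Local Notation X := (@X R n).

Lemma is_derive_X i j (x : 'rV[R]_n) : is_derive x (e_ j) (X i) (i == j)%:R.
Proof.
have h : h^-1 *: (X i (h *: e_ j + x) - X i x) @[h --> (0:R)^'] --> ((i == j)%:R : R).
  apply: cvg_near_cst; near=> h; rewrite /X !mxE eqxx andTb addrK /GRing.scale/=.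
  by rewrite mulrA mulVf ?mul1r//; near: h; exact: nbhs_dnbhs_neq.
apply: DeriveDef; first by apply/cvg_ex; exists (i == j)%:R.
by rewrite /derive; apply/cvg_lim.
Unshelve. all: by end_near. Qed.

(** Polynomial functions of degree at most N, as an inductive predicate on functions: facts about
    them are proved by induction on how they are built, and no normal form is required. *)
Inductive pol : nat -> ('rV[R]_n -> R) -> Prop :=
| polC N c : pol N (fun=> c)
| polX N i p : pol N p -> pol N.+1 (X i * p)
| polD N p q : pol N p -> pol N q -> pol N (p + q).

Lemma pol0 N : pol N 0. Proof. exact: polC. Qed.

Lemma pol1 N : pol N 1. Proof. exact: polC. Qed.

Lemma pol_up N p : pol N p -> pol N.+1 p.
Proof. by elim=> *; [exact: polC|exact: polX|exact: polD]. Qed.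

Lemma pol_le M N p : (M <= N)%N -> pol M p -> pol N p.
Proof.
move=> /subnK <-; elim: (N - M)%N => [|d IH] // hp.
by rewrite addSn; exact/pol_up/IH.
Qed.

Lemma polZ N (c : R) p : pol N p -> pol N (c *: p).
Proof.
elim=> {N p} [N a|N i p _ IH|N p q _ IHp _ IHq].
- exact: (polC N (c * a)).
- by rewrite -fct_scalerAr; exact: polX.
- by rewrite scalerDr; exact: polD.
Qed.

Lemma polN N p : pol N p -> pol N (- p).
Proof. by rewrite -scaleN1r; exact: polZ. Qed.

Lemma polB N p q : pol N p -> pol N q -> pol N (p - q).
Proof. by move=> *; apply: polD => //; exact: polN. Qed.

Lemma pol_sum N I (r : seq I) (P : pred I) (F : I -> 'rV[R]_n -> R) :
  (forall a : I, P a -> pol N (F a)) -> pol N (\sum_(a <- r | P a) F a).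
Proof. by move=> h; apply: (big_ind (pol N)) => //; [exact: pol0|exact: polD]. Qed.

Lemma polM M N p q : pol M p -> pol N q -> pol (M + N) (p * q).
Proof.
elim=> {M p} [M a|M i p _ IH|M p p' _ IHp _ IHq] hq.
- have -> : (fun=> a) * q = a *: q by [].
  by apply: (@pol_le N); [exact: leq_addl|exact: polZ].
- by rewrite -mulrA addSn; apply: polX; exact: IH.
- by rewrite mulrDl; apply: polD; [exact: IHp|exact: IHq].
Qed.

Lemma pol_eb N p : pol N p -> eb p.
Proof.
elim=> {N p} [N a|N i p _ IH|N p q _ IHp _ IHq]; first exact: eb_cst.
- exact: ebM (eb_coord i) IH.
- exact: ebD.
Qed.

Lemma pol_L2 N p : pol N p -> L2 mu p.
Proof. by move=> /pol_eb; exact: eb_L2. Qed.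

Lemma pol_derivable N p : pol N p -> forall x i, derivable p x (e_ i).
Proof.
elim=> {N p} [N a|N j p _ IH|N p q _ IHp _ IHq] x i; first exact: derivable_cst.
- by apply: derivableM; [have [] := is_derive_X j i x|exact: IH].
- by apply: derivableD.
Qed.

Lemma D_cst i (c : R) : pderiv i (fun _ : 'rV[R]_n => c) = 0.
Proof. by apply/funext => x; exact: derive_cst. Qed.

Lemma D_0 i : pderiv i (0 : 'rV[R]_n -> R) = 0. Proof. exact: D_cst. Qed.

Lemma D_X M i j p : pol M p ->
  pderiv j (X i * p) = (i == j)%:R *: p + X i * pderiv j p.
Proof.
move=> hp; apply/funext => x; rewrite /pderiv deriveM.
- have [_ ->] := is_derive_X i j x; rewrite !fctE /GRing.scale/=; ring.
- by have [] := is_derive_X i j x.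
- exact: pol_derivable hp _ _.
Qed.

Lemma D_D M N i p q : pol M p -> pol N q -> pderiv i (p + q) = pderiv i p + pderiv i q.
Proof.
move=> hp hq; apply/funext => x; rewrite /pderiv deriveD//; [exact: pol_derivable hp _ _|exact: pol_derivable hq _ _].
Qed.

Lemma D_Z M i (c : R) p : pol M p -> pderiv i (c *: p) = c *: pderiv i p.
Proof.
move=> hp; apply/funext => x.
rewrite /pderiv (_ : c *: p = cst c * p)// deriveM; last exact: pol_derivable hp _ _.
  by rewrite derive_cst scaler0 addr0.
exact: derivable_cst.
Qed.

Lemma D_B M N i p q : pol M p -> pol N q -> pderiv i (p - q) = pderiv i p - pderiv i q.
Proof.
move=> hp hq; rewrite (D_D _ hp (polN hq)) -scaleN1r (D_Z _ _ hq) scaleN1r//.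
Qed.

Lemma D_M M N i p q : pol M p -> pol N q ->
  pderiv i (p * q) = p * pderiv i q + q * pderiv i p.
Proof.
move=> hp hq; apply/funext => x; rewrite /pderiv deriveM//; [exact: pol_derivable hp _ _|exact: pol_derivable hq _ _].
Qed.

(* Degree less than N, so that [polm 0] only holds of the zero polynomial. *)
Definition polm N q := if N is M.+1 then pol M q else q = 0.

Lemma polm_X N i q : polm N q -> pol N (X i * q).
Proof. by case: N => [->|N]; [rewrite mulr0; exact: pol0|exact: polX]. Qed.

Lemma polm_pol N q : polm N q -> pol N q.
Proof. by case: N => [->|N]; [exact: pol0|exact: pol_up]. Qed.

Lemma polmD N p q : polm N p -> polm N q -> polm N (p + q).
Proof. by case: N => [/= -> ->|N]; [rewrite addr0|exact: polD]. Qed.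

Lemma polm_D N i p : pol N p -> polm N (pderiv i p).
Proof.
elim=> {N p} [N a|N j p hp IH|N p q hp IHp hq IHq].
- by rewrite D_cst; case: N => //= N; exact: pol0.
- by rewrite (D_X _ _ hp); apply: polD; [exact: polZ|exact: polm_X].
- by rewrite (D_D _ hp hq); exact: polmD.
Qed.

Lemma pol_D N i p : pol N p -> pol N (pderiv i p).
Proof. by move=> hp; exact/polm_pol/polm_D. Qed.

Lemma D_comm N i j p : pol N p -> pderiv i (pderiv j p) = pderiv j (pderiv i p).
Proof.
elim=> {N p} [N a|N k p hp IH|N p q hp IHp hq IHq].
- by rewrite !D_cst ?D_0.
- rewrite !(D_X _ _ hp) !(D_D _ (polZ _ hp) (polX _ (pol_D _ hp))).
  by rewrite !(D_Z _ _ hp) !(D_X _ _ (pol_D _ hp)) IH addrCA.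
- by rewrite !(D_D _ hp hq) !(D_D _ (pol_D _ hp) (pol_D _ hq)) IHp IHq.
Qed.

Lemma upd_shift (x : 'rV[R]_n) i (h t : R) :
  upd x i (h + t) = h *: e_ i + upd x i t.
Proof.
apply/rowP => j; rewrite !mxE eqxx /= eq_sym.
by case: eqVneq => _ /=; rewrite ?mulr1// mulr0 add0r.
Qed.

(** The partial derivative as an ordinary derivative along the i-th axis, the form that [stein] asks
    for. *)
Lemma is_derive_upd N p i (x : 'rV[R]_n) (t : R) : pol N p ->
  is_derive t (1 : R) (fun t : R => p (upd x i t)) (pderiv i p (upd x i t)).
Proof.
move=> hp; have dp := @pol_derivable N p hp (upd x i t) i.
have e : (fun h : R => h^-1 *: (((fun t : R => p (upd x i t)) \o shift t) (h *: (1:R)) - p (upd x i t))) =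
  (fun h => h^-1 *: ((p \o shift (upd x i t)) (h *: e_ i) - p (upd x i t))).
  by apply/funext => h /=; rewrite [h *: 1]mulr1 upd_shift.
by apply: DeriveDef; rewrite /derivable/derive ?e.
Qed.

Lemma stein_pol N i p : pol N p -> Ex mu (X i * p - pderiv i p) = 0.
Proof.
move=> hp; apply: stein.
- exact: pol_eb hp.
- exact: pol_eb (pol_D _ hp).
- by move=> x t; exact: is_derive_upd hp.
- move=> x t; apply/differentiable_continuous/derivable1_diffP.
  by have [] := is_derive_upd i x t (pol_D i hp).
Qed.

Definition del i p : 'rV[R]_n -> R := X i * p - pderiv i p.

Lemma pol_del N i p : pol N p -> pol N.+1 (del i p).
Proof. by move=> hp; apply: polB; [exact: polX|exact/pol_up/pol_D]. Qed.

(** Stein's identity for p q, whose derivative splits by Leibniz' rule. *)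
Lemma ip_del M N i p q : pol M p -> pol N q ->
  ip mu (pderiv i p) q = ip mu p (del i q).
Proof.
move=> hp hq; have := stein_pol i (polM hp hq).
rewrite (D_M _ hp hq) => h.
apply/eqP; rewrite eq_sym -subr_eq0 -[X in _ == X]h /ip -ExB.
- by apply/eqP; congr (Ex _ _); rewrite /del; ring.
- by apply: L2_intgM; apply: pol_L2; [exact: hp|exact: pol_del hq].
- by apply: L2_intgM; apply: pol_L2; [exact: pol_D hp|exact: hq].
Qed.

Lemma D_del N i j p : pol N p ->
  pderiv j (del i p) = del i (pderiv j p) + (i == j)%:R *: p.
Proof.
move=> hp; rewrite /del (D_B _ (polX i hp) (pol_D i hp)) (D_X _ _ hp).
by rewrite (D_comm _ _ hp); ring.
Qed.

(** Move [del j] to the left as d_j, commute it with [del i], and move the remaining [del i] to the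
    right as d_i. *)
Lemma ip_del_del M N i j p q : pol M p -> pol N q ->
  ip mu (del i p) (del j q) = (i == j)%:R * ip mu p q +
    ip mu (pderiv j p) (pderiv i q).
Proof.
move=> hp hq; rewrite -(ip_del _ (pol_del i hp) hq) (D_del _ _ hp).
rewrite ipDl ?ipZl; [|exact: pol_L2 hp|exact: pol_L2 hq
  |exact: pol_L2 (pol_del _ (pol_D _ hp))|apply: pol_L2; exact: polZ hp|exact: pol_L2 hq].
by rewrite addrC (ipC _ (del i _)) -(ip_del _ hq (pol_D _ hp)) (ipC _ (pderiv i q)).
Qed.

(** The Ornstein-Uhlenbeck operator with positive sign, x^T grad minus the Laplacian. *)
Definition ou p : 'rV[R]_n -> R := \sum_i del i (pderiv i p).

Lemma ou_D M N p q : pol M p -> pol N q -> ou (p + q) = ou p + ou q.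
Proof.
move=> hp hq; rewrite /ou -big_split/=; apply: eq_bigr => i _.
by rewrite /del (D_D _ hp hq) (D_D _ (pol_D _ hp) (pol_D _ hq)) mulrDr opprD addrACA.
Qed.

Lemma ou_Z N (c : R) p : pol N p -> ou (c *: p) = c *: ou p.
Proof.
move=> hp; rewrite /ou scaler_sumr; apply: eq_bigr => i _.
by rewrite /del (D_Z _ _ hp) (D_Z _ _ (pol_D _ hp)) scalerBr fct_scalerAr.
Qed.

Lemma ou_X N i p : pol N p ->
  ou (X i * p) = X i * ou p + X i * p - 2 *: pderiv i p.
Proof.
move=> hp.
have hj j : del j (pderiv j (X i * p)) =
    X i * del j (pderiv j p) + (i == j)%:R *: (X j * p - 2 *: pderiv j p).
  rewrite /del (D_X _ _ hp).
  rewrite (D_D _ (polZ _ hp) (polX _ (pol_D _ hp))) (D_Z _ _ hp) (D_X _ _ (pol_D _ hp)).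
  by apply/funext => x; rewrite !fctE /GRing.scale/=; ring.
transitivity (\sum_j (X i * del j (pderiv j p) + (i == j)%:R *: (X j * p - 2 *: pderiv j p))).
  exact: eq_bigr.
rewrite big_split/= -big_distrr/= [X in _ + X = _](bigD1 i)//= eqxx scale1r.
rewrite [X in _ + (_ + X)]big1 ?addr0 ?addrA//.
by move=> j; rewrite eq_sym => /negbTE ->; rewrite scale0r.
Qed.

(** Euler's relation: x^T grad multiplies the part of degree N by N, and the Laplacian lowers the
    degree. So [ou] is triangular for the degree, with the degrees as eigenvalues. *)
Lemma polm_ou N p : pol N p -> polm N (ou p - N%:R *: p).
Proof.
elim=> {N p} [N a|N j p hp IH|N p q hp IHp hq IHq].
- have -> : ou (fun=> a) = 0.
    by rewrite /ou big1// => i _; rewrite /del D_cst D_0 mulr0 subr0.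
  rewrite sub0r; case: N => [|N] /=; first by rewrite scale0r oppr0.
  exact/polN/polZ/polC.
- rewrite (ou_X _ hp) /=.
  have -> : X j * ou p + X j * p - 2 *: pderiv j p - N.+1%:R *: (X j * p) =
      X j * (ou p - N%:R *: p) - 2 *: pderiv j p.
    by apply/funext => x; rewrite !fctE /GRing.scale/= -natr1; ring.
  by apply: polB; [exact: polm_X|exact/polZ/pol_D].
- rewrite (ou_D hp hq) (_ : _ - _ = (ou p - N%:R *: p) + (ou q - N%:R *: q)).
    exact: polmD.
  by rewrite scalerDr opprD addrACA.
Qed.

Lemma Ex_ou N p : pol N p -> Ex mu (ou p) = 0.
Proof.
move=> hp; rewrite /ou Ex_sum => [|i _]; last first.
  by apply: L2_intg; exact: pol_L2 (pol_del i (pol_D i hp)).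
by rewrite big1// => i _; exact: stein_pol (pol_D i hp).
Qed.

Lemma pol0_cst p : pol 0 p -> exists c, p = (fun=> c).
Proof.
move: {2 3}0%N (erefl 0%N) => N N0 hp; elim: hp N0 => {N p} [N a|N j p hp IH|N p q hp IHp hq IHq] //.
- by exists a.
- by move=> /[dup] /IHp[a ->] /IHq[b ->]; exists (a + b).
Qed.

(** Induction on the degree: subtracting [ou p] divided by the degree removes the leading part and
    keeps the mean zero, since [ou p] has mean zero. A constant of mean zero is 0, which starts the
    induction. *)
Lemma ou_surj N p : pol N p -> Ex mu p = 0 -> exists2 r, pol N r & p = ou r.
Proof.
elim: N p => [|N IH] p hp p0.
  have [c pc] := pol0_cst hp; exists 0; first exact: pol0.
  move: p0; rewrite pc Ex_cst => ->.
  by rewrite /ou big1// => i _; rewrite /del !D_0 mulr0 subr0.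
have hm : pol N (p - (N.+1%:R)^-1 *: ou p).
  have -> : p - (N.+1%:R)^-1 *: ou p = (- (N.+1%:R)^-1) *: (ou p - N.+1%:R *: p).
    by rewrite scalerBr scalerA mulNr mulVf ?pnatr_eq0// !scaleNr opprK scale1r addrC.
  exact: polZ (polm_ou hp).
have hou : pol N.+1 (ou p).
  have -> : ou p = (ou p - N.+1%:R *: p) + N.+1%:R *: p by rewrite subrK.
  by apply: polD; [exact: pol_up (polm_ou hp)|exact: polZ].
have [|r hr re] := IH _ hm.
  rewrite ExB ?ExZ ?(Ex_ou hp) ?p0 ?mulr0 ?subr0//.
  - by apply: L2_intg; exact: pol_L2 hou.
  - by apply: L2_intg; exact: pol_L2 hp.
  - by apply: L2_intg; apply: pol_L2; exact: polZ hou.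
exists ((N.+1%:R)^-1 *: p + r); first by apply: polD; [exact: polZ|exact: pol_up].
by rewrite (ou_D (polZ _ hp) hr) (ou_Z _ hp) -re addrC subrK.
Qed.

Lemma poincare_pol0 N p : pol N p -> Ex mu p = 0 ->
  ip mu p p <= \sum_i ip mu (pderiv i p) (pderiv i p).
Proof.
move=> hp p0; have [r hr re] := ou_surj hp p0.
have hD i := pol_L2 (pol_D i hr); have hDp i := pol_L2 (pol_D i hp).
have hd i := pol_L2 (pol_del i (pol_D i hr)).
have e1 : ip mu p p = \sum_i ip mu (pderiv i r) (pderiv i p).
  rewrite {1}re /ou ip_suml => [|//|]; last exact: pol_L2 hp.
  by apply: eq_bigr => i _; rewrite ipC -(ip_del _ hp (pol_D i hr)) ipC.
(* By [ip_del_del] the right side is the left side plus the sum of the E[(d_i d_j r)^2], which is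
   dropped. *)
have e2 : \sum_i ip mu (pderiv i r) (pderiv i r) <= ip mu p p.
  rewrite {1 2}re /ou ip_suml => [|//|]; last exact: L2_sum.
  apply: (@le_trans _ _ (\sum_i (ip mu (pderiv i r) (pderiv i r) +
     \sum_j ip mu (pderiv j (pderiv i r)) (pderiv j (pderiv i r))))).
    by apply: ler_sum => i _; rewrite lerDl sumr_ge0// => j _; exact: ip_ge0.
  apply: ler_sum => i _; rewrite ip_sumr//.
  rewrite [leRHS](eq_bigr (fun j => (i == j)%:R * ip mu (pderiv i r) (pderiv j r) +
      ip mu (pderiv j (pderiv i r)) (pderiv j (pderiv i r)))); last first.
    move=> j _; rewrite (ip_del_del _ _ (pol_D i hr) (pol_D j hr)).
    by rewrite (D_comm i j hr).
  rewrite big_split/= [X in _ <= X + _](bigD1 i)//= eqxx mul1r.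
  rewrite [X in _ <= _ + X + _]big1 ?addr0//.
  by move=> j; rewrite eq_sym => /negbTE ->; rewrite mul0r.
(* With x = E[p^2], a = E[|grad r|^2] and b = E[|grad p|^2], the three facts read 2 x <= a + b and a
   <= x, so x <= b. *)
have e3 : 2 * \sum_i ip mu (pderiv i r) (pderiv i p) <=
    \sum_i ip mu (pderiv i r) (pderiv i r) + \sum_i ip mu (pderiv i p) (pderiv i p).
  rewrite mulr_sumr -big_split/=; apply: ler_sum => i _.
  have := ip_ge0 mu (pderiv i r - pderiv i p).
  rewrite (ip_sqrB (hD i) (hDp i)).
  by rewrite -addrA addrCA addrC subr_ge0 addrC.
have key (x s a b : R) : x = s -> a <= x -> 2 * s <= a + b -> x <= b.
  by move=> {e1 e2 e3} -> h1 h2; lra.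
exact: key e1 e2 e3.
Qed.

Lemma poincare_pol N p : pol N p ->
  ip mu p p - Ex mu p ^+ 2 <= \sum_i ip mu (pderiv i p) (pderiv i p).
Proof.
move=> hp; have hL := pol_L2 hp.
pose c : 'rV[R]_n -> R := fun=> Ex mu p.
have hc : pol N c by exact: polC.
have hLc : L2 mu c := pol_L2 hc.
have Dc i : pderiv i (p - c) = pderiv i p by rewrite (D_B _ hp hc) D_cst subr0.
have -> : \sum_i ip mu (pderiv i p) (pderiv i p) =
    \sum_i ip mu (pderiv i (p - c)) (pderiv i (p - c)).
  by apply: eq_bigr => i _; rewrite Dc.
have := @poincare_pol0 N (p - c) (polB hp hc).
rewrite ExB; [|exact: L2_intg..]; rewrite Ex_cst subrr => /(_ erefl); apply: le_trans.
rewrite ip_sqrB//.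
have -> : ip mu p c = Ex mu p ^+ 2.
  by rewrite /ip mulrC (_ : c * p = Ex mu p *: p)// ExZ ?expr2//; exact: L2_intg.
have -> : ip mu c c = Ex mu p ^+ 2 by rewrite /ip (Ex_cst _ (_ * _)).
by lra.
Qed.

End pol.

(** * Density of the polynomials *)

Section orthants.
Context {R : realType} {n : nat}.
Local Notation T := 'rV[R]_n.

(** Open orthants form a generating pi-system, and their indicators are products of functions of one
    coordinate. *)
Definition orthant (b : T) : set T := [set x | forall i, b 0 i < x 0 i].

Lemma measurable_orthant b : measurable (orthant b).
Proof.
rewrite (_ : orthant b = \bigcap_(i in [set: 'I_n])
    ((fun x : T => x 0 i) @^-1` `]b 0 i, +oo[)); last first.
  apply/seteqP; split=> [x bx i _|x bx i] /=; first by rewrite in_itv/= bx.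
  by have := bx i Logic.I; rewrite /= in_itv/= andbT.
apply: fin_bigcap_measurable => // i _; rewrite -[X in measurable X]setTI.
by apply: (measurable_coord i).
Qed.

Lemma measurable_rVE : @measurable _ T = <<s range orthant >>.
Proof.
apply/seteqP; split; last first.
  apply: smallest_sub; first exact: sigma_algebra_measurable.
  by move=> _ [b _ <-]; exact: measurable_orthant.
apply: smallest_sub; first exact: smallest_sigma_algebra.
rewrite -bigcup_seq/=; apply: bigcup_sub => i _ _ [Y mY <-]; rewrite setTI.
have sgi := sigma_algebra_image (fun x : T => x 0 i)
  (smallest_sigma_algebra setT (range orthant)).
have mE : @measurable _ R = (@RGenOInfty.G R).-sigma.-measurable.
  exact: RGenOInfty.measurableE.
rewrite mE in mY.
suff : image_set_system setT (fun x : T => x 0 i) <<s range orthant >> Y.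
  by rewrite /image_set_system/= setTI.
apply: mY; split => //= _ [a ->]; rewrite /image_set_system/= setTI.
rewrite (_ : _ @^-1` _ = \bigcup_k
   orthant (\row_j if j == i then a else - k%:R)); last first.
  apply/seteqP; split=> [x /=|x [k _ /(_ i)]]; rewrite /= in_itv/= ?andbT.
    move=> ax; have [k _ hk] : exists2 k : nat, True & l1 x < k%:R.
      by exists (Num.truncn (l1 x)).+1 => //; rewrite truncnS_gt.
    exists k => // j; rewrite mxE; case: eqVneq => [->//|_].
    by rewrite ltrNl (le_lt_trans _ hk)// (le_trans _ (coord_l1 x j))// -normrN ler_norm.
  by rewrite mxE eqxx.
apply: sigma_algebra_bigcup => k; apply: sub_sigma_algebra.
by exists (\row_j if j == i then a else - k%:R).
Qed.

Lemma setI_closed_orthant : setI_closed (range orthant).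
Proof.
move=> _ _ [a _ <-] [b _ <-]; exists (\row_i Num.max (a 0 i) (b 0 i)) => //.
apply/seteqP; split=> [x h|x [ha hb] i]; last by rewrite mxE gt_max ha hb.
by split=> i; have := h i; rewrite mxE gt_max => /andP[].
Qed.

(** A monotone class theorem, by Dynkin induction from the orthants. It is used for the multipliers
    [mult] and for the bounded F with E[F w] = 0. *)
Lemma bounded_class (C : (T -> R) -> Prop) :
  C 1 ->
  (forall u v, C u -> C v -> C (u + v)) ->
  (forall (c : R) u, C u -> C (c *: u)) ->
  (forall u_ u, (forall k, C (u_ k)) -> (forall k x, `|u_ k x| <= 1) ->
    (forall x, u_ k x @[k --> \oo] --> u x) -> C u) ->
  (forall b, C \1_(orthant b)) ->
  forall A, measurable A -> C \1_A.
Proof.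
move=> C1 CD CZ Clim Corth A.
rewrite measurable_rVE; move: A.
apply: (@dynkin_induction _ _ _ (fun A => C \1_A) measurable_rVE setI_closed_orthant).
- by rewrite indicT.
- by move=> _ [b _ <-]; exact: Corth.
- move=> S mS CS; rewrite (_ : \1_(~` S) = 1 + (-1) *: \1_S); last first.
    apply/funext => x; rewrite !fctE !indicE in_setC (_ : (1 : T -> R) x = 1)//.
    by rewrite /GRing.scale; case: (x \in S) => /=; ring.
  by apply: CD => //; exact: CZ.
- move=> F mF tF CF.
  (* By disjointness the partial sums are themselves indicators, so they satisfy the bound 1 that
     the closure under limits requires. *)
  have hk k : \sum_(i < k) \1_(F i) = \1_(\bigcup_(i < k) F i) :> (T -> R).
    elim: k => [|k IH]; first by rewrite big_ord0 bigcup_mkord big_ord0 indic0.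
    rewrite big_ord_recr/= IH; apply/funext => x; rewrite fctE !indicE.
    rewrite !bigcup_mkord big_ord_recr/= in_setU -bigcup_mkord.
    case: (boolP (x \in F k)) => xFk; last by rewrite orbF addr0.
    rewrite orbT (negbTE (_ : x \notin _)) ?add0r//.
    apply/negP; rewrite inE => -[i /= ik Fix].
    move: xFk; rewrite inE => Fkx.
    move/trivIsetP : tF => /(_ i k Logic.I Logic.I); rewrite (ltn_eqF ik) => /(_ isT) /seteqP[+ _].
    by move=> /(_ x); apply.
  apply: (Clim (fun k => \sum_(i < k) \1_(F i))).
  + move=> k; apply: (big_ind C) => //.
    by rewrite -[0](scale0r (1 : T -> R)); exact: CZ.
  + by move=> k x; rewrite hk indicE; case: (_ \in _); rewrite ?normr1 ?normr0.
  + move=> x; apply: cvg_near_cst.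
    have [[i _ Fix]|nF] := pselect ((\bigcup_i F i) x).
      near=> k; rewrite hk !indicE !mem_set//; first by exists i.
      by exists i => //=; near: k; exact: nbhs_infty_gt.
    apply: nearW => k; rewrite hk !indicE !memNset// => -[i _ Fix].
    by apply: nF; exists i.
Unshelve. all: by end_near. Qed.

End orthants.

(** * Signs as limits of sines *)

Section sgn.
Context {R : realType}.

(* Iterating sgstep sends a value of the sine to its sign, which makes indicators of
   half-spaces out of sines. *)
Definition sgstep (y : R) : R := 2^-1 * (3 * y - y * y * y).

Lemma sgstep_bound (y : R) : `|y| <= 1 -> `|sgstep y| <= 1.
Proof.
rewrite !ler_norml /sgstep => /andP[h1 h2]; apply/andP; split.
- have : 0 <= (1 + y) ^+ 2 * (2 - y) by rewrite mulr_ge0 ?sqr_ge0//; lra.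
  lra.
- have : 0 <= (1 - y) ^+ 2 * (2 + y) by rewrite mulr_ge0 ?sqr_ge0//; lra.
  lra.
Qed.

Lemma iter_sgstep_bound (y : R) k : `|y| <= 1 -> `|iter k sgstep y| <= 1.
Proof. by move=> y1; elim: k => //= k; exact: sgstep_bound. Qed.

Lemma iter_sgstepN (y : R) k : iter k sgstep (- y) = - iter k sgstep y.
Proof. by elim: k => //= k ->; rewrite /sgstep; ring. Qed.

Lemma cvg_iter_sgstep_gt0 (y : R) : 0 < y -> y <= 1 ->
  iter k sgstep y @[k --> \oo] --> (1 : R).
Proof.
move=> y0 y1.
(* The iterates increase, because [sgstep w - w] is w (1 - w^2) / 2. The distance to 1 shrinks by
   the factor 1 - (w + w^2) / 2, which is at most 1 - y / 2 once w >= y. *)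
have h k : [/\ y <= iter k sgstep y, iter k sgstep y <= 1 &
    1 - iter k sgstep y <= (1 - y / 2) ^+ k].
  elim: k => [|k [h1 h2 h3]] /=; first by split=> //; rewrite expr0; lra.
  set w := iter k sgstep y in h1 h2 h3 *; rewrite /sgstep.
  have w2 : 0 <= w * (1 - w * w) by rewrite mulr_ge0//; nra.
  have w3 : 0 <= (1 - w) ^+ 2 * (2 + w) by rewrite mulr_ge0 ?sqr_ge0//; lra.
  split; [lra|lra|].
  rewrite exprSr; apply: (@le_trans _ _ ((1 - w) * (1 - y / 2))); last first.
    by rewrite ler_wpM2r//; lra.
  have : 0 <= (1 - w) * (w + w * w - y) by rewrite mulr_ge0//; nra.
  nra.
have hc : 1 - (1 - y / 2) ^+ k @[k --> \oo] --> (1 : R).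
  rewrite -[X in _ --> X]subr0; apply: (@cvgB R R^o); first exact: cvg_cst.
  by apply: cvg_expr; rewrite ger0_norm; lra.
apply: (squeeze_cvgr _ hc (@cvg_cst _ (1 : R) _ _ _)); apply: nearW => k.
by have [_ h2 h3] := h k; apply/andP; split; lra.
Qed.

Lemma cvg_iter_sgstep (y : R) : `|y| <= 1 ->
  iter k sgstep y @[k --> \oo] --> Num.sg y.
Proof.
rewrite ler_norml => /andP[h1 h2].
have [y0|y0|->] := ltgtP y 0; last first.
- have h0 k : iter k sgstep 0 = 0.
    by elim: k => //= k ->; rewrite /sgstep !mulr0 subrr mulr0.
  by rewrite sgr0; under eq_fun do rewrite h0; exact: cvg_cst.
- by have := cvg_iter_sgstep_gt0 y0 h2; rewrite (gtr0_sg y0).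
- rewrite (ltr0_sg y0); have -> : (fun k => iter k sgstep y) = (fun k => - iter k sgstep (- y)).
    by apply/funext => k; rewrite iter_sgstepN opprK.
  by apply: (@cvgN _ R^o); apply: cvg_iter_sgstep_gt0; lra.
Qed.

(** For large k the argument lies between - pi and pi, where the sine has the sign of its
    argument. *)
Lemma cvg_sg_sin (y : R) :
  Num.sg (sin (k.+1%:R^-1 * y)) @[k --> \oo] --> Num.sg y.
Proof.
have hpos (z : R) : 0 < z -> Num.sg (sin (k.+1%:R^-1 * z)) @[k --> \oo] --> (1 : R).
  move=> z0; apply: cvg_near_cst; near=> k.
  rewrite gtr0_sg// sin_gt0_pi// mulr_gt0 ?invr_gt0//=.
  rewrite mulrC ltr_pdivrMr//.
  have : z < k%:R by near: k; exact: nbhs_infty_gtr.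
  have := pi_ge2 R; rewrite -natr1; have : (0:R) <= k%:R by [].
  by move=> k0 hpi zk; apply: (lt_le_trans zk); nra.
have [y0|y0|->] := ltgtP y 0; last first.
- by under eq_fun do rewrite mulr0 sin0 sgr0; rewrite sgr0; exact: cvg_cst.
- by have := hpos _ y0; rewrite (gtr0_sg y0).
- rewrite (ltr0_sg y0); have -> : (fun k => Num.sg (sin (k.+1%:R^-1 * y))) =
      (fun k => - Num.sg (sin (k.+1%:R^-1 * - y))).
    by apply/funext => k; rewrite mulrN sinN sgrN opprK.
  by apply: (@cvgN _ R^o); apply: hpos; lra.
Unshelve. all: by end_near. Qed.

(** A bound uniform in k and of exponential growth: it dominates the Taylor polynomials in the
    Gaussian L^2. *)
Lemma sin_series_le (y : R) k : `|series (sin_coeff y) k| <= expR `|y|.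
Proof.
apply: (@le_trans _ _ (series (exp_coeff `|y|) k)).
  rewrite /series /= (le_trans (ler_norm_sum _ _ _))//; apply: ler_sum => i _.
  rewrite /sin_coeff /exp_coeff /= !normrM normfV normrX normrX normrN1 expr1n mulr1 normr_nat.
  rewrite normr_nat ler_wpM2r ?invr_ge0 ?ler0n// ler_piMl ?exprn_ge0//.
  by case: odd.
rewrite /expR; apply: nondecreasing_cvgn_le; last exact: is_cvg_series_exp_coeff.
apply/nondecreasing_seqP => j; rewrite seriesSr lerDl; exact: exp_coeff_ge0.
Qed.

Lemma cvg_sin_series (y : R) : series (sin_coeff y) k @[k --> \oo] --> sin y.
Proof. by rewrite unlock; exact: is_cvg_series_sin_coeff. Qed.

End sgn.

Import HBNNSimple.

(** * From sines to indicators to all of L^2 *)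

Section density_pol.
Context {R : realType} {n : nat}.
Local Notation T := 'rV[R]_n.
Local Notation mu := (@normal_rV R n 1).
Implicit Types (u v p F a : T -> R).

Definition dens u := L2 mu u /\
  forall e : R, 0 < e -> exists N p, pol N p /\ ip mu (u - p) (u - p) < e.

Lemma dens_pol N p : pol N p -> dens p.
Proof.
move=> hp; split; first exact: pol_L2 hp.
by move=> e e0; exists N, p; split=> //; rewrite subrr /ip mul0r Ex0.
Qed.

Lemma dens_approx u : L2 mu u ->
  (forall e : R, 0 < e -> exists2 v, dens v & ip mu (u - v) (u - v) < e) -> dens u.
Proof.
move=> hu h; split=> // e e0.
have [|v [hv hv'] uv] := h (e / 4); first by rewrite divr_gt0.
have [|N [p [hp vp]]] := hv' (e / 4); first by rewrite divr_gt0.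
exists N, p; split=> //; have hpL := pol_L2 hp.
have -> : u - p = (u - v) + (v - p) by rewrite addrA subrK.
have := ip_sqrD_le (L2B hu hv) (L2B hv hpL).
by move: uv vp; set x := ip _ _ _; set y := ip _ _ _; set w := ip _ _ _; lra.
Qed.

Lemma densD u v : dens u -> dens v -> dens (u + v).
Proof.
move=> [hu hu'] [hv hv']; split=> [|e e0]; first exact: L2D.
have [|M [p [hp up]]] := hu' (e / 4); first by rewrite divr_gt0.
have [|N [q [hq vq]]] := hv' (e / 4); first by rewrite divr_gt0.
exists (maxn M N), (p + q); split.
  by apply: polD; [exact: (pol_le (leq_maxl _ _) hp)|exact: (pol_le (leq_maxr _ _) hq)].
have -> : u + v - (p + q) = (u - p) + (v - q) by rewrite opprD addrACA.
have := ip_sqrD_le (L2B hu (pol_L2 hp)) (L2B hv (pol_L2 hq)).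
by move: up vq; set x := ip _ _ _; set y := ip _ _ _; set w := ip _ _ _; lra.
Qed.

Lemma densZ (c : R) u : dens u -> dens (c *: u).
Proof.
move=> [hu hu']; split=> [|e e0]; first exact: L2Z.
have c1 : 0 < c ^+ 2 + 1 by rewrite ltr_wpDl// sqr_ge0.
have [|M [p [hp up]]] := hu' (e / (c ^+ 2 + 1)); first by rewrite divr_gt0.
exists M, (c *: p); split; first exact: polZ.
have hL := L2B hu (pol_L2 hp).
rewrite -scalerBr ipZl ?ipZr//; last exact: L2Z.
move: up; rewrite ltr_pdivlMr//; have := ip_ge0 mu (u - p).
by set x := ip _ _ _ => x0 h; apply: le_lt_trans h; nra.
Qed.

Lemma dens_dominated (u_ : nat -> T -> R) u g : (forall k, dens (u_ k)) ->
  L2 mu g -> (forall k x, `|u_ k x| <= g x) ->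
  (forall x, u_ k x @[k --> \oo] --> u x) -> dens u.
Proof.
move=> hu hg ug uu.
have mu_ k : measurable_fun setT (u_ k) by case: (hu k) => -[].
have mu0 : measurable_fun setT u.
  by apply: (measurable_fun_cvg mu_) => x _; exact: uu.
have ule x : `|u x| <= g x.
  have : `|u_ k x| @[k --> \oo] --> `|u x| by apply: cvg_norm; exact: uu.
  by move/cvgr_to_le; apply; exact: nearW.
have g0 x : 0 <= g x by rewrite (le_trans _ (ule x)).
have hL : L2 mu u by apply: (L2_le mu0 _ hg) => x; rewrite (ger0_norm (g0 x)).
apply: dens_approx => // e e0.
have [||||_ h] := @dominated_Ex _ _ _ mu (fun k => (u - u_ k) * (u - u_ k)) 0 (4 *: (g * g)).
- by move=> k; apply: measurable_funM; exact: measurable_funB.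
- move=> x; have h : u x - u_ k x @[k --> \oo] --> (0 : R).
    by rewrite -(subrr (u x)); apply: (@cvgB R R^o); [exact: cvg_cst|exact: uu].
  by rewrite -[X in _ --> X](mulr0 (0 : R)); apply: (@cvgM R).
- by apply: intgZ; case: hg.
- move=> k x; rewrite !fctE /GRing.scale/= normrM.
  have h1 : `|u x - u_ k x| <= g x + g x.
    by rewrite (le_trans (ler_normB _ _))// lerD.
  have := ler_pM (normr_ge0 _) (normr_ge0 _) h1 h1; lra.
rewrite Ex0 in h.
have /cvgrPdist_lt/(_ e e0)[k _ /(_ k (leqnn k)) hk] := h.
exists (u_ k) => //; move: hk; rewrite /= sub0r normrN; apply: le_lt_trans.
exact: ler_norm.
Qed.

Definition bfun F := measurable_fun setT F /\ exists C : R, forall x, `|F x| <= C.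

Lemma bfunM u v : bfun u -> bfun v -> bfun (u * v).
Proof.
move=> [mu_ [C uC]] [mv [D vD]]; split; first exact: measurable_funM.
by exists (C * D) => x; rewrite fctE normrM ler_pM.
Qed.

Lemma bfunD u v : bfun u -> bfun v -> bfun (u + v).
Proof.
move=> [mu_ [C uC]] [mv [D vD]]; split; first exact: measurable_funD.
by exists (C + D) => x; rewrite (le_trans (ler_normD _ _))// lerD.
Qed.

Lemma bfun_cst (c : R) : bfun (fun=> c).
Proof. by split; [exact: measurable_cst|exists `|c|]. Qed.

Lemma bfun_lim (u_ : nat -> T -> R) u (C : R) : (forall k, bfun (u_ k)) ->
  (forall k x, `|u_ k x| <= C) ->
  (forall x, u_ k x @[k --> \oo] --> u x) -> bfun u.
Proof.
move=> hu uC uu; split.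
  by apply: (measurable_fun_cvg (fun k => (hu k).1)) => x _; exact: uu.
exists C => x; have : `|u_ k x| @[k --> \oo] --> `|u x| by apply: cvg_norm; exact: uu.
by move/cvgr_to_le; apply; exact: nearW.
Qed.

(** The quantification over all polynomials p is what lets a Taylor polynomial be absorbed into p in
    [mult_sin]. *)
Definition BB F := bfun F /\ forall N p, pol N p -> dens (F * p).

Lemma BB_cst (c : R) : BB (fun=> c).
Proof.
split; first exact: bfun_cst.
by move=> N p hp; exact: densZ (dens_pol hp).
Qed.

Lemma BBD F G : BB F -> BB G -> BB (F + G).
Proof.
move=> [bF hF] [bG hG]; split; first exact: bfunD.
by move=> N p hp; rewrite mulrDl; apply: densD; [exact: hF hp|exact: hG hp].
Qed.

Lemma BB_lim (F_ : nat -> T -> R) F (C : R) : (forall k, BB (F_ k)) ->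
  (forall k x, `|F_ k x| <= C) ->
  (forall x, F_ k x @[k --> \oo] --> F x) -> BB F.
Proof.
move=> hF FC FF; have bF : bfun F by apply: bfun_lim FC FF => k; case: (hF k).
split=> // N p hp.
apply: (@dens_dominated (fun k => F_ k * p) _ (C *: (fun x => `|p x|))).
- by move=> k; exact: (hF k).2 hp.
- apply: L2Z; apply: L2_le (pol_L2 hp) => [|x]; last by rewrite normr_id.
  by apply: measurableT_comp => //; case: (pol_eb hp).
- move=> k x; rewrite !fctE normrM /GRing.scale/=; exact: ler_wpM2r.
- by move=> x; apply: (@cvgM R); [exact: FF|exact: cvg_cst].
Qed.

(** Multipliers of [BB]. They compose, so products of multipliers are multipliers with no further
    approximation; they also form a vector space closed under bounded pointwise limits. *)
Definition mult a := bfun a /\ forall F, BB F -> BB (a * F).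

Lemma mult_cst (c : R) : mult (fun=> c).
Proof.
split; first exact: bfun_cst.
move=> F [bF hF]; split; first exact: bfunM (bfun_cst c) bF.
move=> N p hp; rewrite -mulrA; exact: densZ (hF _ _ hp).
Qed.

Lemma multM a b : mult a -> mult b -> mult (a * b).
Proof.
move=> [ba ha] [bb hb]; split; first exact: bfunM.
by move=> F hF; rewrite -mulrA; exact/ha/hb.
Qed.

Lemma multD a b : mult a -> mult b -> mult (a + b).
Proof.
move=> [ba ha] [bb hb]; split; first exact: bfunD.
by move=> F hF; rewrite mulrDl; apply: BBD; [exact: ha|exact: hb].
Qed.

Lemma multZ (c : R) a : mult a -> mult (c *: a).
Proof. by move=> ha; exact: multM (mult_cst c) ha. Qed.

Lemma mult_lim (a_ : nat -> T -> R) a (C : R) : (forall k, mult (a_ k)) ->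
  (forall k x, `|a_ k x| <= C) ->
  (forall x, a_ k x @[k --> \oo] --> a x) -> mult a.
Proof.
move=> ha aC aa; split; first by apply: bfun_lim aC aa => k; case: (ha k).
move=> F hF; have [_ [D FD]] := hF.1.
apply: (@BB_lim (fun k => a_ k * F) _ (C * D)).
- by move=> k; exact: (ha k).2.
- by move=> k x; rewrite !fctE normrM; exact: ler_pM.
- by move=> x; apply: (@cvgM R); [exact: aa|exact: cvg_cst].
Qed.

Lemma pol_affine_exp (t b : R) i k : pol k (((t *: (X i - fun=> b)) : T -> R) ^+ k).
Proof.
elim: k => [|k IH]; first exact: pol1.
rewrite exprS fct_scalerAl; apply: polZ.
rewrite mulrBl; apply: polB; first exact: polX.
by apply: pol_up; exact: (polZ b IH).
Qed.

(** If q_k are the Taylor polynomials of the sine, then q_k p is a polynomial, so F q_k p is in the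
    closure; it converges to F sin p under an exponential bound. *)
Lemma mult_sin (t b : R) i : mult (fun x : T => sin (t * (x 0 i - b))).
Proof.
have ms : measurable_fun setT (fun x : T => sin (t * (x 0 i - b))).
  have mi : measurable_fun setT (fun x : T => t * (x 0 i - b)).
    apply: (measurable_funM (measurable_cst _)).
    exact: (measurable_funB (measurable_coord i) (measurable_cst _)).
  apply: (measurableT_comp _ mi).
  by apply: continuous_measurable_fun; exact: continuous_sin.
have bs : bfun (fun x : T => sin (t * (x 0 i - b))).
  by split=> //; exists 1 => x; exact: sin_max.
split=> // F hF; split; first exact: bfunM bs hF.1.
move=> N p hp.
pose Y : T -> R := t *: (X i - fun=> b).
pose q k : T -> R := \sum_(0 <= j < k) ((odd j)%:R * (-1) ^+ j.-1./2 / j`!%:R) *: Y ^+ j.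
have qE k x : q k x = series (sin_coeff (t * (x 0 i - b))) k.
  rewrite /q /series /= fct_sumE; apply: eq_bigr => j _.
  rewrite !fctE /GRing.scale /sin_coeff /=.
  by rewrite mulrAC.
have hq k : pol k (q k).
  rewrite /q big_mkord; apply: pol_sum => j _; apply: polZ.
  by apply: (pol_le (ltnW (ltn_ord j))); exact: pol_affine_exp.
have [mF [C FC]] := hF.1.
(* Comes from |t (x_i - b)| <= |t| |b| + |t| l1(x) in the exponent of [sin_series_le]. *)
pose g : T -> R := fun x => `|C| * (expR (`|t| * `|b|) * expR (`|t| * l1 x)) * `|p x|.
apply: (@dens_dominated (fun k => F * (q k * p)) _ g).
- by move=> k; exact: hF.2 (polM (hq k) hp).
- apply: eb_L2; apply: (@ebM _ _ (fun x => `|C| * (expR (`|t| * `|b|) * expR (`|t| * l1 x)))); last first.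
    by apply: eb_le (pol_eb hp) => [|x]; [apply: measurableT_comp => //; case: (pol_eb hp)|rewrite normr_id].
  split.
    exact: (measurable_funM (measurable_cst _)
      (measurable_funM (measurable_cst _) (measurable_exp_l1 _))).
  exists (`|C| * expR (`|t| * `|b|)); first by rewrite mulr_ge0// expR_ge0.
  exists `|t| => // x; rewrite normrM normr_id ger0_norm ?mulrA//.
- move=> k x; rewrite !fctE !normrM /g mulrA ler_wpM2r// ler_pM//.
    by rewrite (le_trans (FC x))// ler_norm.
  rewrite qE (le_trans (sin_series_le _ _))// -expRD ler_expR normrM -mulrDr.
  rewrite ler_wpM2l// (le_trans (ler_normB _ _))// addrC lerD2l.
  exact: coord_l1.
- move=> x.
  have -> : ((fun x0 : T => sin (t * (x0 0 i - b))) * F * p) x =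
     F x * (sin (t * (x 0 i - b)) * p x) by rewrite !fctE mulrCA mulrA.
  apply: (@cvgM R); first exact: cvg_cst.
  apply: (@cvgM R); last exact: cvg_cst.
  by rewrite /=; under eq_fun do rewrite qE; exact: cvg_sin_series.
Qed.

Lemma mult_orthant (b : T) : mult \1_(orthant b).
Proof.
have hsg (c : R) i : mult (fun x : T => Num.sg (x 0 i - c)).
  (* Two nested limits: the outer one replaces the sign of sin (y / (k + 1)) by that of y, the inner
     one obtains the sign of the sine by iterating [sgstep]. *)
  apply: (@mult_lim (fun k x => Num.sg (sin (k.+1%:R^-1 * (x 0 i - c)))) _ 1).
  - move=> k.
    apply: (@mult_lim (fun m x => iter m sgstep (sin (k.+1%:R^-1 * (x 0 i - c)))) _ 1).
    + elim=> [|m IH]; first exact: mult_sin.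
      set w := (fun x => iter m _ _) in IH.
      rewrite (_ : (fun x => _) = 2^-1 *: (3 *: w + (-1) *: (w * w * w))).
        apply: multZ; apply: multD; first exact: multZ.
        by apply: multZ; do 2?apply: multM.
      by apply/funext => x; rewrite /= /sgstep !fctE /GRing.scale/= mulN1r.
    + move=> m x; exact/iter_sgstep_bound/sin_max.
    + move=> x; exact/cvg_iter_sgstep/sin_max.
  - by move=> k x; rewrite normr_sg; case: (_ != _).
  - by move=> x; exact: cvg_sg_sin.
(* For a sign e, (e + e^2) / 2 is 1 if e = 1 and 0 otherwise. *)
have -> : \1_(orthant b) = \prod_i (2^-1 *: ((fun x : T => Num.sg (x 0 i - b 0 i)) +
    (fun x : T => Num.sg (x 0 i - b 0 i)) * (fun x : T => Num.sg (x 0 i - b 0 i)))).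
  apply/funext => x; rewrite fct_prodE indicE.
  have e i : (2^-1 *: ((fun x : T => Num.sg (x 0 i - b 0 i)) +
    (fun x : T => Num.sg (x 0 i - b 0 i)) * (fun x : T => Num.sg (x 0 i - b 0 i)))) x =
    ((b 0 i < x 0 i)%R)%:R.
    rewrite !fctE /GRing.scale/=; have [h|h|h] := ltgtP (b 0 i) (x 0 i).
    - by rewrite gtr0_sg ?subr_gt0//=; field.
    - by rewrite ltr0_sg ?subr_lt0//=; ring.
    - by rewrite h subrr sgr0/=; ring.
  rewrite (eq_bigr _ (fun i _ => e i)).
  case: (boolP (x \in orthant b)) => [/set_mem xb|xb].
    by rewrite big1// => i _; rewrite xb.
  have /existsNP[i bxi] : ~ (forall i, b 0 i < x 0 i).
    by move=> h; move/negP: xb; apply; exact: mem_set.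
  by rewrite (bigD1 i)//= (negbTE (introT negP bxi)) mul0r.
apply: (big_ind mult); [exact: mult_cst|exact: multM|].
by move=> i _; apply: multZ; apply: multD; [|apply: multM]; exact: hsg.
Qed.

Lemma mult_indic A : measurable A -> mult \1_A.
Proof.
apply: bounded_class.
- exact: mult_cst.
- exact: multD.
- exact: multZ.
- by move=> u_ u hu u1 uu; exact: mult_lim u1 uu.
- exact: mult_orthant.
Qed.

Lemma dens_indic A : measurable A -> dens \1_A.
Proof.
move=> /mult_indic[_ /(_ _ (BB_cst 1))[_ /(_ _ _ (pol1 0))]].
by rewrite !mulr1.
Qed.

Lemma dens_ge0 u : L2 mu u -> (forall x, 0 <= u x) -> dens u.
Proof.
move=> hu u0; have mEu : measurable_fun setT (EFin \o u) by apply/measurable_EFinP; case: hu.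
pose h := nnsfun_approx measurableT mEu.
have hcv x : h k x @[k --> \oo] --> u x.
  have := cvg_nnsfun_approx measurableT mEu (fun x _ => u0 x) (Logic.I : setT x).
  by move/fine_cvg.
apply: (@dens_dominated h u u) => //.
- move=> k.
  rewrite (_ : (h k : T -> R) = \sum_(i < #|` fset_set (range (h k))|)
    ((fset_set (range (h k)))`_i *: \1_(h k @^-1` [set (fset_set (range (h k)))`_i]))); last first.
    by apply/funext => x; rewrite {1}fimfunEord fct_sumE.
  apply: (big_ind dens); [exact: dens_pol (pol0 0)|exact: densD|].
  by move=> i _; apply: densZ; apply: dens_indic; exact: measurable_sfunP.
- move=> k x; rewrite ger0_norm//.
  rewrite -(cvg_lim (@Rhausdorff R) (hcv x)); apply: (@nondecreasing_cvgn_le _ (fun k => h k x)).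
    by move=> i j ij; have /lefP := nd_nnsfun_approx measurableT mEu ij; exact.
  by apply/cvg_ex; exists (u x); exact: hcv.
Qed.

Lemma dens_L2 u : L2 mu u -> dens u.
Proof.
move=> hu; have [mu0 _] := hu.
have hn : L2 mu (fun x => `|u x|).
  by apply: (L2_le _ _ hu) => [|x]; [exact: measurableT_comp|rewrite normr_id].
have -> : u = 2^-1 *: ((fun x => `|u x|) + u) + (- 2^-1) *: ((fun x => `|u x|) - u).
  by apply/funext => x; rewrite !fctE /GRing.scale/=; field.
apply: densD; apply: densZ; apply: dens_ge0.
- exact: L2D.
- by move=> x; rewrite !fctE; have := ler_norm (- u x); rewrite normrN; lra.
- exact: L2B.
- by move=> x; rewrite !fctE subr_ge0 ler_norm.
Qed.

End density_pol.

(** * Sobolev functions as limits of polynomials *)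

Lemma cvg_sumr (R : realType) (I : Type) (r : seq I) (f : I -> nat -> R) (l : I -> R) :
  (forall i, f i k @[k --> \oo] --> l i) ->
  (\sum_(i <- r) f i k) @[k --> \oo] --> \sum_(i <- r) l i.
Proof.
move=> h; elim: r => [|i r IH].
  by rewrite big_nil; under eq_fun do rewrite big_nil; exact: cvg_cst.
by rewrite big_cons; under eq_fun do rewrite big_cons; apply: cvgD.
Qed.

Section sob.
Context {R : realType} {n : nat}.
Local Notation T := 'rV[R]_n.
Local Notation mu := (@normal_rV R n 1).
Local Notation X := (@X R n).
Implicit Types (u v p q r w : T -> R) (G H : 'I_n -> T -> R) (i j : 'I_n).

(** Orthogonal projection of u on the span of l. That p lies in the span is expressed by S p
    together with orthogonality: whatever is orthogonal to l is orthogonal to p. This is the form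
    that the induction consumes. *)
Lemma gram_schmidt (l : seq (T -> R)) (S : (T -> R) -> Prop) :
  S 0 -> (forall p q, S p -> S q -> S (p + q)) ->
  (forall (c : R) p, S p -> S (c *: p)) ->
  (forall p, S p -> L2 mu p) -> (forall b, b \in l -> S b) ->
  forall u, L2 mu u -> exists p, [/\ S p,
    forall r, L2 mu r -> (forall b, b \in l -> ip mu r b = 0) -> ip mu r p = 0 &
    forall b, b \in l -> ip mu (u - p) b = 0].
Proof.
move=> S0 SD SZ SL; elim: l => [|b l IH] Sl u hu.
  by exists 0; split=> // r hr _; rewrite /ip mulr0 Ex0.
have Sl' b' : b' \in l -> S b' by move=> h; apply: Sl; rewrite inE h orbT.
have Sb : S b by apply: Sl; rewrite inE eqxx.
have [p [Sp pp up]] := IH Sl' u hu.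
have [q [Sq qq bq]] := IH Sl' b (SL _ Sb).
have SB : S (b - q) by rewrite -scaleN1r; apply: SD => //; exact: SZ.
have hB := SL _ SB; have hp := SL _ Sp; have hq := SL _ Sq; have hb := SL _ Sb.
pose c := ip mu (u - p) (b - q) / ip mu (b - q) (b - q).
have Sp' : S (p + c *: (b - q)) by apply: SD => //; exact: SZ.
have e : u - (p + c *: (b - q)) = (u - p) - c *: (b - q) by rewrite opprD addrA.
have hup := L2B hu hp; have hcB := L2Z c hB; have hr' := L2B hup hcB.
have perp b' : b' \in l -> ip mu (u - (p + c *: (b - q))) b' = 0.
  move=> b'l; have hb' := SL _ (Sl' _ b'l).
  by rewrite e ipBl// up// ipZl// bq// mulr0 subrr.
exists (p + c *: (b - q)); split=> //.
- move=> r hr rl.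
  have rl' b' : b' \in l -> ip mu r b' = 0 by move=> h; apply: rl; rewrite inE h orbT.
  rewrite ipDr// pp// ipZr// ipBr// qq// rl ?inE ?eqxx//.
  by rewrite subrr mulr0 addr0.
- move=> b'; rewrite inE => /predU1P[->|]; last exact: perp.
  rewrite -[X in ip _ _ X](subrK q) ipDr//; last by rewrite e.
  rewrite (qq _ _ perp); last by rewrite e.
  rewrite addr0 e ipBl// ipZl// /c.
  (* If b - q has norm zero, Cauchy-Schwarz makes it orthogonal to everything, whatever c is. *)
  have [B0|B0] := eqVneq (ip mu (b - q) (b - q)) 0; last by rewrite divfK// subrr.
  by rewrite B0 mulr0 subr0; exact: ip_eq0.
Qed.

Fixpoint monos N : seq (T -> R) :=
  if N is M.+1 then 1 :: [seq X i * m | i <- enum 'I_n, m <- monos M] else [:: 1].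

Lemma pol_monos N b : b \in monos N -> pol N b.
Proof.
elim: N b => [|N IH] b /=; first by rewrite inE => /eqP ->; exact: pol1.
rewrite inE => /predU1P[->|/allpairsP[[i m] /= [_ hm ->]]]; first exact: pol1.
by apply: polX; exact: IH.
Qed.

(** w is generalized so that the induction can move a factor x_i from p to w. Integrability against
    all polynomials is preserved by this move. *)
Lemma monos_perp N p : pol N p -> forall w,
  (forall M q, pol M q -> intg mu (w * q)) ->
  (forall m, m \in monos N -> Ex mu (w * m) = 0) -> Ex mu (w * p) = 0.
Proof.
elim=> {N p} [N c|N i p _ IH|N p q hp IHp hq IHq] w iw hw.
- have -> : w * (fun=> c) = c *: (w * 1).
    by rewrite mulr1; apply/funext => x; exact: mulrC.
  rewrite ExZ; last exact: iw (pol1 0).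
  by rewrite hw ?mulr0//; case: N {hw} => [|N]; rewrite /= inE eqxx.
- rewrite mulrA; apply: IH => [M q hq|m hm].
    by rewrite -mulrA; exact: iw (polX i hq).
  by rewrite -mulrA hw//= inE; apply/orP; right; apply: allpairs_f => //; rewrite mem_enum.
- by rewrite mulrDr ExD ?IHp ?IHq ?addr0//; [exact: iw hp|exact: iw hq].
Qed.

(** Orthogonal projection on degree N, kept as a relation: existence and minimality of the distance
    suffice below. *)
Definition proj N u p := pol N p /\ forall q, pol N q -> ip mu (u - p) q = 0.

Lemma proj_ex N u : L2 mu u -> exists p, proj N u p.
Proof.
move=> hu.
have [||||| p [hp _ up]] := @gram_schmidt (monos N) (pol N) _ _ _ _ _ u hu.
- exact: pol0.
- exact: polD.
- exact: polZ.
- by move=> p; exact: pol_L2.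
- exact: pol_monos.
exists p; split=> // q hq; apply: (monos_perp hq) => [M q' hq'|m hm]; last exact: up.
by apply: L2_intgM; [apply: L2B => //; exact: pol_L2 hp|exact: pol_L2 hq'].
Qed.

Lemma proj_best N u p q : L2 mu u -> proj N u p -> pol N q ->
  ip mu (p - u) (p - u) <= ip mu (u - q) (u - q).
Proof.
move=> hu [hp up] hq.
have -> : u - q = (u - p) + (p - q) by rewrite addrA subrK.
have hpL := pol_L2 hp; have hqL := pol_L2 hq.
rewrite (ip_sqrD (L2B hu hpL) (L2B hpL hqL)) (up _ (polB hp hq)).
rewrite mulr0 addr0 (_ : ip mu (p - u) (p - u) = ip mu (u - p) (u - p)).
  by rewrite lerDl ip_ge0.
by rewrite /ip -mulrNN !opprB.
Qed.

(** By density some polynomial, of degree M say, is close to u; for N >= M the projection is at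
    least as close. *)
Lemma proj_cvg u (p : nat -> T -> R) : L2 mu u ->
  (forall N, proj N u (p N)) -> cvgL2 mu p u.
Proof.
move=> hu hp; apply/cvgrPdist_lt => e e0.
have [_ /(_ e e0)[M [q [hq uq]]]] := dens_L2 hu.
near=> N; rewrite sub0r normrN ger0_norm ?ip_ge0//; apply: le_lt_trans uq.
apply: (proj_best hu (hp N)); apply: (pol_le _ hq).
by near: N; exact: nbhs_infty_ge.
Unshelve. all: by end_near. Qed.

(** A Hilbert space form of W^{1,2}: G is the gradient of u when tested against polynomials only,
    through the adjoints [del i]. *)
Definition sob u G := [/\ L2 mu u, forall i, L2 mu (G i) &
  forall i N q, pol N q -> ip mu (G i) q = ip mu u (del i q)].

Lemma sob_L2 u G : sob u G -> L2 mu u. Proof. by case. Qed.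

Lemma sob_L2G u G i : sob u G -> L2 mu (G i). Proof. by case. Qed.

Lemma sob_pol N p : pol N p -> sob p (fun i => pderiv i p).
Proof.
move=> hp; split; [exact: pol_L2 hp|by move=> i; exact: pol_L2 (pol_D i hp)|].
by move=> i M q hq; exact: ip_del hp hq.
Qed.

Lemma sobB u v G H : sob u G -> sob v H -> sob (u - v) (fun i => G i - H i).
Proof.
move=> [hu hG uG] [hv hH vH]; split=> [|i|i N q hq]; [exact: L2B|exact: L2B|].
have hqL := pol_L2 hq; have hd := pol_L2 (pol_del i hq).
by rewrite !ipBl// (uG i _ _ hq) (vH i _ _ hq).
Qed.

(* del_i, the adjoint of d_i, raises the degree by one; hence derivation maps the
   projection of u on degree N+1 to the projection of its gradient on degree N. *)
Lemma proj_D N u G i p : sob u G -> proj N.+1 u p -> proj N (G i) (pderiv i p).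
Proof.
move=> [hu hG uG] [hp up]; have hDp : pol N (pderiv i p) := polm_D i hp.
split=> // q hq; have hd := pol_del i hq.
rewrite ipBl; [|exact: hG|exact: pol_L2 hDp|exact: pol_L2 hq].
rewrite (uG i _ _ hq) (ip_del i hp hq) -ipBl; [|exact: hu|exact: pol_L2 hp|exact: pol_L2 hd].
exact: up.
Qed.

Lemma sob_approx u G : sob u G -> exists p : nat -> T -> R,
  [/\ forall k, pol k.+1 (p k), cvgL2 mu p u &
      forall i, cvgL2 mu (fun k => pderiv i (p k)) (G i)].
Proof.
move=> uG; have hu := sob_L2 uG.
have [p hp] := choice (fun N => proj_ex N hu).
(* The shift by one makes the derivative of the k-th term the projection of the gradient on degree
   k. *)
exists (fun k => p k.+1); split=> [k||i]; first by case: (hp k.+1).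
- have := proj_cvg hu hp; rewrite /cvgL2 => h.
  by have := h; rewrite -(cvg_shiftS (fun k => ip mu (p k - u) (p k - u))).
- by apply: proj_cvg => [|N]; [exact: sob_L2G uG|exact: proj_D uG (hp N.+1)].
Qed.

(** x_i p = del_i p + d_i p, and E[(del_i p)^2] = E[p^2] + E[(d_i p)^2]. *)
Lemma pol_X_le N p i : pol N p ->
  ip mu (X i * p) (X i * p) <= 2 * ip mu p p + 4 * ip mu (pderiv i p) (pderiv i p).
Proof.
move=> hp; have e : X i * p = del i p + pderiv i p by rewrite /del subrK.
rewrite e; apply: (le_trans (ip_sqrD_le (pol_L2 (pol_del i hp)) (pol_L2 (pol_D i hp)))).
rewrite (ip_del_del _ _ hp hp) eqxx mul1r.
by set a := ip _ _ _; set b := ip _ _ _; lra.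
Qed.

(** Monotone convergence applied to the squares. *)
Lemma L2_lim_le (a_ : nat -> T -> R) a (C : R) : (forall k, L2 mu (a_ k)) ->
  (forall x, nondecreasing_seq (fun k => `|a_ k x|)) ->
  (forall x, a_ k x @[k --> \oo] --> a x) ->
  (forall k, ip mu (a_ k) (a_ k) <= C) -> L2 mu a /\ ip mu a a <= C.
Proof.
move=> ha nda aa aC.
have ma : measurable_fun setT a.
  by apply: (measurable_fun_cvg (fun k => (ha k).1)) => x _; exact: aa.
pose g_ k := EFin \o (a_ k * a_ k).
have gE k : (\int[mu]_x g_ k x = (ip mu (a_ k) (a_ k))%:E)%E.
  by rewrite /ip /Ex /Rintegral fineK//; apply: integrable_fin_num => //; case: (ha k).
have g0 k x : (0 <= g_ k x)%E by rewrite lee_fin fctE -expr2 sqr_ge0.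
have mg k : measurable_fun setT (g_ k).
  by apply/measurable_EFinP; apply: measurable_funM; case: (ha k).
have ndg x : setT x -> nondecreasing_seq (fun k => g_ k x).
  move=> _ k m km; rewrite lee_fin !fctE -!expr2 -(real_normK (num_real (a_ k x))).
  by rewrite -(real_normK (num_real (a_ m x))) ler_pXn2r ?nnegrE//; exact: nda.
have limg x : limn (fun k => g_ k x) = (a x * a x)%:E.
  apply/cvg_lim => //; apply: cvg_EFin; first exact: nearW.
  exact: (@cvgM R).
have e : (\int[mu]_x (a x * a x)%:E = limn (fun k => \int[mu]_x g_ k x))%E.
  rewrite -monotone_convergence//.
  by apply: eq_integral => x _; rewrite limg.
have aC' : (\int[mu]_x (a x * a x)%:E <= C%:E)%E.
  rewrite e; apply: lime_le.
    apply: ereal_nondecreasing_is_cvgn => k m km; apply: ge0_le_integral => //.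
    by move=> x _; exact: ndg.
  by apply: nearW => k; rewrite gE lee_fin.
have i0 : (0 <= \int[mu]_x (a x * a x)%:E)%E.
  by apply: integral_ge0 => x _; rewrite lee_fin -expr2 sqr_ge0.
have fin : (\int[mu]_x (a x * a x)%:E)%E \is a fin_num.
  by rewrite ge0_fin_numE// (le_lt_trans aC')// ltry.
split; last by rewrite /ip /Ex /Rintegral -lee_fin fineK.
split=> //; apply/integrableP; split.
  by apply/measurable_EFinP; exact: measurable_funM.
rewrite (eq_integral (fun x => (a x * a x)%:E)); first by rewrite -ge0_fin_numE.
by move=> x _; rewrite /= ger0_norm// -expr2 sqr_ge0.
Qed.

(** L^2 convergence of polynomials p_k to u says nothing about x_i u at once, as x_i is unbounded.
    With x_i cut off at M, let k tend to infinity first and M afterwards. The constants are twice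
    those of [pol_X_le], because of the splitting into two terms. *)
Lemma sob_X_le u G i : sob u G -> L2 mu (X i * u) /\
  ip mu (X i * u) (X i * u) <= 4 * ip mu u u + 8 * ip mu (G i) (G i).
Proof.
move=> uG; have hu := sob_L2 uG; have hGi := sob_L2G i uG.
have [p [hp pu pG]] := sob_approx uG.
pose a (M : nat) : T -> R := \1_[set x : T | `|x 0 i| <= M%:R] * X i.
have ma M : measurable_fun setT (a M).
  apply: measurable_funM; last exact: measurable_coord.
  apply: measurable_indic.
  rewrite -[X in measurable X]setTI.
  rewrite (_ : [set x | _] = (fun x : T => `|x 0 i|) @^-1` `]-oo, M%:R]%classic); last first.
    by apply/seteqP; split=> x /=; rewrite in_itv.
  by apply: (measurableT_comp _ (measurable_coord i)) => //.
have aM M x : `|a M x| <= M%:R.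
  rewrite /a fctE normrM indicE; case: (boolP (x \in _)) => [/set_mem/= h|_].
    by rewrite normr1 mul1r.
  by rewrite normr0 mul0r.
have aX M x : `|a M x| <= `|x 0 i|.
  by rewrite /a fctE normrM indicE ler_piMl//; case: (_ \in _); rewrite ?normr1 ?normr0.
apply: (@L2_lim_le (fun M => a M * u)).
- by move=> M; exact: L2_bddM (ma M) (aM M) hu.
- move=> x M M' MM'; change (`|a M x * u x| <= `|a M' x * u x|).
  rewrite !normrM ler_wpM2r// ler_wpM2r//.
  rewrite !indicE; case: (boolP (x \in [set _ | _])) => [/set_mem/= h|_]; last by rewrite normr0.
  by rewrite mem_set//= (le_trans h)// ler_nat.
- move=> x; apply: cvg_near_cst; near=> M; rewrite /a !fctE indicE mem_set ?mul1r//=.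
  by near: M; exact: nbhs_infty_ger.
- move=> M.
  (* Split u into p_k and u - p_k. The part with u - p_k vanishes as k grows, M being fixed; the
     other is bounded independently of M, as |a_M| <= |x_i|. *)
  have h k : ip mu (a M * u) (a M * u) <= 2 * (M%:R ^+ 2 * ip mu (p k - u) (p k - u)) +
      2 * (2 * ip mu (p k) (p k) + 4 * ip mu (pderiv i (p k)) (pderiv i (p k))).
    have hpk := pol_L2 (hp k); have hd := L2B hpk hu.
    have e : a M * u = (a M * p k) - a M * (p k - u) by rewrite mulrBr opprB addrC subrK.
    have h1 : L2 mu (a M * p k) by exact: L2_bddM (ma M) (aM M) hpk.
    have h2 : L2 mu (a M * (p k - u)) by exact: L2_bddM (ma M) (aM M) hd.
    rewrite e; apply: (le_trans (ip_sqrD_le h1 (L2N h2))).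
    rewrite addrC; apply: lerD; rewrite ler_pM2l//.
      rewrite [X in X <= _]/ip mulrNN.
      rewrite -ExZ; last by case: hd.
      apply: le_Ex; [by case: h2|by apply: intgZ; case: hd|].
      move=> x; rewrite !fctE /GRing.scale/= mulrACA ler_wpM2r -?expr2 ?sqr_ge0//.
      by rewrite -(real_normK (num_real (a M x))) ler_pXn2r// nnegrE.
    apply: le_trans (pol_X_le i (hp k)).
    have h3 := pol_L2 (polX i (hp k)).
    apply: le_Ex; [by case: h1|by case: h3|].
    move=> x; rewrite !fctE -!expr2 -(real_normK (num_real (a M x * _))).
    rewrite -(real_normK (num_real (X i x * _))) ler_pXn2r ?nnegrE//.
    by rewrite !normrM ler_wpM2r//; have := aX M x; rewrite /a fctE normrM.
  have hc : 2 * (M%:R ^+ 2 * ip mu (p k - u) (p k - u)) +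
      2 * (2 * ip mu (p k) (p k) + 4 * ip mu (pderiv i (p k)) (pderiv i (p k)))
      @[k --> \oo] --> 2 * (M%:R ^+ 2 * 0) + 2 * (2 * ip mu u u + 4 * ip mu (G i) (G i)).
    have hpL k := pol_L2 (hp k); have hDL k := pol_L2 (pol_D i (hp k)).
    apply: cvgD; apply: cvgMr; first exact: cvgMr.
    by apply: cvgD; apply: cvgMr; apply: cvg_ip.
  apply: (@le_trans _ _ (2 * (M%:R ^+ 2 * 0) + 2 * (2 * ip mu u u + 4 * ip mu (G i) (G i)))).
    by move/cvgr_to_ge: hc; apply; apply: nearW => m; exact: h.
  rewrite mulr0 mulr0 add0r {h hc}.
  by set A := ip _ _ _; set B := ip _ _ _; lra.
Unshelve. all: by end_near. Qed.

(** [del i u], with w standing for the weak derivative d_i u. *)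
Definition dl i u w : T -> R := X i * u - w.

Lemma sob_dl u G i : sob u G -> L2 mu (dl i u (G i)).
Proof.
by move=> uG; apply: L2B; [exact: (sob_X_le i uG).1|exact: sob_L2G uG].
Qed.

(** [sob_X_le] is applied to the difference p_k - u, itself a Sobolev function. The constants are 8
    = 2 * 4 and 18 = 2 * 8 + 2. *)
Lemma cvg_dl u G i (p : nat -> T -> R) : sob u G ->
  (forall k, pol k.+1 (p k)) -> cvgL2 mu p u ->
  cvgL2 mu (fun k => pderiv i (p k)) (G i) ->
  cvgL2 mu (fun k => del i (p k)) (dl i u (G i)).
Proof.
move=> uG hp pu pG.
have hb k : ip mu (del i (p k) - dl i u (G i)) (del i (p k) - dl i u (G i)) <=
    8 * ip mu (p k - u) (p k - u) + 18 * ip mu (pderiv i (p k) - G i) (pderiv i (p k) - G i).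
  have hs := sobB (sob_pol (hp k)) uG.
  have -> : del i (p k) - dl i u (G i) = X i * (p k - u) - (pderiv i (p k) - G i).
    by rewrite /del /dl; apply/funext => x; rewrite !fctE; ring.
  have [h1 h2] := sob_X_le i hs; have h3 := sob_L2G i hs.
  apply: (le_trans (ip_sqrD_le h1 (L2N h3))).
  rewrite [X in _ + _ * X]/ip mulrNN -/(ip _ _ _).
  by move: h2; set A := ip _ _ _; set B := ip _ _ _; set C := ip _ _ _; lra.
have hc : 8 * ip mu (p k - u) (p k - u) + 18 * ip mu (pderiv i (p k) - G i) (pderiv i (p k) - G i)
   @[k --> \oo] --> (8 * 0 + 18 * 0 : R).
  by apply: cvgD; exact: cvgMr.
rewrite !mulr0 addr0 in hc.
apply: (squeeze_cvgr _ (@cvg_cst _ (0 : R) _ _ _) hc); apply: nearW => k.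
by rewrite ip_ge0 hb.
Qed.

Lemma ip_dl_dl u v G H i j : sob u G -> sob v H ->
  ip mu (dl i u (G i)) (dl j v (H j)) = (i == j)%:R * ip mu u v + ip mu (G j) (H i).
Proof.
move=> uG vH; have [p [hp pu pG]] := sob_approx uG; have [q [hq qv qH]] := sob_approx vH.
have hpL k := pol_L2 (hp k); have hqL k := pol_L2 (hq k).
have h1 : ip mu (del i (p k)) (del j (q k)) @[k --> \oo] --> ip mu (dl i u (G i)) (dl j v (H j)).
  apply: cvg_ip.
  - by move=> k; exact: pol_L2 (pol_del i (hp k)).
  - exact: sob_dl.
  - by move=> k; exact: pol_L2 (pol_del j (hq k)).
  - exact: sob_dl.
  - exact: cvg_dl.
  - exact: cvg_dl.
apply: (cvg_unique _ h1) => //.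
have -> : (fun k => ip mu (del i (p k)) (del j (q k))) = (fun k =>
   (i == j)%:R * ip mu (p k) (q k) + ip mu (pderiv j (p k)) (pderiv i (q k))).
  by apply/funext => k; exact: ip_del_del (hp k) (hq k).
apply: cvgD.
  apply: cvgMr; apply: cvg_ip => //; [exact: sob_L2 uG|exact: sob_L2 vH].
apply: cvg_ip => //; [|exact: sob_L2G uG| |exact: sob_L2G vH] => k.
- exact: pol_L2 (pol_D _ (hp k)).
- exact: pol_L2 (pol_D _ (hq k)).
Qed.

(** For polynomial v this is the definition of [sob]; only v has to be approximated. *)
Lemma ip_dl u v G H i : sob u G -> sob v H ->
  ip mu (dl i u (G i)) v = ip mu u (H i).
Proof.
move=> uG vH; have [q [hq qv qH]] := sob_approx vH.
have hqL k := pol_L2 (hq k); have hu := sob_L2 uG; have hv := sob_L2 vH.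
have h1 : ip mu (dl i u (G i)) (q k) @[k --> \oo] --> ip mu (dl i u (G i)) v.
  apply: (@cvg_ip _ _ _ _ (fun=> dl i u (G i))) => //.
  - by move=> k; exact: sob_dl.
  - exact: sob_dl.
  - by rewrite /cvgL2; under eq_fun do rewrite subrr /ip mul0r Ex0; exact: cvg_cst.
apply: (cvg_unique _ h1) => //.
have -> : (fun k => ip mu (dl i u (G i)) (q k)) = (fun k => ip mu u (pderiv i (q k))).
  apply/funext => k; have [_ hG uG'] := uG.
  rewrite /dl ipBl//; [|exact: (sob_X_le i uG).1].
  rewrite (uG' i _ _ (hq k)) /del ipBr//; last 2 first.
  - exact: pol_L2 (polX i (hq k)).
  - exact: pol_L2 (pol_D i (hq k)).
  rewrite (_ : ip mu (X i * u) (q k) = ip mu u (X i * q k)); last first.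
    by rewrite /ip (mulrC (X i) u) mulrA.
  by rewrite opprB addrC subrK.
apply: (@cvg_ip _ _ _ _ (fun=> u)) => //.
- by move=> k; exact: pol_L2 (pol_D i (hq k)).
- exact: sob_L2G vH.
- by rewrite /cvgL2; under eq_fun do rewrite subrr /ip mul0r Ex0; exact: cvg_cst.
Qed.

Lemma Ex_dl u G i : sob u G -> Ex mu (dl i u (G i)) = 0.
Proof.
move=> uG; rewrite -[dl _ _ _]mulr1 -/(ip _ _ _) (ip_dl i uG (sob_pol (pol1 0))).
by rewrite D_cst /ip mulr0 Ex0.
Qed.

Lemma poincare u G : sob u G ->
  ip mu u u - Ex mu u ^+ 2 <= \sum_i ip mu (G i) (G i).
Proof.
move=> uG; have [p [hp pu pG]] := sob_approx uG.
have hpL k := pol_L2 (hp k); have hu := sob_L2 uG.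
have hE : Ex mu (p k) @[k --> \oo] --> Ex mu u.
  rewrite -[u]mulr1 (_ : (fun k => _) = (fun k => Ex mu (p k * 1))); last first.
    by apply/funext => k; rewrite mulr1.
  apply: (@cvg_ip _ _ _ _ p (fun=> 1)) => //.
  - by move=> k; exact: L2_1.
  - exact: L2_1.
  - by rewrite /cvgL2; under eq_fun do rewrite subrr /ip mul0r Ex0; exact: cvg_cst.
have h1 : ip mu (p k) (p k) - Ex mu (p k) ^+ 2 @[k --> \oo] -->
    ip mu u u - Ex mu u ^+ 2.
  apply: (@cvgB R R^o); first exact: cvg_ip.
  by under eq_fun do rewrite expr2; rewrite expr2; exact: cvgM.
have h2 : \sum_i ip mu (pderiv i (p k)) (pderiv i (p k)) @[k --> \oo] -->
    \sum_i ip mu (G i) (G i).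
  apply: cvg_sumr => i; apply: cvg_ip => //; [|exact: sob_L2G uG| |exact: sob_L2G uG] => k;
    exact: pol_L2 (pol_D _ (hp k)).
apply: (ler_cvg_to h1 h2); apply: nearW => k; exact: poincare_pol (hp k).
Qed.

(** Each [dl] term has mean zero, so E[Z] = - E[v]. Expanding the square, the cross terms - 2
    E[u_i H_i] complete E[u_i^2] to the squares of u_i - H_i, at the price of the E[H_i^2]
    subtracted at the end. *)
Lemma variance_identity (u : 'I_n -> T -> R) (G : 'I_n -> 'I_n -> T -> R) v H :
  (forall i, sob (u i) (G i)) -> sob v H ->
  let Z := \sum_i dl i (u i) (G i i) - v in
  L2 mu Z /\
  ip mu Z Z - Ex mu Z ^+ 2 =
    \sum_i ip mu (u i - H i) (u i - H i) + \sum_i \sum_j ip mu (G i j) (G j i) +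
    (ip mu v v - Ex mu v ^+ 2 - \sum_i ip mu (H i) (H i)).
Proof.
move=> uG vH Z.
have hv := sob_L2 vH; have hu i := sob_L2 (uG i); have hH i := sob_L2G i vH.
have hd i := sob_dl i (uG i).
have hS : L2 mu (\sum_i dl i (u i) (G i i)) by apply: L2_sum.
have EZ : Ex mu Z = - Ex mu v.
  rewrite /Z ExB ?Ex_sum; [|by move=> i _; exact: L2_intg|exact: L2_intg|exact: L2_intg].
  by rewrite big1 ?sub0r// => i _; exact: Ex_dl (uG i).
split; first exact: L2B.
have e1 : ip mu (\sum_i dl i (u i) (G i i)) (\sum_i dl i (u i) (G i i)) =
    \sum_i ip mu (u i) (u i) + \sum_i \sum_j ip mu (G i j) (G j i).
  rewrite ip_suml// -big_split/=; apply: eq_bigr => i _.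
  rewrite ip_sumr// (eq_bigr (fun j => (i == j)%:R * ip mu (u i) (u j) + ip mu (G i j) (G j i))).
    rewrite big_split/= (bigD1 i)//= eqxx mul1r [X in _ + X + _]big1 ?addr0//.
    by move=> j; rewrite eq_sym => /negbTE ->; rewrite mul0r.
  by move=> j _; exact: ip_dl_dl (uG i) (uG j).
have e2 : ip mu (\sum_i dl i (u i) (G i i)) v = \sum_i ip mu (u i) (H i).
  by rewrite ip_suml//; apply: eq_bigr => i _; exact: ip_dl (uG i) vH.
have e3 : \sum_i ip mu (u i - H i) (u i - H i) =
    \sum_i ip mu (u i) (u i) - 2 * (\sum_i ip mu (u i) (H i)) + \sum_i ip mu (H i) (H i).
  rewrite mulr_sumr -sumrB -big_split/=; apply: eq_bigr => i _; exact: ip_sqrB.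
rewrite EZ /Z (ip_sqrB hS hv) e1 e2 e3 sqrrN.
move: (ip mu v v) (Ex mu v) (\sum_i ip mu (u i) (u i)) (\sum_i ip mu (u i) (H i)).
move: (\sum_i ip mu (H i) (H i)) (\sum_i \sum_j ip mu (G i j) (G j i)) => {e1 e2 e3 EZ} a b c d e f.
by ring.
Qed.

End sob.

(** * Test functions *)

Section smooth.
Context {R : realType} {n : nat}.
Local Notation T := 'rV[R]_n.
Local Notation e_ := (delta_mx 0).
Implicit Types (phi psi : T -> R) (i j : 'I_n).

Definition pd_closed (K : (T -> R) -> Prop) := forall phi, K phi ->
  [/\ continuous phi, forall i x, derivable phi x (e_ i) & forall i, K (pderiv i phi)].

(** A coinduction principle: smoothness is proved by exhibiting a class stable under partial
    derivatives. It replaces formulas for iterated derivatives. *)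
Lemma smooth_class K phi : pd_closed K -> K phi -> smooth phi.
Proof.
move=> hK Kphi s; suff : K (foldr (@pderiv R n) phi s) by move=> /hK[].
by elim: s => //= i s IH; have [_ _] := hK _ IH; exact.
Qed.

Lemma smooth_pderiv i phi : smooth phi -> smooth (pderiv i phi).
Proof. by move=> sphi s; have := sphi (rcons s i); rewrite foldr_rcons. Qed.

Lemma pd_closed_smooth : pd_closed (@smooth R n).
Proof.
move=> phi sphi; have [cphi dphi] := sphi [::].
split; [exact: cphi|exact: dphi|by move=> i; exact: smooth_pderiv].
Qed.

Lemma smooth_continuous phi : smooth phi -> continuous phi.
Proof. by move=> /pd_closed_smooth[]. Qed.

Lemma smooth_derivable phi i x : smooth phi -> derivable phi x (e_ i).
Proof. by move=> /pd_closed_smooth[]. Qed.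

Lemma pderivM phi psi i : smooth phi -> smooth psi ->
  pderiv i (phi * psi) = phi * pderiv i psi + psi * pderiv i phi.
Proof.
move=> hp hq; apply/funext => x; rewrite /pderiv deriveM//; [exact: (@smooth_derivable _ i x hp)|exact: (@smooth_derivable _ i x hq)].
Qed.

(** By Leibniz' rule a derivative of a product is a sum of two products, so this class is stable
    under derivation. *)
Inductive sum_of_products : (T -> R) -> Prop :=
| SPmul phi psi : smooth phi -> smooth psi -> sum_of_products (phi * psi)
| SPadd phi psi : sum_of_products phi -> sum_of_products psi ->
    sum_of_products (phi + psi).

Lemma sum_of_products_pd : pd_closed sum_of_products.
Proof.
move=> phi; elim=> {phi} [phi psi hp hq|phi psi _ [c1 d1 p1] _ [c2 d2 p2]]; split.
- by move=> x; exact: (cvgM (@smooth_continuous _ hp x) (@smooth_continuous _ hq x)).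
- by move=> i x; apply: derivableM; [exact: (@smooth_derivable _ i x hp)|exact: (@smooth_derivable _ i x hq)].
- move=> i; rewrite pderivM//.
  exact (SPadd (SPmul hp (smooth_pderiv i hq)) (SPmul hq (smooth_pderiv i hp))).
- by move=> x; exact: (@cvgD R R^o _ _ _ _ _ _ _ (c1 x) (c2 x)).
- by move=> i x; apply: derivableD; [exact: d1|exact: d2].
- move=> i; rewrite (_ : pderiv i (phi + psi) = pderiv i phi + pderiv i psi).
    exact: SPadd.
  by apply/funext => x; rewrite /pderiv deriveD.
Qed.

Lemma smoothM phi psi : smooth phi -> smooth psi -> smooth (phi * psi).
Proof. by move=> hp hq; apply: (smooth_class sum_of_products_pd); exact: SPmul. Qed.

Lemma pderiv_cst i (c : R) : pderiv i (fun _ : T => c) = 0.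
Proof. by apply/funext => x; exact: derive_cst. Qed.

Lemma smooth_cst (c : R) : smooth (fun _ : T => c).
Proof.
apply: (@smooth_class (fun phi => exists c, phi = fun=> c)); last by exists c.
move=> _ [a ->]; split=> [x|i x|i]; first exact: (@cst_continuous T R a x).
- exact: derivable_cst.
- by exists 0; exact: pderiv_cst.
Qed.

Lemma smoothD phi psi : smooth phi -> smooth psi -> smooth (phi + psi).
Proof.
move=> hp hq; apply: (smooth_class sum_of_products_pd).
rewrite -[phi]mulr1 -[psi]mulr1.
exact (SPadd (SPmul hp (smooth_cst 1)) (SPmul hq (smooth_cst 1))).
Qed.

Lemma smoothZ (c : R) phi : smooth phi -> smooth (c *: phi).
Proof. by move=> hp; exact: smoothM (smooth_cst c) hp. Qed.

Lemma smooth_prod I (r : seq I) (P : pred I) (F : I -> T -> R) :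
  (forall a, P a -> smooth (F a)) -> smooth (\prod_(a <- r | P a) F a).
Proof.
move=> h; apply: (big_ind (@smooth R n)); [exact (smooth_cst 1)| |exact h].
by move=> f g hf hg; exact: smoothM.
Qed.

(* h has derivatives of all orders: it lies in a class K stable under derivation. *)
Definition smooth1 (h : R -> R) := exists K : (R -> R) -> Prop, K h /\
  forall g, K g -> exists2 g', K g' & forall t : R, is_derive t (1 : R) g (g' t).

Lemma is_derive_coord (h : R -> R) (a : R) i (x : T) :
  is_derive (x 0 i) (1 : R) h a -> is_derive x (e_ i) (fun y : T => h (y 0 i)) a.
Proof.
move=> [dh ha].
have e : (fun s : R => s^-1 *: (((fun y : T => h (y 0 i)) \o shift x) (s *: e_ i) - h (x 0 i))) =
  (fun s => s^-1 *: ((h \o shift (x 0 i)) (s *: (1 : R)) - h (x 0 i))).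
  by apply/funext => s /=; rewrite !mxE !eqxx.
by apply: DeriveDef; rewrite /derivable/derive ?e.
Qed.

Lemma is_derive_indep (phi : T -> R) i (x : T) :
  (forall s : R, phi (s *: e_ i + x) = phi x) -> is_derive x (e_ i) phi 0.
Proof.
move=> h; have e : (fun s : R => s^-1 *: ((phi \o shift x) (s *: e_ i) - phi x)) = (fun=> 0).
  by apply/funext => s /=; rewrite h subrr scaler0.
apply: DeriveDef; rewrite /derivable/derive e; first exact: is_cvg_cst.
exact: lim_cst.
Qed.

Lemma coord_continuous_rV i : continuous (fun x : T => x 0 i).
Proof. exact: coord_continuous. Qed.

Lemma smooth_coord_comp (h : R -> R) i : smooth1 h -> smooth (fun x : T => h (x 0 i)).
Proof.
move=> [K [Kh hK]].
(* The zero function is included because the derivatives along the other axes vanish. *)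
apply: (@smooth_class (fun phi => phi = 0 \/ exists2 g, K g & phi = (fun x : T => g (x 0 i))));
  last by right; exists h.
move=> _ [->|[g Kg ->]].
  split=> [x|j x|j]; [exact: (@cst_continuous T R 0 x)|exact: derivable_cst|by left; exact: pderiv_cst].
have [g' Kg' dg] := hK _ Kg.
split=> [x|j x|j].
- have cg : {for x 0 i, continuous g}.
    by apply/differentiable_continuous/derivable1_diffP; have [] := dg (x 0 i).
  exact: (continuous_comp (@coord_continuous_rV i x) cg).
- have [->|ji] := eqVneq j i; first by have [] := is_derive_coord (dg (x 0 i)).
  have [] // := @is_derive_indep (fun x : T => g (x 0 i)) j x.
  by move=> s; rewrite !mxE eqxx/= eq_sym (negbTE ji) mulr0 add0r.
- have [->|ji] := eqVneq j i.
    right; exists g' => //; apply/funext => x.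
    by have [] := is_derive_coord (dg (x 0 i)).
  left; apply/funext => x.
  have [] // := @is_derive_indep (fun x : T => g (x 0 i)) j x.
  by move=> s; rewrite !mxE eqxx/= eq_sym (negbTE ji) mulr0 add0r.
Qed.

Lemma smooth1_id : smooth1 id.
Proof.
exists (fun h => exists p : {poly R}, h = horner p); split.
  by exists 'X; apply/funext => t; rewrite hornerX.
move=> _ [p ->]; exists (horner p^`()); first by exists p^`().
by move=> t; exact: is_derive_poly.
Qed.

Lemma smooth_coord i : smooth (fun x : T => x 0 i).
Proof. exact: (smooth_coord_comp i smooth1_id). Qed.

Lemma pderiv_coord i j : pderiv j (fun x : T => x 0 i) = (fun=> (i == j)%:R).
Proof.
apply/funext => x; have [->|ij] := eqVneq i j.
  by have [] := @is_derive_coord id 1 j x (is_derive_id _ _).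
have [] // := @is_derive_indep (fun x : T => x 0 i) j x.
by move=> s; rewrite !mxE eqxx/= (negbTE ij) mulr0 add0r.
Qed.

End smooth.

(** * Smooth functions flat at the origin *)

Section flat.
Context {R : realType}.
Implicit Types (P : {poly R}) (t y : R).

(** The classical smooth function e^(-1/y) vanishing for y <= 0, with a polynomial factor in 1/y so
    that the family is stable under derivation. *)
Definition flat P y : R := if 0 < y then P.[y^-1] * expR (- y^-1) else 0.

(** Coefficientwise, from s^i <= i! e^s for s >= 0. *)
Lemma poly_exp_bound P : exists2 C : R, 0 <= C &
  forall s, 0 <= s -> `|P.[s]| * expR (- s) <= C.
Proof.
exists (\sum_(i < size P) `|P`_i| * i`!%:R).
  by apply: sumr_ge0 => i _; rewrite mulr_ge0.
move=> s s0; rewrite expRN ler_pdivrMr ?expR_gt0// horner_coef.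
rewrite (le_trans (ler_norm_sum _ _ _))// mulr_suml; apply: ler_sum => i _.
rewrite normrM -mulrA ler_wpM2l// normrX ger0_norm//.
case: (nat_of_ord i) => [|k].
  by rewrite expr0 fact0 mul1r -[leLHS]expR0 ler_expR.
have := expR_ge1Dxn k s0; have f0 : (0 : R) < k.+1`!%:R by rewrite ltr0n fact_gt0.
by move=> h; rewrite mulrC -ler_pdivrMr// (le_trans _ h)// lerDr.
Qed.

Lemma flat_bound P : exists2 C : R, 0 <= C & forall y, `|flat P y| <= C.
Proof.
have [C C0 h] := poly_exp_bound P; exists C => // y; rewrite /flat.
case: ifP => [y0|_]; last by rewrite normr0.
by rewrite normrM (ger0_norm (expR_ge0 _)) h// invr_ge0 ltW.
Qed.

(** [poly_exp_bound] for P X^2. The quadratic bound yields continuity and derivative 0 at the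
    origin. *)
Lemma flat_le_sqr P : exists2 C : R, 0 <= C & forall y, `|flat P y| <= C * y ^+ 2.
Proof.
have [C C0 h] := poly_exp_bound (P * 'X^2); exists C => // y; rewrite /flat.
case: ifP => [y0|_]; last by rewrite normr0 mulr_ge0// sqr_ge0.
have y1 : 0 <= y^-1 by rewrite invr_ge0 ltW.
have := h _ y1; rewrite hornerM hornerXn normrM (ger0_norm (exprn_ge0 2 y1)) => h1.
rewrite normrM (ger0_norm (expR_ge0 _)) -ler_pdivrMr ?exprn_gt0//.
by apply: le_trans h1; rewrite exprVn mulrAC.
Qed.

(** For y > 0 the derivative of P(1/y) e^(-1/y) is y^(-2) (P - P')(1/y) e^(-1/y). *)
Definition dflat P : {poly R} := 'X^2 * (P - P^`()).

Lemma is_derive_flat P y : is_derive y (1 : R) (flat P) (flat (dflat P) y).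
Proof.
have [y0|y0|->] := ltgtP y 0.
- have -> : flat (dflat P) y = 0 by rewrite /flat ltNge ltW.
  apply: (near_eq_is_derive _ (is_derive_cst (0 : R) y (1 : R))).
  by near=> t; rewrite /flat ltNge ltW//; near: t; exact: lt_nbhsl.
- pose g : R -> R := (horner P \o GRing.inv) * (expR \o (- GRing.inv)).
  have yn0 : y != 0 by rewrite gt_eqF.
  have dinv : is_derive y (1 : R) (@GRing.inv R) (- y ^- 2).
    apply: (is_derive_eq (@is_deriveV _ id y 1 1 yn0 (is_derive_id y (1 : R)))).
    by rewrite /GRing.scale/= mulr1.
  have d1 := @is_derive1_comp _ (horner P) (@GRing.inv R) y _ _ (is_derive_poly P _) dinv.
  have d2 := @is_derive1_comp _ expR (- @GRing.inv R) y _ _ (is_derive_expR _) (is_deriveN dinv).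
  have dg := is_deriveM d1 d2.
  have e : flat (dflat P) y = (horner P \o GRing.inv) y *: (expR (- y^-1) * - - y ^- 2) +
      (expR \o - GRing.inv) y *: (P^`().[y^-1] * - y ^- 2).
    rewrite /flat y0 /dflat hornerM hornerXn hornerD hornerN /GRing.scale/= -exprVn.
    by rewrite !fctE; ring.
  rewrite e; apply: (near_eq_is_derive _ dg).
  by near=> t; rewrite /flat /g !fctE ifT//; near: t; exact: lt_nbhsr.
- have [C C0 hC] := flat_le_sqr P.
  have F0 : flat P 0 = 0 by rewrite /flat ltxx.
  have -> : flat (dflat P) 0 = 0 by rewrite /flat ltxx.
  have h : s^-1 *: ((flat P \o shift 0) (s *: (1 : R)) - flat P 0) @[s --> (0 : R)^'] --> (0 : R).
    apply/norm_cvg0P.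
    have hc : C * `|s| @[s --> (0 : R)^'] --> (0 : R).
      rewrite -[X in _ --> X](mulr0 C); apply: cvgMr.
      apply/cvgrPdist_lt => e e0; near=> s.
      by rewrite sub0r normrN normr_id; near: s; exact: dnbhs0_lt.
    apply: (squeeze_cvgr _ (@cvg_cst _ (0 : R) _ _ _) hc); near=> s.
    have s0 : s != 0 by near: s; exact: nbhs_dnbhs_neq.
    rewrite normr_ge0/= F0 subr0 addr0 [s *: 1]mulr1 normrM normfV.
    rewrite ler_pdivrMl ?normr_gt0// (le_trans (hC _))//.
    by rewrite -(real_normK (num_real s)) expr2 mulrCA.
  apply: DeriveDef; first by apply/cvg_ex; exists 0.
  by rewrite /derive; apply/cvg_lim.
Unshelve. all: by end_near. Qed.

Lemma smooth1_flat P (a b : R) : smooth1 (fun t => flat P (a + b * t)).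
Proof.
exists (fun h => exists P, h = (fun t => flat P (a + b * t))); split; first by exists P.
move=> _ {P} [P ->]; exists (fun t => flat (b *: dflat P) (a + b * t)).
  by exists (b *: dflat P).
move=> t; have dl : is_derive t (1 : R) (fun t => a + b * t) b.
  apply: (is_derive_eq (is_deriveD (is_derive_cst a t (1 : R)) (is_deriveZ b (is_derive_id t (1 : R))))).
  by rewrite add0r /GRing.scale/= mulr1.
apply: (is_derive_eq (@is_derive1_comp _ (flat P) (fun t => a + b * t) t _ _ (is_derive_flat P _) dl)).
by rewrite /flat; case: ifP => _; rewrite ?mul0r// hornerZ; ring.
Qed.

Lemma smooth1_gauss (c : R) : smooth1 (fun t => c * expR (- (t ^+ 2 / 2))).
Proof.
exists (fun h => exists P : {poly R}, h = (fun t => P.[t] * expR (- (t ^+ 2 / 2)))); split.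
  by exists c%:P; apply/funext => t; rewrite hornerC.
move=> _ [P ->]; exists (fun t => (P^`() - P * 'X).[t] * expR (- (t ^+ 2 / 2))).
  by exists (P^`() - P * 'X).
move=> t; have dq : is_derive t (1 : R) (fun t : R => - (t ^+ 2 / 2)) (- t).
  have e : horner (- 2^-1 *: 'X^2) = (fun t : R => - (t ^+ 2 / 2)).
    by apply/funext => s; rewrite hornerZ hornerXn mulNr mulrC.
  have := is_derive_poly (- 2^-1 *: 'X^2) t; rewrite e => d; apply: (is_derive_eq d).
  by rewrite derivZ derivXn hornerZ hornerMn hornerXn expr1; field.
apply: (is_derive_eq (is_deriveM (is_derive_poly P t) (@is_derive1_comp _ expR (fun t : R => - (t ^+ 2 / 2)) t _ _ (is_derive_expR _) dq))).
rewrite /GRing.scale/= hornerD hornerN hornerMX; ring.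
Qed.

End flat.

(** * Boxes, compactness and measurability in R^n *)

Section rV_topology.
Context {R : realType} {n : nat}.
Local Notation T := 'rV[R]_n.

Lemma cvg_rV (u_ : nat -> T) (u : T) :
  (forall i, u_ k 0 i @[k --> \oo] --> u 0 i) -> u_ k @[k --> \oo] --> u.
Proof.
move=> h A [P hP PA].
have : \forall k \near \oo, forall i : 'I_n, P 0 i (u_ k 0 i).
  by apply: filter_forall => i; exact: (h i _ (hP 0 i)).
by apply: filterS => k Pk; apply: PA => a i; rewrite (ord1 a).
Qed.

Definition box (k : nat) : set T := [set x | forall i, `|x 0 i| <= k%:R].

Lemma compact_box k : compact (box k).
Proof.
rewrite (_ : box k = [set v : T | forall i, `[- k%:R, k%:R]%classic (v ord0 i)]).
  by apply: (@rV_compact R n (fun=> `[- k%:R, k%:R]%classic)) => i; exact: segment_compact.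
apply/seteqP; split=> x h i; have := h i; first by rewrite ler_norml /= in_itv.
by rewrite /= in_itv /= ler_norml.
Qed.

Lemma closed_box k : closed (box k).
Proof. apply: compact_closed; [exact: norm_hausdorff|exact: compact_box]. Qed.

Lemma measurable_box k : measurable (box k).
Proof.
rewrite (_ : box k = \bigcap_(i in [set: 'I_n])
    ((fun x : T => x 0 i) @^-1` `[- k%:R, k%:R])); last first.
  apply/seteqP; split=> [x h i _|x h i]; first by have := h i; rewrite ler_norml /= in_itv.
  by have := h i Logic.I; rewrite /= in_itv /= ler_norml.
apply: fin_bigcap_measurable => // i _; rewrite -[X in measurable X]setTI.
by apply: (measurable_coord i).
Qed.

Lemma compact_sub_box (K : set T) : compact K -> exists k, K `<=` box k.
Proof.
move=> /compact_bounded[M [_ hM]].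
exists (Num.truncn `|M + 1|).+1 => x Kx i.
have := hM (M + 1); rewrite ltrDl ltr01 => /(_ isT x Kx) h.
apply: (@le_trans _ _ `|x|).
  rewrite -[ `|x| ]/(mx_norm x) mx_normrE; apply: (@le_bigmax _ _ _ 0 (fun ij => `|x ij.1 ij.2|) (0, i)).
by apply: (le_trans h); rewrite (le_trans (ler_norm _))// ltW// truncnS_gt.
Qed.

Lemma continuous_box_bounded (phi : T -> R) k : continuous phi ->
  exists2 C : R, 0 <= C & forall x, box k x -> `|phi x| <= C.
Proof.
move=> cphi; have : compact (phi @` box k).
  by apply: continuous_compact; [exact: continuous_subspaceT|exact: compact_box].
move=> /compact_bounded[M [_ hM]]; exists `|M + 1| => // x bx.
have := hM (M + 1); rewrite ltrDl ltr01 => /(_ isT) h.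
by rewrite (le_trans _ (ler_norm _))//; apply: h; exists x.
Qed.

Lemma measurable_floor_rV k : forall z : 'rV[int]_n,
  measurable [set x : T | forall i, Num.floor (k.+1%:R * x 0 i) = z 0 i].
Proof.
move=> z; rewrite (_ : [set x | _] = \bigcap_(i in [set: 'I_n])
    ((fun x : T => x 0 i) @^-1` ((fun t : R => Num.floor (k.+1%:R * t)) @^-1` [set z 0 i]))); last first.
  by apply/seteqP; split=> [x h i _|x h i]; [exact: h|exact: (h i Logic.I)].
apply: fin_bigcap_measurable => // i _; rewrite -[X in measurable X]setTI.
apply: (measurable_coord i) => //.
rewrite -[X in measurable X]setTI.
rewrite (_ : _ @^-1` _ = [set t : R | k.+1%:R^-1 * (z 0 i)%:~R <= t < k.+1%:R^-1 * (z 0 i + 1)%:~R]).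
  rewrite setTI (_ : [set t | _] = `[k.+1%:R^-1 * (z 0 i)%:~R, k.+1%:R^-1 * (z 0 i + 1)%:~R[%classic) //.
apply/seteqP; split=> t /=.
  move=> <-; rewrite ler_pdivrMl// ltr_pdivlMl//.
  by rewrite floor_le floorD1_gt.
rewrite ler_pdivrMl// ltr_pdivlMl// => h.
by apply/eqP; rewrite floor_eq.
Qed.

(** The sigma-algebra is generated by the coordinates, not by the open sets. Hence phi is written as
    the limit of its values at x rounded down to the grid of mesh 1 / (k + 1); these functions take
    countably many values, on measurable cells. *)
Lemma continuous_measurable_rV (phi : T -> R) : continuous phi -> measurable_fun setT phi.
Proof.
move=> cphi.
pose z k (x : T) : 'rV[int]_n := \row_i Num.floor (k.+1%:R * x 0 i).
pose q k (y : 'rV[int]_n) : T := \row_i (k.+1%:R^-1 * (y 0 i)%:~R).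
apply: (@measurable_fun_cvg _ _ _ setT (fun k x => phi (q k (z k x)))); last first.
  move=> x _; apply: (@cvg_comp _ _ _ (fun k => q k (z k x)) phi _ (nbhs x)); last exact: cphi.
  apply: cvg_rV => i; apply/cvgrPdist_le => e e0; near=> k.
  rewrite /q /z !mxE.
  have h1 := floor_le (k.+1%:R * x 0 i); have h2 := floorD1_gt (k.+1%:R * x 0 i).
  have k0 : (0 : R) < k.+1%:R by [].
  have e1 : e^-1 <= k.+1%:R.
    by near: k; exists (Num.truncn e^-1).+1 => // m /= hm; apply: ltW;
      rewrite (lt_le_trans (truncnS_gt _))// ler_nat (leq_trans hm).
  have e2 : 1 <= k.+1%:R * e by rewrite -ler_pdivrMr// div1r.
  rewrite -(ler_pM2l k0) -{1}(ger0_norm (ltW k0)) -normrM mulrBr mulrA divff ?gt_eqF// mul1r.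
  rewrite ger0_norm; last by rewrite subr_ge0.
  by apply: le_trans e2; move: h2; rewrite intrD1; lra.
move=> k _ Y mY; rewrite setTI.
rewrite (_ : _ @^-1` Y = \bigcup_(y in [set y | Y (phi (q k y))])
    [set x : T | forall i, Num.floor (k.+1%:R * x 0 i) = y 0 i]); last first.
  apply/seteqP; split=> [x Yx|x [y Yy h]] /=.
    by exists (z k x) => // i; rewrite /z mxE.
  by rewrite (_ : z k x = y)//; apply/rowP => i; rewrite mxE h.
rewrite bigcup_mkcond; apply: countable_bigcupT_measurable; first exact: countableP.
by move=> y; case: ifPn => _ //; exact: measurable_floor_rV.
Unshelve. all: by end_near. Qed.

(** The support of phi lies in a box, on which phi is bounded. *)
Lemma integrable_loc_mul (g phi : T -> R) : locally_integrable_rV g ->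
  continuous phi -> compact (closure [set x | phi x != 0]) ->
  (lebesgue_rV n).-integrable setT (fun x => (g x * phi x)%:E).
Proof.
move=> [mg ig] cphi kphi.
have [k hk] := compact_sub_box kphi.
have [C C0 hC] := continuous_box_bounded k cphi.
have mphi := continuous_measurable_rV cphi.
have phi0 x : ~ box k x -> phi x = 0.
  move=> nb; apply/eqP; apply: contra_notT nb => h.
  by apply: hk; apply: subset_closure.
apply/integrableP; split; first by apply/measurable_EFinP; exact: measurable_funM.
have i1 : (C%:E * \int[lebesgue_rV n]_(x in box k) `|g x|%:E < +oo)%E.
  by apply: lte_mul_pinfty; rewrite ?lee_fin//; exact: (ig _ (@compact_box k)).
apply: le_lt_trans i1.
rewrite -ge0_integralZl//; last 2 first.
- exact: measurable_box.
- apply: measurable_funTS; apply/measurable_EFinP; exact: measurableT_comp.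
rewrite [leRHS]integral_mkcond; apply: ge0_le_integral => //.
- by apply: measurableT_comp => //; apply/measurable_EFinP; exact: measurable_funM.
- apply/(measurable_restrictT _ _).1; first exact: measurable_box.
  apply: measurable_funTS; apply: measurable_funeM; apply/measurable_EFinP; exact: measurableT_comp.
- move=> x _; rewrite patchE; case: ifPn => [/set_mem bx|/negP nbx].
    by rewrite -EFinM lee_fin normrM mulrC ler_wpM2r// hC.
  rewrite phi0; first by rewrite mulr0 abse0.
  by move=> bx; apply: nbx; exact: mem_set.
Qed.

End rV_topology.

(** * Cutoffs on the line *)

Section cut1.
Context {R : realType}.

Lemma flat1E (y : R) : flat 1 y = if 0 < y then expR (- y^-1) else 0.
Proof. by rewrite /flat hornerC mul1r. Qed.

Lemma flat1_ge0 (y : R) : 0 <= flat 1 y.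
Proof. by rewrite flat1E; case: ifP => // _; exact: expR_ge0. Qed.

Lemma flat1_le1 (y : R) : flat 1 y <= 1.
Proof.
rewrite flat1E; case: ifP => // y0.
by rewrite -expR0 ler_expR oppr_le0 invr_ge0 ltW.
Qed.

Lemma is_derive_flat_lin (P : {poly R}) (a b t : R) :
  is_derive t (1 : R) (fun t => flat P (a + b * t)) (b * flat (dflat P) (a + b * t)).
Proof.
have dl : is_derive t (1 : R) (fun t => a + b * t) b.
  apply: (is_derive_eq (is_deriveD (is_derive_cst a t (1 : R)) (is_deriveZ b (is_derive_id t (1 : R))))).
  by rewrite add0r /GRing.scale/= mulr1.
apply: (is_derive_eq (@is_derive1_comp _ (flat P) (fun t => a + b * t) t _ _ (is_derive_flat P _) dl)).
by rewrite mulrC.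
Qed.

(* The factor expR 2 normalizes the limit of cut k to 1. *)
Definition cut (k : nat) (t : R) : R :=
  expR 2 * (flat 1 (1 + (- k.+1%:R^-1) * t) * flat 1 (1 + k.+1%:R^-1 * t)).

Definition dcut (k : nat) (t : R) : R := k.+1%:R^-1 *
  (expR 2 * (flat 1 (1 + (- k.+1%:R^-1) * t) * flat (dflat 1) (1 + k.+1%:R^-1 * t) -
    flat 1 (1 + k.+1%:R^-1 * t) * flat (dflat 1) (1 + (- k.+1%:R^-1) * t))).

Lemma is_derive_cut k (t : R) : is_derive t (1 : R) (cut k) (dcut k t).
Proof.
have d1 := is_derive_flat_lin 1 1 (- k.+1%:R^-1) t.
have d2 := is_derive_flat_lin 1 1 (k.+1%:R^-1) t.
apply: (is_derive_eq (is_deriveM (is_derive_cst (expR 2 : R) t (1 : R)) (is_deriveM d1 d2))).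
by rewrite /dcut /GRing.scale/=; ring.
Qed.

Lemma cut_ge0 k t : 0 <= cut k t.
Proof. by rewrite /cut !mulr_ge0// ?flat1_ge0// expR_ge0. Qed.

Lemma cut_le k t : cut k t <= expR 2.
Proof.
rewrite /cut ler_piMr ?expR_ge0//.
by rewrite mulr_ile1 ?flat1_ge0 ?flat1_le1.
Qed.

Lemma cut_eq0 k t : k.+1%:R < `|t| -> cut k t = 0.
Proof.
move=> kt; have k0 : (0 : R) < k.+1%:R by [].
have [t0|t0] := ger0P t; rewrite /cut.
- have -> : flat 1 (1 + (- k.+1%:R^-1) * t) = 0; last by rewrite mul0r mulr0.
  rewrite flat1E ifF//; apply/negbTE; rewrite -leNgt mulNr subr_le0.
  by rewrite ler_pdivlMl// mulr1 ltW//; rewrite ger0_norm in kt.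
- have -> : flat 1 (1 + k.+1%:R^-1 * t) = 0; last by rewrite !mulr0.
  rewrite flat1E ifF//; apply/negbTE; rewrite -leNgt addrC -lerBrDr sub0r.
  by rewrite ler_pdivrMl// mulrN1 lerNr ltW//; rewrite ltr0_norm in kt.
Qed.

(** The factor 1 / (k + 1), due to the stretching of the cutoff, makes the terms with a derivative
    of the cutoff vanish in the limit. *)
Lemma dcut_bound : exists2 C : R, 0 <= C & forall k t, `|dcut k t| <= k.+1%:R^-1 * C.
Proof.
have [C C0 hC] := @flat_bound R (dflat 1).
exists (expR 2 * (C + C)) => [|k t]; first by rewrite mulr_ge0 ?expR_ge0 ?addr_ge0.
rewrite /dcut normrM ger0_norm ?invr_ge0// ler_wpM2l ?invr_ge0//.
rewrite normrM ger0_norm ?expR_ge0// ler_wpM2l ?expR_ge0//.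
rewrite (le_trans (ler_normB _ _))// lerD// normrM ger0_norm ?flat1_ge0//.
  by rewrite -[C]mul1r ler_pM ?flat1_ge0 ?flat1_le1.
by rewrite -[C]mul1r ler_pM ?flat1_ge0 ?flat1_le1.
Qed.

Lemma cvg_cut (t : R) : cut k t @[k --> \oo] --> (1 : R).
Proof.
have hl (s : R) : flat 1 (1 + (s * k.+1%:R^-1) * t) @[k --> \oo] --> flat 1 (1 : R).
  have cf : {for (1 : R), continuous (flat 1)}.
    apply/differentiable_continuous/derivable1_diffP.
    by have [] := is_derive_flat 1 (1 : R).
  apply: (@cvg_comp _ _ _ (fun k => 1 + (s * k.+1%:R^-1) * t) (flat 1) _ (nbhs (1 : R))); last exact: cf.
  have -> : (fun k => 1 + s * k.+1%:R^-1 * t) = (fun k => 1 + (s * t) * harmonic k).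
    by apply/funext => k; rewrite /harmonic/= mulrAC.
  have h0 : (s * t) * harmonic k @[k --> \oo] --> (s * t) * (0 : R).
    by apply: cvgMr; exact: cvg_harmonic.
  have := @cvgD R R^o nat \oo _ (fun=> 1) _ _ _ (cvg_cst (1 : R)) h0.
  by move=> h; rewrite mulr0 addr0 in h; apply: h.
have -> : cut^~ t = (fun k => expR 2 * (flat 1 (1 + (-1 * k.+1%:R^-1) * t) *
      flat 1 (1 + (1 * k.+1%:R^-1) * t))).
  by apply/funext => k; rewrite /cut mulN1r mul1r.
have e : expR 2 * (flat 1 1 * flat 1 1) = 1 :> R.
  by rewrite flat1E ltr01 invr1 -!expRD -[RHS]expR0; congr expR; ring.
have h : expR 2 * (flat 1 (1 + (-1 * k.+1%:R^-1) * t) * flat 1 (1 + (1 * k.+1%:R^-1) * t))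
    @[k --> \oo] --> expR 2 * (flat 1 1 * flat 1 1).
  by apply: cvgMr; apply: cvgM; [exact: (hl (-1))|exact: (hl 1)].
by rewrite e in h.
Qed.

(** The argument is (k + 1)(t - b): smooth functions with values in [0, 1] approximate the indicator
    of a half-line. *)
Lemma cvg_flat_indic (b t : R) :
  flat 1 (- (k.+1%:R * b) + k.+1%:R * t) @[k --> \oo] --> ((b < t)%R%:R : R).
Proof.
have e k : - (k.+1%:R * b) + k.+1%:R * t = k.+1%:R * (t - b) by rewrite mulrBr addrC.
under eq_fun do rewrite e flat1E.
have [bt|tb] := ltP b t.
- have h0 : - (t - b)^-1 * harmonic k @[k --> \oo] --> - (t - b)^-1 * (0 : R).
    by apply: cvgMr; exact: cvg_harmonic.
  have h := @cvg_comp _ _ _ (fun k => - (t - b)^-1 * harmonic k) expR _ _ _ h0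
    (@continuous_expR R _).
  rewrite mulr0 expR0 in h.
  rewrite (_ : (fun k => _) = expR \o (fun k => - (t - b)^-1 * harmonic k)) //.
  apply/funext => k /=; rewrite pmulr_rgt0// subr_gt0 bt.
  by rewrite /harmonic/= invfM mulrC mulNr.
- rewrite (_ : (fun k => _) = (fun=> 0)); first exact: cvg_cst.
  by apply/funext => k; rewrite pmulr_rgt0// subr_gt0 ltNge tb.
Qed.

End cut1.

(** * Cutoffs and the Gaussian density as smooth functions on R^n *)

Section cut_rV.
Context {R : realType} {n : nat}.
Local Notation T := 'rV[R]_n.
Implicit Types (phi : T -> R) (i j : 'I_n) (k : nat).

Lemma smooth_prod_coord (h : 'I_n -> R -> R) (P : pred 'I_n) :
  (forall j, smooth (fun x : T => h j (x 0 j))) ->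
  smooth (fun x : T => \prod_(j | P j) h j (x 0 j)).
Proof.
move=> hs; have := @smooth_prod R n _ (index_enum 'I_n) P (fun j (x : T) => h j (x 0 j)) (fun j _ => hs j).
by rewrite fct_prodE.
Qed.

Lemma pderiv_prod_coord (h : 'I_n -> R -> R) (dh : R -> R) i :
  (forall j, smooth (fun x : T => h j (x 0 j))) ->
  (forall t, is_derive t (1 : R) (h i) (dh t)) ->
  pderiv i (fun x : T => \prod_j h j (x 0 j)) =
  (fun x => (\prod_(j | j != i) h j (x 0 j)) * dh (x 0 i)).
Proof.
move=> hs dhi.
have -> : (fun x : T => \prod_j h j (x 0 j)) =
    (fun x : T => \prod_(j | j != i) h j (x 0 j)) * (fun x : T => h i (x 0 i)).
  by apply/funext => x; rewrite fctE (bigD1 i)//= mulrC.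
rewrite pderivM//; last exact: smooth_prod_coord.
have -> : pderiv i (fun x : T => \prod_(j | j != i) h j (x 0 j)) = 0.
  apply/funext => x.
  have [] // := @is_derive_indep _ _ (fun x : T => \prod_(j | j != i) h j (x 0 j)) i x.
  move=> s; apply: eq_bigr => j ji; rewrite !mxE eqxx/= (negbTE ji) mulr0 add0r//.
rewrite mulr0 addr0; apply/funext => x; rewrite fctE; congr (_ * _).
by have [] := is_derive_coord (dhi (x 0 i)).
Qed.

Definition chi k (x : T) : R := \prod_i cut k (x 0 i).

Lemma smooth_cut k i : smooth (fun x : T => cut k (x 0 i)).
Proof.
apply: (@smoothZ R n (expR 2) (_ * _)); apply: smoothM.
- exact: (smooth_coord_comp i (smooth1_flat 1 1 (- k.+1%:R^-1))).
- exact: (smooth_coord_comp i (smooth1_flat 1 1 (k.+1%:R^-1))).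
Qed.

Lemma smooth_chi k : smooth (chi k).
Proof. by apply: (@smooth_prod_coord (fun=> cut k) xpredT) => j; exact: smooth_cut. Qed.

Lemma chi_bound : exists2 C : R, 0 <= C & forall k x, `|chi k x| <= C.
Proof.
exists (\prod_(i < n) expR 2) => [|k x]; first by apply: prodr_ge0 => i _; exact: expR_ge0.
rewrite normr_prod; apply: ler_prod => i _; rewrite normr_ge0/=.
by rewrite ger0_norm ?cut_ge0// cut_le.
Qed.

Lemma cvg_prodr (I : Type) (r : seq I) (f : I -> nat -> R) (l : I -> R) :
  (forall a : I, f a k @[k --> \oo] --> l a) ->
  (\prod_(a <- r) f a k) @[k --> \oo] --> \prod_(a <- r) l a.
Proof.
move=> h; elim: r => [|a r IH].
  by rewrite big_nil; under eq_fun do rewrite big_nil; exact: cvg_cst.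
by rewrite big_cons; under eq_fun do rewrite big_cons; apply: cvgM.
Qed.

Lemma cvg_chi (x : T) : chi k x @[k --> \oo] --> (1 : R).
Proof.
have := @cvg_prodr _ (index_enum 'I_n) (fun i k => cut k (x 0 i)) (fun=> 1) (fun i => cvg_cut (x 0 i)).
by rewrite big1.
Qed.

Lemma pderiv_chi_bound i : exists2 C : R, 0 <= C &
  forall k x, `|pderiv i (chi k) x| <= k.+1%:R^-1 * C.
Proof.
have [C C0 hC] := @dcut_bound R.
exists ((\prod_(j < n | j != i) expR 2) * C) => [|k x].
  by rewrite mulr_ge0//; apply: prodr_ge0 => j _; exact: expR_ge0.
rewrite [pderiv i _](@pderiv_prod_coord (fun=> cut k) (dcut k) i (fun j => smooth_cut k j)
  (is_derive_cut k)).
rewrite normrM mulrCA ler_pM//.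
rewrite normr_prod; apply: ler_prod => j _; rewrite normr_ge0/=.
by rewrite ger0_norm ?cut_ge0// cut_le.
Qed.

Lemma test_chi k phi : smooth phi -> test_function (chi k * phi).
Proof.
move=> hp; split; first exact: smoothM (smooth_chi k) hp.
apply: (@subclosed_compact _ _ (box k.+1)); first exact: closed_closure.
  exact: compact_box.
have /closure_id -> := @closed_box R n k.+1; apply: closureS => x /= xn i.
rewrite leNgt; apply: contra_neqN xn => h; rewrite fctE /chi (bigD1 i)//=.
by rewrite cut_eq0// !mul0r.
Qed.

Lemma normal_pdf01E (t : R) : normal_pdf 0 1 t = normal_peak 1 * expR (- (t ^+ 2 / 2)).
Proof. by rewrite normal_pdfE ?oner_eq0// /normal_fun subr0 expr1n mulNr. Qed.

Lemma smooth_pdf i : smooth (fun x : T => normal_pdf 0 1 (x 0 i)).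
Proof.
have -> : (fun x : T => normal_pdf 0 1 (x 0 i)) =
    (fun x : T => normal_peak 1 * expR (- (x 0 i ^+ 2 / 2))).
  by apply/funext => x; rewrite normal_pdf01E.
exact: (@smooth_coord_comp R n _ i (smooth1_gauss (normal_peak 1))).
Qed.

Lemma smooth_gdens : smooth (@gdens R n).
Proof. by apply: (@smooth_prod_coord (fun=> normal_pdf 0 1) xpredT) => j; exact: smooth_pdf. Qed.

(** This relation turns a derivative of q times the density into minus [del i q] times the
    density. *)
Lemma pderiv_gdens i : pderiv i (@gdens R n) = - (X i * @gdens R n).
Proof.
rewrite [LHS](@pderiv_prod_coord (fun=> normal_pdf 0 1) _ i (fun j => smooth_pdf j) (fun t => is_derive_normal_pdf t)).
by apply/funext => x; rewrite /gdens !fctE [in RHS](bigD1 i)//= /X; ring.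
Qed.

Lemma pol_smooth N (p : T -> R) : pol N p -> smooth p.
Proof.
elim=> {N p} [N c|N i p _ IH|N p q _ IHp _ IHq]; first exact: smooth_cst.
- exact: smoothM (smooth_coord i) IH.
- exact: smoothD.
Qed.

End cut_rV.

(** * Weak gradients *)

Section weak_gradient_to_sob.
Context {R : realType} {n : nat}.
Local Notation T := 'rV[R]_n.
Local Notation mu := (normal_rV 1 : probability T R).
Implicit Types (phi u v w D : T -> R).

Lemma integral_gdens u : measurable_fun setT u ->
  (\int[mu]_x (u x)%:E = \int[lebesgue_rV n]_x (u x * gdens x)%:E)%E.
Proof.
move=> hu; have mEu : measurable_fun setT (EFin \o u) by exact/measurable_EFinP.
rewrite [LHS]integralE [RHS]integralE; congr (_ - _)%E.
- rewrite ge0_integral_gdens//; last exact: measurable_funepos.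
  apply: eq_integral => x _; rewrite !funeposE /= -[0%E]/(0%R%:E) -!EFin_max.
  by rewrite -EFinM maxr_pMl ?gdens_ge0// mul0r.
- rewrite ge0_integral_gdens//; last exact: measurable_funeneg.
  apply: eq_integral => x _; rewrite !funenegE /= -[0%E]/(0%R%:E) -!EFin_max.
  by rewrite -EFinM maxr_pMl ?gdens_ge0// mul0r mulNr.
Qed.

Lemma smooth_mfun phi : smooth phi -> measurable_fun setT phi.
Proof. by move=> hp; apply: continuous_measurable_rV; exact: (smooth_continuous hp). Qed.

Lemma intg_bddM (b : T -> R) w (C : R) : measurable_fun setT b ->
  (forall x, `|b x| <= C) -> intg mu w -> intg mu (b * w).
Proof.
move=> mb bC iw; apply: (@intg_le _ _ _ _ _ (C *: (fun x => `|w x|))).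
- exact: measurable_funM mb (intg_mfun iw).
- by move=> x; rewrite !fctE normrM ler_wpM2r.
- by apply: intgZ; exact: integrable_abse iw.
Qed.

Lemma cvg_Ex_bddM (b_ : nat -> T -> R) (b : T -> R) w (C : R) :
  (forall k, measurable_fun setT (b_ k)) -> (forall k x, `|b_ k x| <= C) ->
  (forall x, b_ k x @[k --> \oo] --> b x) -> intg mu w ->
  Ex mu (b_ k * w) @[k --> \oo] --> Ex mu (b * w).
Proof.
move=> mb bC bb iw.
have [||||_ h] := @dominated_Ex _ _ _ mu (fun k => b_ k * w) (b * w) (C *: (fun x => `|w x|)).
- by move=> k; exact: measurable_funM (mb k) (intg_mfun iw).
- by move=> x; rewrite fctE; apply: cvgMl; exact: bb.
- by apply: intgZ; exact: integrable_abse iw.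
- by move=> k x; rewrite !fctE normrM ler_wpM2r.
- exact: h.
Qed.

(* The test function is chi_k phi gdens. *)
Lemma weak_pderiv_chi i u w phi k : measurable_fun setT u -> measurable_fun setT w ->
  weak_pderiv i u w -> smooth phi ->
  Ex mu (u * (pderiv i (chi k) * phi - chi k * (X i * phi - pderiv i phi))) =
  - Ex mu (w * (chi k * phi)).
Proof.
move=> mu_ mw uw sp; have sg := @smooth_gdens R n; have sc := @smooth_chi R n k.
have := uw _ (test_chi k (smoothM sp sg)).
have -> : pderiv i (chi k * (phi * @gdens R n)) =
    (pderiv i (chi k) * phi - chi k * (X i * phi - pderiv i phi)) * @gdens R n.
  rewrite (pderivM i sc (smoothM sp sg)) (pderivM i sp sg) pderiv_gdens.
  by apply/funext => x; rewrite !fctE; ring.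
have mphi := smooth_mfun sp; have mchi := smooth_mfun sc.
have mdphi := smooth_mfun (smooth_pderiv i sp); have mdchi := smooth_mfun (smooth_pderiv i sc).
rewrite /Ex /Rintegral integral_gdens; last first.
  apply: measurable_funM => //; apply: measurable_funB; first exact: measurable_funM mdchi mphi.
  apply: (measurable_funM mchi); apply: measurable_funB mdphi.
  exact: measurable_funM (measurable_coord i) mphi.
rewrite integral_gdens; last exact: measurable_funM mw (measurable_funM mchi mphi).
move=> h; rewrite -fineN; congr fine.
transitivity (\int[lebesgue_rV n]_x (u x * ((pderiv i (chi k) * phi -
   chi k * (X i * phi - pderiv i phi)) * @gdens R n) x)%:E)%E.
  by apply: eq_integral => x _; rewrite !fctE mulrA.
by rewrite h; congr (- _)%E; apply: eq_integral => x _; rewrite !fctE !mulrA.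
Qed.

(** Let k tend to infinity in [weak_pderiv_chi] with phi = q: the term with the derivative of the
    cutoff disappears, and in the others the cutoff becomes 1. *)
Lemma weak_gradient_sob u (G : T -> T) : is_weak_gradient u G -> L2 mu u ->
  (forall i, L2 mu (fun x => G x 0 i)) -> sob u (fun i x => G x 0 i).
Proof.
move=> uG hu hG; split=> // i N q hq.
have hqL := pol_L2 hq; have hd := pol_L2 (pol_del i hq).
have sq := pol_smooth hq.
have [C C0 hC] := @chi_bound R n; have [D D0 hD] := @pderiv_chi_bound R n i.
have sc k := @smooth_chi R n k.
have mchi k : measurable_fun setT (@chi R n k) by exact: (smooth_mfun (sc k)).
have mdchi k : measurable_fun setT (pderiv i (@chi R n k)).
  by exact: (smooth_mfun (smooth_pderiv i (sc k))).
have cd x : pderiv i (@chi R n k) x @[k --> \oo] --> (0 : R).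
  apply/norm_cvg0P; apply: (squeeze_cvgr _ (@cvg_cst _ (0:R) _ _ _)
    (_ : (fun k => harmonic k * D) @ \oo --> (0 : R))).
    by apply: nearW => k; rewrite normr_ge0/=; exact: hD.
  by rewrite -(mul0r D); apply: cvgMl; exact: cvg_harmonic.
have dD k x : `|pderiv i (@chi R n k) x| <= D.
  by rewrite (le_trans (hD k x))// ler_piMl// invf_le1// ler1n.
have i1 := L2_intgM hu hqL; have i2 := L2_intgM hu hd; have i3 := L2_intgM (hG i) hqL.
have c1 := @cvg_Ex_bddM (fun k => pderiv i (chi k)) 0 _ D mdchi dD cd i1.
have c2 := @cvg_Ex_bddM chi 1 _ C mchi hC (fun x => cvg_chi x) i2.
have c3 := @cvg_Ex_bddM chi 1 _ C mchi hC (fun x => cvg_chi x) i3.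
rewrite mul0r Ex_cst in c1; rewrite !mul1r in c2 c3.
(* Each expectation is put in the form of a bounded function times a fixed integrable one, for
   dominated convergence. *)
have e k : Ex mu (pderiv i (chi k) * (u * q)) - Ex mu (chi k * (u * del i q)) =
    - Ex mu (chi k * ((fun x => G x 0 i) * q)).
  rewrite -ExB; [|exact: intg_bddM (mdchi k) (dD k) i1|exact: intg_bddM (mchi k) (hC k) i2].
  have := @weak_pderiv_chi i u _ q k (L2_mfun hu) (L2_mfun (hG i)) (uG i).2 sq.
  congr (_ = - _); congr (Ex _ _); apply/funext => x; rewrite /del !fctE; ring.
have c4 : Ex mu (pderiv i (chi k) * (u * q)) - Ex mu (chi k * (u * del i q))
    @[k --> \oo] --> 0 - ip mu u (del i q) by exact: (@cvgB R R^o _ _ _ _ _ _ _ c1 c2).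
have c5 : - Ex mu (chi k * ((fun x => G x 0 i) * q)) @[k --> \oo] --> - ip mu (fun x => G x 0 i) q.
  by exact: (@cvgN R R^o _ _ _ _ _ c3).
rewrite (_ : (fun k => _) = (fun k => Ex mu (pderiv i (chi k) * (u * q)) -
  Ex mu (chi k * (u * del i q)))) in c5; last by apply/funext => k; rewrite e.
have : - ip mu (fun x => G x 0 i) q = 0 - ip mu u (del i q).
  exact: (@cvg_unique R (@norm_hausdorff _ R^o) _ _ _ _ c5 c4).
by move=> h; apply: oppr_inj; rewrite h ?sub0r.
Qed.

End weak_gradient_to_sob.

(** * Almost everywhere uniqueness of weak gradients *)

Section uniqueness.
Context {R : realType} {n : nat}.
Local Notation T := 'rV[R]_n.
Local Notation mu := (normal_rV 1 : probability T R).
Implicit Types (phi u v w D : T -> R).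

(** The cutoff times the Gaussian density is a test function, so local integrability is enough. *)
Lemma intg_chi D k : locally_integrable_rV D -> intg mu (D * chi k).
Proof.
move=> lD; have sg := @smooth_gdens R n; have sc := @smooth_chi R n k.
have mD : measurable_fun setT (D * chi k) := measurable_funM lD.1 (smooth_mfun sc).
have [sgc kgc] := test_chi k sg.
have /integrableP[_ h] := integrable_loc_mul lD (smooth_continuous sgc) kgc.
apply/integrableP; split; first exact/measurable_EFinP.
apply: le_lt_trans h; rewrite ge0_integral_gdens//; last first.
  by apply: measurableT_comp => //; exact/measurable_EFinP.
rewrite le_eqVlt; apply/orP; left; apply/eqP; apply: eq_integral => x _.
by rewrite !fctE /= -EFinM !normrM (ger0_norm (gdens_ge0 x)) mulrA.
Qed.

Lemma indic_orthant_limit (b : T) : exists2 E : nat -> T -> R,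
  (forall k, smooth (E k)) /\ (forall k x, `|E k x| <= 1) &
  forall x, E k x @[k --> \oo] --> (\1_(orthant b) x : R).
Proof.
exists (fun k x => \prod_i flat 1 (- (k.+1%:R * b 0 i) + k.+1%:R * x 0 i)); first split=> [k|k x].
- apply: (@smooth_prod_coord R n (fun i t => flat 1 (- (k.+1%:R * b 0 i) + k.+1%:R * t)) xpredT) => i.
  exact: (@smooth_coord_comp R n _ i (smooth1_flat 1 (- (k.+1%:R * b 0 i)) k.+1%:R)).
- rewrite normr_prod -[leRHS](@big1_eq _ _ *%R _ (index_enum 'I_n) xpredT).
  apply: ler_prod => i _; rewrite normr_ge0/= ger0_norm ?flat1_ge0//; exact: flat1_le1.
move=> x; have -> : \1_(orthant b) x = \prod_i ((b 0 i < x 0 i)%R%:R : R).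
  rewrite indicE; have [/set_mem h|/negP h] := boolP (x \in orthant b).
    by rewrite big1// => i _; rewrite h.
  have /existsNP[i hi] : ~ forall i, b 0 i < x 0 i by move=> h'; apply: h; exact: mem_set.
  by rewrite (bigD1 i)//= (negbTE (introN idP hi)) mul0r.
have h := @cvg_prodr R _ (index_enum 'I_n) (fun i k => flat 1 (- (k.+1%:R * b 0 i) + k.+1%:R * x 0 i))
  _ (fun i => @cvg_flat_indic R (b 0 i) (x 0 i)).
apply: h.
Qed.

(** Indicators of orthants are bounded limits of smooth functions, so the monotone class theorem
    extends the hypothesis to all indicators of measurable sets. *)
Lemma ae0_of_smooth w : intg mu w -> (forall phi, smooth phi -> Ex mu (phi * w) = 0) ->
  {ae mu, forall x, w x = 0}.
Proof.
move=> iw h.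
pose C F := bfun F /\ Ex mu (F * w) = 0.
have iM F : bfun F -> intg mu (F * w).
  by move=> [mF [M FM]]; exact: intg_bddM mF FM iw.
have CA : forall A, measurable A -> C \1_A.
  apply: bounded_class.
  - by split; [exact: bfun_cst|exact: (h _ (@smooth_cst R n 1))].
  - move=> u v [bu u0] [bv v0]; split; first exact: bfunD.
    by rewrite mulrDl ExD; [rewrite u0 v0 addr0|exact: iM|exact: iM].
  - move=> c u [bu u0]; split.
      by have := bfunM (bfun_cst c) bu.
    by rewrite fct_scalerAl ExZ; [rewrite u0 mulr0|exact: iM].
  - move=> u_ u hu u1 uu; split; first exact: bfun_lim (fun k => (hu k).1) u1 uu.
    have := cvg_Ex_bddM (fun k => (hu k).1.1) u1 uu iw.
    under eq_fun do rewrite (hu _).2.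
    move=> hc; apply/esym; exact: (@cvg_unique R (@norm_hausdorff _ R^o) _ _ _ _ (cvg_cst 0) hc).
  - move=> b; have [E [sE E1] Eb] := indic_orthant_limit b; split.
      by split; [exact: (measurable_indic (measurable_orthant b))|
        exists 1 => x; rewrite indicE normr_nat lern1; case: (_ \in _)].
    have := cvg_Ex_bddM (fun k => smooth_mfun (sE k)) E1 Eb iw.
    under eq_fun do rewrite h//.
    move=> hc; apply/esym; exact: (@cvg_unique R (@norm_hausdorff _ R^o) _ _ _ _ (cvg_cst 0) hc).
have h0 : ae_eq mu setT (EFin \o w) (EFin \o (fun=> 0)).
  apply: integral_ae_eq => //.
    exact/measurable_EFinP/measurable_cst.
  move=> E _ mE; rewrite [RHS]integral0_eq//.
  have [bE wE] := CA E mE; rewrite integral_mkcond.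
  transitivity (Ex mu (\1_E * w))%:E; last by rewrite wE.
  rewrite /Ex /Rintegral fineK; last by apply: integrable_fin_num => //; exact: iM bE.
  apply: eq_integral => x _; rewrite -[(\1_E * w) x]/(\1_E x * w x) indicE patchE; case: ifPn => _; [by rewrite mul1r|by rewrite mul0r].
by apply: filterS h0 => x /(_ Logic.I) []. 
Qed.

(** The two gradients are only locally integrable, so their difference need not be integrable for
    the Gaussian measure; it is multiplied by each cutoff before [ae0_of_smooth] is applied. *)
Lemma weak_gradient_unique u (G H : T -> T) i : is_weak_gradient u G -> is_weak_gradient u H ->
  {ae mu, forall x, G x 0 i = H x 0 i}.
Proof.
move=> uG uH; pose g x := G x 0 i; pose h x := H x 0 i.
have [lg wg] := uG i; have [lh wh] := uH i.
pose w k : T -> R := (g - h) * chi k.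
have iw k : intg mu (w k) by rewrite /w mulrBl; apply: intgB; exact: intg_chi.
have w0 k phi : smooth phi -> Ex mu (phi * w k) = 0.
  move=> sp; have sc := @smooth_chi R n k; have sg := @smooth_gdens R n.
  have [st kt] := test_chi k (smoothM sp sg).
  have ig := integrable_loc_mul lg (smooth_continuous st) kt.
  have ih := integrable_loc_mul lh (smooth_continuous st) kt.
  rewrite /Ex /Rintegral integral_gdens; last exact: measurable_funM (smooth_mfun sp) (intg_mfun (iw k)).
  transitivity (fine (\int[lebesgue_rV n]_x ((g x * (chi k * (phi * @gdens R n)) x)%:E -
      (h x * (chi k * (phi * @gdens R n)) x)%:E))%E).
    by congr fine; apply: eq_integral => x _; rewrite -EFinB /w !fctE; congr EFin; ring.
  rewrite integralB_EFin//.
  have := wg _ (conj st kt); rewrite (wh _ (conj st kt)) => /oppe_inj ->.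
  by rewrite subee// integrable_fin_num.
have ae k := ae0_of_smooth (iw k) (w0 k).
apply: (@negligibleS _ _ _ _ (\bigcup_k ~` [set x | w k x = 0])); last first.
  by apply: negligible_bigcup => k; exact: ae.
move=> x /= ne.
(* The cutoffs tend to 1 at x, so one of them is nonzero there and can be divided out. *)
have c1 : \forall k \near \oo, 0 < chi k x by apply: (cvgr_gt _ (cvg_chi x)).
have [k /= hk] := filter_ex c1.
exists k => //= wk; apply: ne; apply/eqP; rewrite -subr_eq0.
move/eqP: wk; rewrite /w !fctE mulf_eq0 => /orP[//|].
by rewrite gt_eqF.
Qed.

Lemma L2_ae u v : measurable_fun setT u -> measurable_fun setT v ->
  {ae mu, forall x, u x = v x} -> L2 mu u -> L2 mu v.
Proof.
move=> mu_ mv uv [_ /integrableP[_ iu]]; split=> //; apply/integrableP; split.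
  by apply/measurable_EFinP; exact: measurable_funM.
apply: le_lt_trans iu; rewrite le_eqVlt; apply/orP; left; apply/eqP; apply: ae_eq_integral => //.
- by apply: measurableT_comp => //; apply/measurable_EFinP; exact: measurable_funM.
- by apply: measurableT_comp => //; apply/measurable_EFinP; exact: measurable_funM.
- by apply: filterS uv => x uv _; rewrite /= !fctE uv.
Qed.

End uniqueness.

Section integral_subset.
Context {d} {T : measurableType d} {R : realType} (mu : {measure set T -> \bar R}).

(** Every simple function below f restricted to A is also below f restricted to B. Here A and B are
    arbitrary sets, so this covers the compact sets in the definition of local integrability
    directly. *)
Lemma ge0_integral_subset (A B : set T) (f : T -> \bar R) :
  (forall x, 0 <= f x)%E -> A `<=` B -> (\int[mu]_(x in A) f x <= \int[mu]_(x in B) f x)%E.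
Proof.
move=> f0 AB; rewrite !ge0_integralE//.
apply: le_ereal_sup => _ [h hf <-]; exists h => // x.
apply: (le_trans (hf x)); rewrite !patchE; case: ifPn => [/set_mem/AB/mem_set ->//|_].
by case: ifP.
Qed.
End integral_subset.

(** * Local integrability on boxes, and smooth functions under dilation *)

Section locally_integrable.
Context {R : realType} {n : nat}.
Local Notation T := 'rV[R]_n.
Local Notation leb := (lebesgue_rV n).
Local Notation mu := (normal_rV 1 : probability T R).
Implicit Types (phi u v w : T -> R) (i j : 'I_n) (k : nat).

Lemma locally_integrable_boxP u : locally_integrable_rV u <->
  measurable_fun setT u /\ forall k, leb.-integrable (box k) (EFin \o u).
Proof.
split=> -[hu h]; split=> //.
  move=> k; apply/integrableP; split.
    by apply: measurable_funTS; exact/measurable_EFinP.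
  exact: (h _ (@compact_box R n k)).
move=> K /compact_sub_box[k Kk].
have /integrableP[_] := h k; apply: le_lt_trans; exact: ge0_integral_subset.
Qed.

Lemma locally_integrable_rVD u v : locally_integrable_rV u -> locally_integrable_rV v ->
  locally_integrable_rV (u + v).
Proof.
move=> /locally_integrable_boxP[hu iu] /locally_integrable_boxP[hv iv].
apply/locally_integrable_boxP; split; first exact: measurable_funD.
move=> k; have mb := @measurable_box R n k.
rewrite (_ : EFin \o _ = (EFin \o u) \+ (EFin \o v))%E; last by [].
exact: integrableD (iu k) (iv k).
Qed.

Lemma locally_integrable_rV_mul u (b : T -> R) (c : nat -> R) : locally_integrable_rV u ->
  measurable_fun setT b -> (forall k x, box k x -> `|b x| <= c k) -> locally_integrable_rV (b * u).
Proof.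
move=> /locally_integrable_boxP[hu iu] mb bc.
apply/locally_integrable_boxP; split; first exact: measurable_funM.
move=> k; have mk := @measurable_box R n k.
apply: (le_integrable mk (g := fun x => ((c k)%:E * (u x)%:E)%E)).
- by apply: measurable_funTS; apply/measurable_EFinP; exact: measurable_funM.
- move=> x bx /=; rewrite lee_fin !fctE !normrM ler_wpM2r//.
  by rewrite (le_trans (bc _ _ bx))// ler_norm.
- exact: integrableZl (iu k).
Qed.

Lemma locally_integrable_rV0 : locally_integrable_rV (0 : T -> R).
Proof.
apply/locally_integrable_boxP; split; first exact: measurable_cst.
by move=> k; exact: integrable0.
Qed.

Lemma box_supp phi k : (forall x, phi x != 0 -> box k x) ->
  compact (closure [set x | phi x != 0]).
Proof.
move=> h; apply: (@subclosed_compact _ _ (box k)); first exact: closed_closure.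
  exact: compact_box.
by have /closure_id -> := @closed_box R n k; apply: closureS.
Qed.

Lemma test_box phi : test_function phi -> exists k, forall x, phi x != 0 -> box k x.
Proof.
move=> [_ /compact_sub_box[k hk]]; exists k => x h; apply: hk.
exact: subset_closure.
Qed.

(** Only the derivative along v is assumed, so this is the one-variable chain rule for t |-> phi(t v
    + x) composed with t |-> a t. *)
Lemma is_derive_dir (a : R) phi (x v : T) (l : R) :
  is_derive x v phi l -> is_derive x (a *: v) phi (a * l).
Proof.
move=> [dp lp].
pose g (t : R) := phi (t *: v + x).
have dg : is_derive (0 : R) (1 : R) g l.
  have e : (fun s : R => s^-1 *: ((g \o shift 0) (s *: (1 : R)) - g 0)) =
    (fun s => s^-1 *: ((phi \o shift x) (s *: v) - phi x)).
    apply/funext => s; rewrite /g /= scale0r add0r addr0.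
    by rewrite [s *: (1 : R)]mulr1.
  by apply: DeriveDef; rewrite /derivable/derive ?e.
have da : is_derive (0 : R) (1 : R) (fun t => a * t) a.
  apply: (is_derive_eq (is_deriveZ a (is_derive_id (0 : R) (1 : R)))).
  by rewrite /GRing.scale/= mulr1.
have dg' : is_derive (a * 0 : R) (1 : R) g l by rewrite mulr0.
have [dga lga] := @is_derive1_comp _ g (fun t => a * t) 0 _ _ dg' da.
have e : (fun s : R => s^-1 *: (((g \o (fun t => a * t)) \o shift 0) (s *: (1 : R)) - (g \o (fun t => a * t)) 0)) =
    (fun s => s^-1 *: ((phi \o shift x) (s *: (a *: v)) - phi x)).
  apply/funext => s; rewrite /g /= mulr0 scale0r add0r addr0.
  by rewrite [s *: (1 : R)]mulr1 scalerA mulrC.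
by apply: DeriveDef; [move: dga|move: lga]; rewrite /derivable/derive e // mulrC.
Qed.

Lemma is_derive_scale (a : R) phi (x v : T) (l : R) :
  is_derive (a *: x) v phi l -> is_derive x v (fun y => phi (a *: y)) (a * l).
Proof.
move=> /(is_derive_dir a)[dp lp].
have e : (fun s : R => s^-1 *: (((fun y => phi (a *: y)) \o shift x) (s *: v) - phi (a *: x))) =
    (fun s => s^-1 *: ((phi \o shift (a *: x)) (s *: (a *: v)) - phi (a *: x))).
  apply/funext => s /=; rewrite (scalerDr a (s *: v) x) !scalerA; by rewrite [a * s]mulrC.
by apply: DeriveDef; [move: dp|move: lp]; rewrite /derivable/derive e.
Qed.

Lemma pderiv_scale (a : R) phi i : smooth phi ->
  pderiv i (fun y => phi (a *: y)) = (fun y => a * pderiv i phi (a *: y)).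
Proof.
move=> sp; apply/funext => x.
have := @smooth_derivable _ _ _ i (a *: x) sp => dp.
have h : is_derive (a *: x) (delta_mx 0 i) phi (pderiv i phi (a *: x)) by exact: DeriveDef.
by have [_] := is_derive_scale h.
Qed.

Lemma smooth_scale (a : R) phi : smooth phi -> smooth (fun y => phi (a *: y)).
Proof.
move=> sp; apply: (@smooth_class _ _ (fun psi => exists c phi, smooth phi /\
    psi = (fun y => c * phi (a *: y)))); last first.
  by exists 1, phi; split=> //; apply/funext => y; rewrite mul1r.
move=> _ {phi sp} [c [phi [sp ->]]].
have key i (x : T) : is_derive x (delta_mx 0 i) (fun y => c * phi (a *: y))
    (c * a * pderiv i phi (a *: x)).
  have dp := @smooth_derivable _ _ _ i (a *: x) sp.
  have h : is_derive (a *: x) (delta_mx 0 i) phi (pderiv i phi (a *: x)) by exact: DeriveDef.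
  apply: (is_derive_eq (is_deriveM (is_derive_cst c x (delta_mx 0 i)) (is_derive_scale h))).
  by rewrite scaler0 addr0 /GRing.scale/= mulrA.
split.
- move=> x; have h : (fun y : T => a *: y) @ x --> a *: x by exact: (@scaler_continuous R T a x).
  have h2 := @smooth_continuous R n phi sp (a *: x).
  have h3 := @cvg_comp _ _ _ (fun y : T => a *: y) phi _ _ _ h h2.
  exact: (@cvgM R T (nbhs x) _ (fun=> c) _ _ _ (cvg_cst c) h3).
- by move=> i x; have [] := key i x.
- move=> i; exists (c * a), (pderiv i phi); split; first exact (smooth_pderiv i sp).
  by apply/funext => x; have [_] := key i x.
Qed.

End locally_integrable.

(** * Weak derivatives under dilation *)

Section weak_pderiv_scale.
Context {R : realType} {n : nat}.
Local Notation T := 'rV[R]_n.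
Local Notation leb := (lebesgue_rV n).
Local Notation mu := (normal_rV 1 : probability T R).
Implicit Types (phi u v w : T -> R) (i j : 'I_n) (k : nat) (s : R).

Lemma measurable_scaled u s : measurable_fun setT u ->
  measurable_fun setT (fun x : T => u (s *: x)).
Proof. by move=> hu; exact: (measurableT_comp hu (measurable_scale_rV s)). Qed.

Lemma integrable_scale u s : 0 < s -> leb.-integrable setT (EFin \o u) ->
  leb.-integrable setT (fun x => (u (s *: x))%:E).
Proof.
move=> s0 /integrableP[mEu iu]; have hu : measurable_fun setT u by exact/measurable_EFinP.
apply/integrableP; split; first by apply/measurable_EFinP; exact (measurable_scaled s hu).
move: iu; rewrite (lebesgue_rV_scale s0)//; last exact: measurableT_comp.
have I0 : (0 <= \int[leb]_x `|(u (s *: x))%:E|)%E by apply: integral_ge0.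
move: (\int[leb]_x _)%E I0 => I I0.
case: I I0 => [r||] // _; rewrite ?ltry//.
by rewrite gt0_muley// lte_fin exprn_gt0.
Qed.

Lemma integral_scale u s : 0 < s -> leb.-integrable setT (EFin \o u) ->
  (\int[leb]_x (u x)%:E = (s ^+ n)%:E * \int[leb]_x (u (s *: x)%R)%:E)%E.
Proof.
move=> s0 iu; have ius := integrable_scale s0 iu.
have mEu := measurable_int _ iu.
rewrite [LHS]integralE [X in (_ * X)%E]integralE muleBr//; last first.
  by apply: fin_num_adde_defl; rewrite fin_numN; exact: (integrable_neg_fin_num measurableT ius).
congr (_ - _)%E.
- rewrite (lebesgue_rV_scale s0) => [||x]; [|exact: measurable_funepos|exact: funepos_ge0].
  by congr (_ * _)%E; apply: eq_integral => x _; rewrite !funeposE.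
- rewrite (lebesgue_rV_scale s0) => [||x]; [|exact: measurable_funeneg|exact: funeneg_ge0].
  by congr (_ * _)%E; apply: eq_integral => x _; rewrite !funenegE.
Qed.

Lemma box_scale s k (x : T) : 0 < s -> box k x -> box (Num.truncn (s * k%:R)).+1 (s *: x).
Proof.
move=> s0 bx i; rewrite mxE normrM (gtr0_norm s0).
rewrite (le_trans (ler_wpM2l (ltW s0) (bx i)))// ltW// truncnS_gt//.
Qed.

Lemma locally_integrable_scale u s : 0 < s -> locally_integrable_rV u ->
  locally_integrable_rV (fun x => u (s *: x)).
Proof.
move=> s0 /locally_integrable_boxP[hu iu].
apply/locally_integrable_boxP; split; first exact: measurable_scaled.
move=> k; set m := (Num.truncn (s * k%:R)).+1.
have mk := @measurable_box R n k; have mm := @measurable_box R n m.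
(* The scaling rule concerns the whole space, so u is first restricted to a box containing the
   dilated one. *)
have i1 : leb.-integrable setT (EFin \o (\1_(box m) * u)).
  have := iu m; rewrite (integrable_mkcond _ mm); congr (leb.-integrable _ _).
  apply/funext => x; transitivity (\1_(box m) x * u x)%:E; last by [].
  rewrite patchE indicE.
  by case: ifPn => _; rewrite ?mul1r ?mul0r.
have := integrableS measurableT mk (@subsetT _ _) (integrable_scale s0 i1).
apply: eq_integrable => // x /set_mem bx; congr EFin.
transitivity (\1_(box m) (s *: x) * u (s *: x)); first by [].
rewrite indicE mem_set ?mul1r//.
exact: box_scale.
Qed.

(** Off its closed support phi vanishes in a neighbourhood, so its derivative vanishes there. *)
Lemma compact_supp_pderiv i phi : compact (closure [set x | phi x != 0]) ->
  compact (closure [set x | pderiv i phi x != 0]).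
Proof.
move=> kphi; apply: (subclosed_compact _ kphi); first exact: closed_closure.
rewrite [X in _ `<=` X](closure_id _).1; last exact: closed_closure.
apply: closureS => x /=; apply: contra_neqP => nx.
have op : open (~` closure [set x | phi x != 0]) by apply: closed_openC; exact: closed_closure.
rewrite /pderiv (@near_eq_derive _ _ _ phi (fun=> 0)); first exact: derive_cst.
have := open_nbhs_nbhs (conj op nx); apply: filterS => y ny.
by apply/eqP; apply: contra_notT ny => hy; exact: subset_closure.
Qed.

Lemma weak_pderiv_scale s i u w : 0 < s ->
  locally_integrable_rV u -> locally_integrable_rV w -> weak_pderiv i u w ->
  weak_pderiv i (fun x => u (s *: x)) (fun x => s * w (s *: x)).
Proof.
move=> s0 lu lw uw phi tphi; have [sp _] := tphi; have [k hk] := test_box tphi.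
have s1 : s != 0 by rewrite gt_eqF.
(* The test function for u itself. The factor s cancels the 1 / s of the chain rule, and the
   Jacobian s^n, present on both sides, drops out. *)
pose psi : T -> R := s *: (fun y : T => phi (s^-1 *: y)).
have spsi : smooth psi by exact (smoothZ s (smooth_scale s^-1 sp)).
have kpsi : compact (closure [set x | psi x != 0]).
  apply: (@box_supp _ _ _ (Num.truncn (s * k%:R)).+1) => x hx.
  rewrite -[x](scalerKV s1).
  apply: box_scale => //; apply: hk; apply: contra_neq hx => h.
  by rewrite /psi fctE h scaler0.
have dpsi y : pderiv i psi y = pderiv i phi (s^-1 *: y).
  have -> : psi = (fun=> s) * (fun y : T => phi (s^-1 *: y)) by [].
  rewrite (pderivM i (smooth_cst s) (smooth_scale s^-1 sp)) pderiv_cst mulr0 addr0.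
  by rewrite pderiv_scale// fctE mulVKf.
have sd := smooth_pderiv i spsi.
have kd : compact (closure [set x | pderiv i psi x != 0]).
  exact (@compact_supp_pderiv i psi kpsi).
have i1 := integrable_loc_mul lu (smooth_continuous sd) kd.
have i2 := integrable_loc_mul lw (smooth_continuous spsi) kpsi.
have := uw _ (conj spsi kpsi).
rewrite (integral_scale s0 i1) (integral_scale s0 i2) -muleN => h.
have c0 : (0 < (s ^+ n)%:E)%E by rewrite lte_fin exprn_gt0.
have {h}h := congr1 (fun z => ((s ^+ n)^-1%:E * z)%E) h.
move: h; rewrite !muleA -EFinM mulVf ?expf_neq0// !mul1e => h.
transitivity (\int[leb]_x (u (s *: x) * pderiv i psi (s *: x))%:E)%E.
  by apply: eq_integral => x _; rewrite dpsi scalerK.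
rewrite h; congr (- _)%E; apply: eq_integral => x _.
by rewrite /psi fctE scalerK// /GRing.scale/= mulrCA mulrA.
Qed.

End weak_pderiv_scale.

(** * Operations on weak gradients, and membership in [sob] *)

Section W12.
Context {R : realType} {n : nat}.
Local Notation T := 'rV[R]_n.
Local Notation leb := (lebesgue_rV n).
Local Notation mu := (normal_rV 1 : probability T R).
Implicit Types (phi u v w : T -> R) (i j : 'I_n) (k : nat) (s : R).

Lemma weak_pderivD i u u' w w' :
  locally_integrable_rV u -> locally_integrable_rV u' ->
  locally_integrable_rV w -> locally_integrable_rV w' ->
  weak_pderiv i u w -> weak_pderiv i u' w' -> weak_pderiv i (u + u') (w + w').
Proof.
move=> lu lu' lw lw' uw uw' phi tphi; have [sp kp] := tphi.
have sd := smooth_pderiv i sp; have kd := @compact_supp_pderiv _ _ i _ kp.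
have i1 := integrable_loc_mul lu (smooth_continuous sd) kd.
have i2 := integrable_loc_mul lu' (smooth_continuous sd) kd.
have i3 := integrable_loc_mul lw (smooth_continuous sp) kp.
have i4 := integrable_loc_mul lw' (smooth_continuous sp) kp.
transitivity (\int[leb]_x ((u x * pderiv i phi x)%:E + (u' x * pderiv i phi x)%:E))%E.
  by apply: eq_integral => x _; rewrite -EFinD -mulrDl.
rewrite integralD//= (uw _ tphi) (uw' _ tphi) -fin_num_oppeD; last exact: integrable_fin_num.
rewrite -integralD//; congr (- _)%E; apply: eq_integral => x _.
by rewrite -EFinD -mulrDl.
Qed.

(** Test u against x_j phi instead of phi, and expand the derivative of that product. *)
Lemma weak_pderiv_X i j u w : locally_integrable_rV u -> locally_integrable_rV w ->
  weak_pderiv i u w -> weak_pderiv i (X j * u) (X j * w + (j == i)%:R *: u).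
Proof.
move=> lu lw uw phi tphi; have [sp kp] := tphi.
have sd := smooth_pderiv i sp; have kd := @compact_supp_pderiv _ _ i _ kp.
have sXp := smoothM (smooth_coord j) sp.
have kXp : compact (closure [set x | ((fun x : T => x 0 j) * phi) x != 0]).
  apply: (subclosed_compact _ kp); first exact: closed_closure.
  by apply: closureS => x /=; apply: contra_neq => h; rewrite fctE h mulr0.
have sXd := smooth_pderiv i sXp; have kXd := @compact_supp_pderiv _ _ i _ kXp.
have i1 := integrable_loc_mul lu (smooth_continuous sXd) kXd.
have i2 := integrable_loc_mul lu (smooth_continuous sp) kp.
have i3 := integrable_loc_mul lw (smooth_continuous sXp) kXp.
have i4 : leb.-integrable setT (fun x => ((j == i)%:R%:E * (u x * phi x)%:E)%E).
  exact: integrableZl.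
transitivity (\int[leb]_x ((u x * pderiv i ((fun x : T => x 0 j) * phi) x)%:E -
    (j == i)%:R%:E * (u x * phi x)%:E))%E.
  apply: eq_integral => x _; rewrite (pderivM i (smooth_coord j) sp) pderiv_coord.
  by rewrite -EFinM -EFinB /X !fctE; congr EFin; ring.
rewrite integralB//= (uw _ (conj sXp kXp)) -fin_num_oppeD; last exact: integrable_fin_num.
rewrite -integralD//; congr (- _)%E; apply: eq_integral => x _.
by rewrite -EFinM -EFinD /X !fctE /GRing.scale/=; congr EFin; ring.
Qed.

Lemma locally_integrable_X j u : locally_integrable_rV u -> locally_integrable_rV (X j * u).
Proof.
move=> lu; apply: (@locally_integrable_rV_mul _ _ _ _ (fun k => k%:R) lu) => [|k x bx].
  exact: measurable_coord.
exact: bx.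
Qed.

Lemma locally_integrable_rVZ (c : R) u : locally_integrable_rV u -> locally_integrable_rV (c *: u).
Proof.
move=> lu; exact: (@locally_integrable_rV_mul _ _ _ (fun=> c) (fun=> `|c|) lu).
Qed.

Lemma locally_integrable_rV_sum (r : seq 'I_n) (F : 'I_n -> T -> R) :
  (forall j, locally_integrable_rV (F j)) -> locally_integrable_rV (\sum_(j <- r) F j).
Proof.
move=> h; apply: (big_ind (@locally_integrable_rV R n)) => //.
- exact: locally_integrable_rV0.
- exact: locally_integrable_rVD.
Qed.

Lemma weak_pderiv_sum i (r : seq 'I_n) (F G : 'I_n -> T -> R) :
  (forall j, locally_integrable_rV (F j)) -> (forall j, locally_integrable_rV (G j)) ->
  (forall j, weak_pderiv i (F j) (G j)) -> weak_pderiv i (\sum_(j <- r) F j) (\sum_(j <- r) G j).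
Proof.
move=> hF hG FG; elim: r => [|j r IH].
  rewrite !big_nil => phi _.
  by rewrite !integral0_eq ?oppe0// => x _; congr EFin; exact: mul0r.
rewrite !big_cons; apply: weak_pderivD; [exact: hF|exact: locally_integrable_rV_sum|exact: hG|
  exact: locally_integrable_rV_sum|exact: FG|exact: IH].
Qed.

Lemma weak_gradient_dotv (u : 'I_n -> T -> R) (G : 'I_n -> T -> T) :
  (forall j, locally_integrable_rV (u j)) -> (forall j, is_weak_gradient (u j) (G j)) ->
  is_weak_gradient (\sum_j X j * u j)
    (fun x => \row_i (u i x + \sum_j x 0 j * G j x 0 i)).
Proof.
move=> lu uG i.
have lG j : locally_integrable_rV (fun x => G j x 0 i) by exact: (uG j i).1.
have e : (fun x : T => (\row_i (u i x + \sum_j x 0 j * G j x 0 i)) 0 i) =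
    \sum_j (X j * (fun x => G j x 0 i) + (j == i)%:R *: u j).
  apply/funext => x; rewrite mxE fct_sumE [RHS](_ : _ = \sum_j (x 0 j * G j x 0 i) + \sum_j ((j == i)%:R * u j x)).
    rewrite addrC; congr (_ + _); rewrite (bigD1 i)//= eqxx mul1r big1 ?addr0// => j /negbTE ->.
    by rewrite mul0r.
  by rewrite -big_split.
have l2 j : locally_integrable_rV (X j * (fun x => G j x 0 i) + (j == i)%:R *: u j).
  by apply: locally_integrable_rVD; [exact: locally_integrable_X|exact: locally_integrable_rVZ].
rewrite e; split; first exact: locally_integrable_rV_sum.
apply: weak_pderiv_sum => [j|//|j]; first exact: locally_integrable_X.
exact: weak_pderiv_X (lu j) (lG j) (uG j i).2.
Qed.

Lemma is_weak_gradient_wgrad u : weakly_differentiable u -> is_weak_gradient u (wgrad u).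
Proof. by move=> [G uG]; exact: (@getPex _ [set G | is_weak_gradient u G] (ex_intro _ G uG)). Qed.

Lemma weak_gradient_scale s u (G : T -> T) : 0 < s -> locally_integrable_rV u ->
  is_weak_gradient u G -> is_weak_gradient (fun x => u (s *: x)) (fun x => s *: G (s *: x)).
Proof.
move=> s0 lu uG i; have [lG wG] := uG i.
have e : (fun x : T => (s *: G (s *: x)) 0 i) = s *: (fun x : T => G (s *: x) 0 i).
  by apply/funext => x; rewrite mxE.
rewrite e; split.
  by apply: locally_integrable_rVZ; exact (locally_integrable_scale s0 lG).
exact (weak_pderiv_scale s0 lu lG wG).
Qed.

Lemma L2_le_sqr u w : measurable_fun setT u -> measurable_fun setT w ->
  (\int[mu]_x (w x)%:E < +oo)%E -> (forall x, u x ^+ 2 <= w x) -> L2 mu u.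
Proof.
move=> hu hw iw uw; have w0 x : 0 <= w x by rewrite (le_trans _ (uw x))// sqr_ge0.
split=> //; apply: (@intg_le _ _ _ _ _ w).
- exact: measurable_funM.
- by move=> x; rewrite fctE -expr2 ger0_norm ?sqr_ge0.
- apply/integrableP; split; first exact/measurable_EFinP.
  by under eq_integral do rewrite /= ger0_norm//.
Qed.

Lemma sqr_enorm (x : T) : enorm x ^+ 2 = \sum_i x 0 i ^+ 2.
Proof. by rewrite sqr_sqrtr// sumr_ge0// => i _; exact: sqr_ge0. Qed.

Lemma W12_L2 u : W12_gauss u -> L2 mu u /\ forall i, L2 mu (fun x => wgrad u x 0 i).
Proof.
move=> [lu du iu]; have uG := is_weak_gradient_wgrad du.
have mG i : measurable_fun setT (fun x => wgrad u x 0 i) by exact: (uG i).1.1.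
have mw : measurable_fun setT (fun x => u x ^+ 2 + enorm (wgrad u x) ^+ 2).
  apply: measurable_funD; first by apply: measurable_funX; exact: lu.1.
  under eq_fun do rewrite sqr_enorm.
  by apply: measurable_sum => i; exact: measurable_funX.
split=> [|i]; apply: (L2_le_sqr _ mw iu) => [|x].
- exact: lu.1.
- by rewrite lerDl sqr_ge0.
- exact: mG.
- rewrite sqr_enorm (bigD1 i)//= addrCA lerDl addr_ge0 ?sqr_ge0// sumr_ge0// => j _.
  exact: sqr_ge0.
Qed.

(** [W12_gauss] bounds the chosen version [wgrad u] only; uniqueness almost everywhere carries the
    square-integrability over to G. *)
Lemma weak_gradient_W12_sob u (G : T -> T) : W12_gauss u -> is_weak_gradient u G ->
  sob u (fun i x => G x 0 i).
Proof.
move=> wu uG; have [hu hw] := W12_L2 wu; have [lu du _] := wu.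
have uG' := is_weak_gradient_wgrad du.
apply: weak_gradient_sob => // i; apply: (L2_ae _ _ (weak_gradient_unique i uG' uG)) => //.
- exact: (uG' i).1.1.
- exact: (uG i).1.1.
Qed.

(** The hypothesis is about the dilated function. Dilating back by 1 / s shows that u itself is
    weakly differentiable, so that [wgrad u] is a genuine weak gradient and, dilated, serves as a
    version for the dilated function. *)
Lemma W12_scaled s u : 0 < s -> W12_gauss (fun x => u (s *: x)) ->
  [/\ locally_integrable_rV u, is_weak_gradient u (wgrad u) &
      sob (fun x => u (s *: x)) (fun i x => s * wgrad u (s *: x) 0 i)].
Proof.
move=> s0 wu; have [lus dus _] := wu; have s1 : s != 0 by rewrite gt_eqF.
have si0 : 0 < s^-1 by rewrite invr_gt0.
have e : (fun x : T => u (s *: (s^-1 *: x))) = u.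
  by apply/funext => x; rewrite scalerKV.
have lu : locally_integrable_rV u.
  by have := locally_integrable_scale si0 lus; rewrite e.
have uG : is_weak_gradient u (wgrad u).
  apply: is_weak_gradient_wgrad.
  have := weak_gradient_scale si0 lus (is_weak_gradient_wgrad dus); rewrite e => h.
  by eexists; exact: h.
split=> //.
have := weak_gradient_W12_sob wu (weak_gradient_scale s0 lu uG).
congr (sob _ _); apply/funext => i; apply/funext => x; by rewrite mxE.
Qed.

End W12.

(** * Variance formulas *)

Section transfer.
Context {R : realType} {n : nat} {d : measure_display} {Omega : measurableType d}.
Variables (P : probability Omega R) (s : R) (z : {RV P >-> 'rV[R]_n}).
Local Notation T := 'rV[R]_n.
Local Notation mu := (normal_rV 1 : probability T R).
Hypothesis s0 : 0 < s.
Hypothesis zE : forall A : set T, measurable A -> distribution P z A = normal_rV s A.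

Lemma ge0_integral_rv (h : T -> \bar R) : measurable_fun setT h -> (forall x, 0 <= h x)%E ->
  (\int[P]_w h (z w) = \int[mu]_x h (s *: x)%R)%E.
Proof.
move=> mh h0; rewrite -(normal_rV_scale s0)//.
transitivity (\int[distribution P z]_x h x)%E; first by rewrite ge0_integral_distribution.
by apply: eq_measure_integral => A mA _; exact: zE.
Qed.

(** Expectations are computed on the standard Gaussian space, where [us] is F after dilation. *)
Lemma expectation_rv (F us : T -> R) : (forall x, F (s *: x) = us x) -> intg mu us ->
  'E_P[fun w => F (z w)]%E = (Ex mu us)%:E.
Proof.
move=> Fus ius.
have mF : measurable_fun setT F.
  have -> : F = (fun x => us (s^-1 *: x)).
    by apply/funext => x; rewrite -Fus scalerKV// gt_eqF.
  exact (measurable_scaled s^-1 (intg_mfun ius)).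
have mEF : measurable_fun setT (EFin \o F) by exact/measurable_EFinP.
rewrite unlock /Ex /Rintegral fineK; last exact: integrable_fin_num.
rewrite [LHS]integralE [RHS]integralE; congr (_ - _)%E.
- rewrite -[LHS](_ : (\int[P]_w (EFin \o F)^\+ (z w))%E = _); last first.
    by apply: eq_integral => w _; rewrite !funeposE.
  rewrite ge0_integral_rv; [|exact: measurable_funepos|exact: funepos_ge0].
  by apply: eq_integral => x _; rewrite !funeposE /= Fus.
- rewrite -[LHS](_ : (\int[P]_w (EFin \o F)^\- (z w))%E = _); last first.
    by apply: eq_integral => w _; rewrite !funenegE.
  rewrite ge0_integral_rv; [|exact: measurable_funeneg|exact: funeneg_ge0].
  by apply: eq_integral => x _; rewrite !funenegE /= Fus.
Qed.

Lemma variance_rv (F us : T -> R) : (forall x, F (s *: x) = us x) -> L2 mu us ->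
  'V_P[fun w => F (z w)]%E = (ip mu us us - Ex mu us ^+ 2)%:E.
Proof.
move=> Fus hus; have hc := @L2_cst _ _ _ mu (Ex mu us).
rewrite /variance unlock (expectation_rv Fus (L2_intg hus)) /=.
rewrite (@expectation_rv (fun x => (F x - Ex mu us) * (F x - Ex mu us))
  ((us - (fun=> Ex mu us)) * (us - (fun=> Ex mu us)))).
- congr EFin; rewrite -[LHS]/(ip mu (us - (fun=> Ex mu us)) (us - (fun=> Ex mu us))).
  have hB := L2B hus hc.
  rewrite ipBl// !ipBr//.
  have e : ip mu us (fun=> Ex mu us) = Ex mu us * Ex mu us.
    rewrite /ip (_ : us * _ = Ex mu us *: us); first by rewrite ExZ//; exact: L2_intg.
    by apply/funext => x; rewrite fctE mulrC.
  rewrite (ipC _ (fun=> Ex mu us)) e.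
  have -> : ip mu (fun=> Ex mu us) (fun=> Ex mu us) = Ex mu us * Ex mu us by exact: Ex_cst.
  by rewrite subrr subr0 expr2.
- by move=> x; rewrite !Fus.
- by apply: L2_intgM; exact: L2B.
Qed.

End transfer.

Section sobolev_ops.
Context {R : realType} {n : nat}.
Local Notation T := 'rV[R]_n.
Local Notation mu := (normal_rV 1 : probability T R).
Implicit Types (u w : T -> R) (i : 'I_n).

Lemma sobZ (c : R) u (G : 'I_n -> T -> R) : sob u G -> sob (c *: u) (fun i => c *: G i).
Proof.
move=> [hu hG uG]; split=> [|i|i N q hq]; [exact: L2Z|exact: L2Z|].
have hqL := pol_L2 hq; have hd := pol_L2 (pol_del i hq).
by rewrite !ipZl// (uG i _ _ hq).
Qed.

Lemma weak_gradientZ (c : R) u (G : T -> T) : locally_integrable_rV u ->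
  is_weak_gradient u G -> is_weak_gradient (c *: u) (fun x => c *: G x).
Proof.
move=> lu uG i; have [lG wG] := uG i.
have -> : (fun x : T => (c *: G x) 0 i) = c *: (fun x => G x 0 i).
  by apply/funext => x; rewrite mxE.
split; first exact: locally_integrable_rVZ.
move=> phi tphi; have [sp kp] := tphi.
have sd := smooth_pderiv i sp; have kd := @compact_supp_pderiv _ _ i _ kp.
have i1 := integrable_loc_mul lu (smooth_continuous sd) kd.
have i2 := integrable_loc_mul lG (smooth_continuous sp) kp.
have := congr1 (fun y => (c%:E * y)%E) (wG _ tphi).
rewrite muleN -!integralZl// => h.
transitivity (\int[lebesgue_rV n]_x (c%:E * (u x * pderiv i phi x)%:E))%E.
  by apply: eq_integral => x _; rewrite -EFinM mulrA.
by rewrite h; congr (- _)%E; apply: eq_integral => x _; rewrite -EFinM mulrA.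
Qed.

End sobolev_ops.

(** * Reduction to unit variance, and the divergence *)

Section scaled.
Context {R : realType} {n : nat}.
Variables (s : R) (f : 'rV[R]_n -> 'rV[R]_n).
Local Notation T := 'rV[R]_n.
Local Notation mu := (normal_rV 1 : probability T R).
Hypothesis s0 : 0 < s.
Hypothesis f_W12 : forall i : 'I_n, W12_gauss (fun x => f (s *: x) 0 i).
Implicit Types (i j : 'I_n).

(** The outer factor s makes x^T f~(x) equal to (s x)^T f(s x) and div f~(x) equal to s^2 (div f)(s
    x), for f~ with components [fs]; the formulas for sigma = 1 then apply verbatim. *)
Definition fs i : T -> R := s *: (fun x : T => f (s *: x) 0 i).
Definition dfs i j : T -> R := s *: (fun x : T => s * wgrad (fun y => f y 0 i) (s *: x) 0 j).

Lemma fsE i x : fs i x = s * f (s *: x) 0 i. Proof. by []. Qed.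

Lemma dfsE i j x : dfs i j x = s ^+ 2 * wgrad (fun y => f y 0 i) (s *: x) 0 j.
Proof. by rewrite expr2 -mulrA. Qed.

Lemma sob_fs i : sob (fs i) (dfs i).
Proof.
have [_ _ h] := W12_scaled s0 (f_W12 i : W12_gauss (fun x => (fun y : T => f y 0 i) (s *: x))).
exact: sobZ h.
Qed.

Definition trfs : T -> R := \sum_i \sum_j dfs i j * dfs j i.

Lemma intg_trfs : intg mu trfs.
Proof.
by apply: intg_sum => i _; apply: intg_sum => j _; apply: L2_intgM; exact: sob_L2G (sob_fs _).
Qed.

Lemma Ex_trfs : Ex mu trfs = \sum_i \sum_j ip mu (dfs i j) (dfs j i).
Proof.
have h i j : intg mu (dfs i j * dfs j i).
  by apply: L2_intgM; exact: sob_L2G (sob_fs _).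
by rewrite Ex_sum => [|i _]; [apply: eq_bigr => i _; rewrite Ex_sum|exact: intg_sum].
Qed.

Lemma trfsE x : trfs x = s ^+ 4 * \tr (nabla f (s *: x) *m nabla f (s *: x)).
Proof.
rewrite /trfs fct_sumE /mxtrace mulr_sumr; apply: eq_bigr => i _.
rewrite fct_sumE mxE mulr_sumr; apply: eq_bigr => j _.
by rewrite !mxE fctE !dfsE; ring.
Qed.

Lemma dotv_fs x : (\sum_i X i * fs i) x = dotv (s *: x) (f (s *: x)).
Proof.
rewrite fct_sumE /dotv; apply: eq_bigr => i _.
by rewrite fctE fsE /X mxE; ring.
Qed.

Lemma wdiv_dfs x : (\sum_i dfs i i) x = s ^+ 2 * wdiv f (s *: x).
Proof.
rewrite fct_sumE /wdiv mulr_sumr; apply: eq_bigr => i _.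
by rewrite dfsE.
Qed.

Lemma sum_dl_fs : \sum_i dl i (fs i) (dfs i i) = \sum_i X i * fs i - \sum_i dfs i i.
Proof. by rewrite -sumrB. Qed.

(** The i-th component of (nabla f~) x, that is, what the gradient of x^T f~ contains besides f~. *)
Definition Qfs i : T -> R := \sum_j X j * dfs j i.

Lemma QfsE i x : Qfs i x = s * (nabla f (s *: x) *m (s *: x)^T) i 0.
Proof.
rewrite /Qfs fct_sumE mxE mulr_sumr; apply: eq_bigr => j _.
by rewrite !mxE fctE dfsE /X; ring.
Qed.

Lemma sob_dotv_fs : W12_gauss (fun x => dotv (s *: x) (f (s *: x))) ->
  sob (\sum_i X i * fs i) (fun i => fs i + Qfs i).
Proof.
move=> h; have e : (fun x => dotv (s *: x) (f (s *: x))) = \sum_i X i * fs i.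
  by apply/funext => x; rewrite dotv_fs.
rewrite e in h.
have lf i : locally_integrable_rV (fun x : T => f (s *: x) 0 i) by case: (f_W12 i).
have hG i : is_weak_gradient (fun x : T => f (s *: x) 0 i)
    (fun x => s *: wgrad (fun y => f y 0 i) (s *: x)).
  have [lu uG _] := W12_scaled s0 (f_W12 i : W12_gauss (fun x => (fun y : T => f y 0 i) (s *: x))).
  exact (weak_gradient_scale s0 lu uG).
have l1 i : locally_integrable_rV (fs i) by exact (locally_integrable_rVZ s (lf i)).
have := weak_gradient_W12_sob h (weak_gradient_dotv l1 (fun i => weak_gradientZ s (lf i) (hG i))).
congr (sob _ _); apply/funext => i; apply/funext => x.
rewrite mxE -[RHS]/(fs i x + Qfs i x) /Qfs fct_sumE; congr (_ + _).
by apply: eq_bigr => j _; rewrite !mxE fctE.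
Qed.

(* With v = x^T f, the terms quadratic in f cancel against those of E|grad v|^2. *)
Lemma variance_div : W12_gauss (fun x => dotv (s *: x) (f (s *: x))) ->
  let v := \sum_i X i * fs i in let Z := \sum_i dfs i i in
  [/\ ip mu Z Z - Ex mu Z ^+ 2 = Ex mu trfs + (ip mu v v - Ex mu v ^+ 2)
        - \sum_i ip mu (fs i) (fs i) - 2 * \sum_i ip mu (fs i) (Qfs i) &
      (ip mu v v - Ex mu v ^+ 2) - \sum_i ip mu (fs i) (fs i)
        - 2 * \sum_i ip mu (fs i) (Qfs i) <= \sum_i ip mu (Qfs i) (Qfs i)].
Proof.
move=> h v Z; have hv := sob_dotv_fs h.
have hf i : L2 mu (fs i) := sob_L2 (sob_fs i).
have hQ i : L2 mu (Qfs i).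
  have := L2B (sob_L2G i hv) (hf i); congr (L2 _ _).
  by rewrite addrAC subrr add0r.
have hZ : L2 mu Z by apply: L2_sum => i _; exact: sob_L2G (sob_fs i).
(* For v = x^T f~ the variable Z of this lemma is minus the divergence. *)
have [_] := variance_identity sob_fs hv.
rewrite sum_dl_fs addrAC subrr add0r -Ex_trfs.
have -> : ip mu (- \sum_i dfs i i) (- \sum_i dfs i i) = ip mu Z Z.
  by rewrite /ip mulrNN.
rewrite ExN ?sqrrN; last exact: L2_intg.
have -> : \sum_i ip mu (fs i - (fs i + Qfs i)) (fs i - (fs i + Qfs i)) = \sum_i ip mu (Qfs i) (Qfs i).
  by apply: eq_bigr => i _; rewrite opprD addNKr /ip mulrNN.
have eH : \sum_i ip mu (fs i + Qfs i) (fs i + Qfs i) =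
    \sum_i ip mu (fs i) (fs i) + 2 * (\sum_i ip mu (fs i) (Qfs i)) + \sum_i ip mu (Qfs i) (Qfs i).
  rewrite mulr_sumr -!big_split/=; apply: eq_bigr => i _.
  have hFQ := L2D (hf i) (hQ i).
  rewrite ipDl// !ipDr// (ipC _ (Qfs i) (fs i)).
  move: (ip _ _ _) (ip _ _ _) (ip _ _ _) => a b c; ring.
have := poincare hv; rewrite eH -/v -/Z {eH}.
move: (\sum_i ip mu (fs i) (fs i)) (\sum_i ip mu (fs i) (Qfs i)) (\sum_i ip mu (Qfs i) (Qfs i))
  (ip mu v v - Ex mu v ^+ 2) (ip mu Z Z - Ex mu Z ^+ 2) (Ex mu trfs) => a b c e g t h1 h2.
clear - h1 h2; split; lra.
Qed.

End scaled.

Unset Implicit Arguments.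
Theorem theorem2p2 (R : realType) (n : nat) (d : measure_display)
    (Omega : measurableType d) (P : probability Omega R) (sigma : R)
    (z : {RV P >-> 'rV[R]_n}) (f : 'rV[R]_n -> 'rV[R]_n)
    (sigma_gt0 : 0 < sigma)
    (z_normal : forall A : set 'rV[R]_n, measurable A ->
      distribution P z A = normal_rV sigma A)
    (f_W12 : forall i : 'I_n, W12_gauss (fun x => f (sigma *: x) 0 i)) :
  (forall g : 'rV[R]_n -> R, W12_gauss (fun x => g (sigma *: x)) ->
     let Vtilde := ('V_P[fun w => g (z w)]
       - (sigma ^+ 2)%:E * 'E_P[fun w => (enorm (wgrad g (z w)) ^+ 2)%R])%E in
     let rhs := ('E_P[fun w =>
        (sigma ^+ 2 * enorm (f (z w) - wgrad g (z w)) ^+ 2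
         + sigma ^+ 4 * \tr (nabla f (z w) *m nabla f (z w)))%R])%E in
     ('V_P[fun w =>
        (dotv (z w) (f (z w)) - sigma ^+ 2 * wdiv f (z w) - g (z w))%R]
      = rhs + Vtilde)%E
     /\ (rhs + Vtilde <= rhs)%E)
  /\
  (W12_gauss (fun x => dotv (sigma *: x) (f (sigma *: x))) ->
     let rhs :=
       ('E_P[fun w => \tr (nabla f (z w) *m nabla f (z w))]
        + 'V_P[fun w => (dotv (z w) (f (z w)) / sigma ^+ 2)%R]
        - 'E_P[fun w => (enorm (sigma^-1 *: f (z w)) ^+ 2)%R]
        - 2%:E * 'E_P[fun w =>
            ((f (z w) *m nabla f (z w) *m (z w)^T) 0 0 / sigma ^+ 2)%R])%E in
     ('V_P[fun w => wdiv f (z w)] = rhs)%E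
     /\ (rhs <= 'E_P[fun w => \tr (nabla f (z w) *m nabla f (z w))]
          + 'E_P[fun w =>
              (enorm (sigma^-1 *: (nabla f (z w) *m (z w)^T)^T) ^+ 2)%R])%E).

Proof.
have s1 : sigma != 0 by rewrite gt_eqF.
pose mu : probability 'rV[R]_n R := normal_rV 1.
have hG i j : L2 mu (dfs sigma f i j) := sob_L2G j (sob_fs sigma_gt0 f_W12 i).
have hU i : L2 mu (fs sigma f i) := sob_L2 (sob_fs sigma_gt0 f_W12 i).
have hT := intg_trfs sigma_gt0 f_W12.
split=> [g g_W12|v_W12].
- have [lg _ vH] := W12_scaled sigma_gt0 g_W12.
  set v := (fun x => g (sigma *: x)) in vH.
  set H := (fun i x => _) in vH.
  have hv : L2 mu v := sob_L2 vH; have hH i : L2 mu (H i) := sob_L2G i vH.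
  have [hZ eZ] := variance_identity (sob_fs sigma_gt0 f_W12) vH.
  have pv := poincare vH.
  have iH i : true -> intg mu (H i * H i) by move=> _; exact: L2_intgM.
  have iH' := @intg_sum _ _ _ mu _ (index_enum 'I_n) xpredT _ iH.
  have iB i : true -> intg mu ((fs sigma f i - H i) * (fs sigma f i - H i)).
    by move=> _; apply: L2_intgM; exact: L2B.
  have iB' := @intg_sum _ _ _ mu _ (index_enum 'I_n) xpredT _ iB.
  (* Each expectation and variance in the statement is rewritten on the standard Gaussian space. H
     carries a factor sigma, which accounts for the weight sigma^2. *)
  have e1 : 'V_P[fun w => g (z w)]%E = (ip mu v v - Ex mu v ^+ 2)%:E.
    exact: (@variance_rv _ _ _ _ _ _ _ sigma_gt0 z_normal g v (fun x => erefl) hv).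
  have e2 : ((sigma ^+ 2)%:E * 'E_P[fun w => (enorm (wgrad g (z w)) ^+ 2)%R] =
      (\sum_i ip mu (H i) (H i))%:E)%E.
    rewrite (@expectation_rv _ _ _ _ _ _ _ sigma_gt0 z_normal (fun x => enorm (wgrad g x) ^+ 2)
      ((sigma ^+ 2)^-1 *: (\sum_i H i * H i))).
    - by rewrite ExZ// -EFinM mulVKf ?expf_neq0// Ex_sum.
    - move=> x; rewrite sqr_enorm -[RHS]/((sigma ^+ 2)^-1 * (\sum_i H i * H i) x).
      rewrite fct_sumE mulr_sumr; apply: eq_bigr => i _.
      by rewrite fctE /H -expr2 exprMn mulKf ?expf_neq0.
    - exact: intgZ.
  have e3 : 'E_P[fun w => (sigma ^+ 2 * enorm (f (z w) - wgrad g (z w)) ^+ 2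
         + sigma ^+ 4 * \tr (nabla f (z w) *m nabla f (z w)))%R]%E =
     (\sum_i ip mu (fs sigma f i - H i) (fs sigma f i - H i) +
      \sum_i \sum_j ip mu (dfs sigma f i j) (dfs sigma f j i))%:E.
    rewrite (@expectation_rv _ _ _ _ _ _ _ sigma_gt0 z_normal
      (fun x => sigma ^+ 2 * enorm (f x - wgrad g x) ^+ 2 + sigma ^+ 4 * \tr (nabla f x *m nabla f x))
      ((\sum_i (fs sigma f i - H i) * (fs sigma f i - H i)) + trfs sigma f)).
    - by rewrite ExD// Ex_trfs// Ex_sum.
    - move=> x; rewrite -trfsE; congr (_ + _).
      rewrite sqr_enorm fct_sumE mulr_sumr; apply: eq_bigr => i _.
      by rewrite !fctE fsE /H !mxE; ring.
    - exact: intgD.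
  have e4 : 'V_P[fun w => (dotv (z w) (f (z w)) - sigma ^+ 2 * wdiv f (z w) - g (z w))%R]%E =
     (ip mu (\sum_i dl i (fs sigma f i) (dfs sigma f i i) - v) (\sum_i dl i (fs sigma f i) (dfs sigma f i i) - v)
       - Ex mu (\sum_i dl i (fs sigma f i) (dfs sigma f i i) - v) ^+ 2)%:E.
    rewrite (@variance_rv _ _ _ _ _ _ _ sigma_gt0 z_normal (fun x => dotv x (f x) - sigma ^+ 2 * wdiv f x - g x) _ _ hZ)//.
    by move=> x; rewrite sum_dl_fs -dotv_fs -wdiv_dfs.
  rewrite e1 e2 e3 e4 eZ; split; first by rewrite -EFinB -EFinD.
  by rewrite -EFinB -EFinD lee_fin gerDl subr_le0.
- have [eD leD] := variance_div sigma_gt0 f_W12 v_W12.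
  have vH := sob_dotv_fs sigma_gt0 f_W12 v_W12.
  have hv := sob_L2 vH.
  have hQ i : L2 mu (Qfs sigma f i).
    have := L2B (sob_L2G i vH) (hU i); congr (L2 _ _).
    by rewrite addrAC subrr add0r.
  set v := \sum_i X i * _ in eD leD hv.
  set Z := \sum_i dfs _ _ _ _ in eD.
  have hZ : L2 mu Z by apply: L2_sum.
  (* The components [fs], [dfs] and [Qfs] carry sigma, sigma^2 and sigma, so each term of the
     statement is sigma^(-4) times its counterpart in [variance_div]. *)
  have e1 : 'E_P[fun w => \tr (nabla f (z w) *m nabla f (z w))]%E =
      ((sigma ^+ 4)^-1 * Ex mu (trfs sigma f))%:E.
    rewrite (@expectation_rv _ _ _ _ _ _ _ sigma_gt0 z_normal (fun x => \tr (nabla f x *m nabla f x))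
      ((sigma ^+ 4)^-1 *: trfs sigma f)).
    - by rewrite ExZ.
    - by move=> x; rewrite -[RHS]/(_ * trfs sigma f x) trfsE mulKf ?expf_neq0.
    - exact: intgZ.
  have e2 : 'V_P[fun w => (dotv (z w) (f (z w)) / sigma ^+ 2)%R]%E =
      ((sigma ^+ 4)^-1 * (ip mu v v - Ex mu v ^+ 2))%:E.
    rewrite (@variance_rv _ _ _ _ _ _ _ sigma_gt0 z_normal (fun x => dotv x (f x) / sigma ^+ 2)
      ((sigma ^+ 2)^-1 *: v) _ (L2Z _ hv)).
      congr EFin; have hv' := L2Z (sigma ^+ 2)^-1 hv.
      rewrite ipZl// ipZr// ExZ; last exact: L2_intg.
      by move: (ip _ _ _) (Ex _ _) => a b; field.
    by move=> x; rewrite -dotv_fs mulrC.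
  have e3 : 'E_P[fun w => (enorm (sigma^-1 *: f (z w)) ^+ 2)%R]%E =
      ((sigma ^+ 4)^-1 * \sum_i ip mu (fs sigma f i) (fs sigma f i))%:E.
    have iU i : true -> intg mu (fs sigma f i * fs sigma f i).
      by move=> _; exact: L2_intgM.
    have iU' := @intg_sum _ _ _ mu _ (index_enum 'I_n) xpredT _ iU.
    rewrite (@expectation_rv _ _ _ _ _ _ _ sigma_gt0 z_normal (fun x => enorm (sigma^-1 *: f x) ^+ 2)
      ((sigma ^+ 4)^-1 *: (\sum_i fs sigma f i * fs sigma f i))).
    - by rewrite ExZ// Ex_sum.
    - move=> x; rewrite sqr_enorm -[RHS]/(_ * (\sum_i _) x) fct_sumE mulr_sumr.
      by apply: eq_bigr => i _; rewrite fctE fsE mxE; field.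
    - exact: intgZ.
  have e4 : 'E_P[fun w => ((f (z w) *m nabla f (z w) *m (z w)^T) 0 0 / sigma ^+ 2)%R]%E =
      ((sigma ^+ 4)^-1 * \sum_i ip mu (fs sigma f i) (Qfs sigma f i))%:E.
    have iU i : true -> intg mu (fs sigma f i * Qfs sigma f i).
      by move=> _; exact: L2_intgM.
    have iU' := @intg_sum _ _ _ mu _ (index_enum 'I_n) xpredT _ iU.
    rewrite (@expectation_rv _ _ _ _ _ _ _ sigma_gt0 z_normal
      (fun x => (f x *m nabla f x *m x^T) 0 0 / sigma ^+ 2)
      ((sigma ^+ 4)^-1 *: (\sum_i fs sigma f i * Qfs sigma f i))).
    - by rewrite ExZ// Ex_sum.
    - move=> x; rewrite -mulmxA mxE mulr_suml -[RHS]/(_ * (\sum_i _) x) fct_sumE mulr_sumr.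
      by apply: eq_bigr => i _; rewrite fctE fsE QfsE; field.
    - exact: intgZ.
  have e5 : 'E_P[fun w => (enorm (sigma^-1 *: (nabla f (z w) *m (z w)^T)^T) ^+ 2)%R]%E =
      ((sigma ^+ 4)^-1 * \sum_i ip mu (Qfs sigma f i) (Qfs sigma f i))%:E.
    have iU i : true -> intg mu (Qfs sigma f i * Qfs sigma f i).
      by move=> _; exact: L2_intgM.
    have iU' := @intg_sum _ _ _ mu _ (index_enum 'I_n) xpredT _ iU.
    rewrite (@expectation_rv _ _ _ _ _ _ _ sigma_gt0 z_normal
      (fun x => enorm (sigma^-1 *: (nabla f x *m x^T)^T) ^+ 2)
      ((sigma ^+ 4)^-1 *: (\sum_i Qfs sigma f i * Qfs sigma f i))).
    - by rewrite ExZ// Ex_sum.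
    - move=> x; rewrite sqr_enorm -[RHS]/(_ * (\sum_i _) x) fct_sumE mulr_sumr.
      by apply: eq_bigr => i _; rewrite fctE QfsE !mxE; field.
    - exact: intgZ.
  have e6 : 'V_P[fun w => wdiv f (z w)]%E = ((sigma ^+ 4)^-1 * (ip mu Z Z - Ex mu Z ^+ 2))%:E.
    rewrite (@variance_rv _ _ _ _ _ _ _ sigma_gt0 z_normal (wdiv f)
      ((sigma ^+ 2)^-1 *: Z) _ (L2Z _ hZ)).
      congr EFin; have hZ' := L2Z (sigma ^+ 2)^-1 hZ.
      rewrite ipZl// ipZr// ExZ; last exact: L2_intg.
      by move: (ip _ _ _) (Ex _ _) => a b; field.
    by move=> x; rewrite -[RHS]/(_ * Z x) /Z wdiv_dfs mulKf ?expf_neq0.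
  (* What remains is [variance_div] multiplied by the nonnegative constant sigma^(-4). *)
  rewrite e1 e2 e3 e4 e5 e6 eD {e1 e2 e3 e4 e5 e6 eD}.
  have c0 : 0 <= (sigma ^+ 4)^-1 by rewrite invr_ge0 exprn_ge0// ltW.
  move: leD; set A := \sum_i ip _ _ _; set B := \sum_i ip _ _ _; set C := \sum_i ip _ _ _.
  set V := ip _ _ _ - _; set E := Ex _ _.
  move: A B C V E ((sigma ^+ 4)^-1) c0 => A B C V E c c0 le1.
  have le2 := ler_wpM2l c0 le1; clear - le2; rewrite -EFinM -!EFinN -!EFinD; split.
    by congr EFin; ring.
  by rewrite lee_fin; move: le2; lra.
Qed.
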